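(* Let $k\ge 4$ be a fixed integer. There is a set $S$ of positive integers of asymptotic density $1$ such that for every $n\in S$, \[ n \text{ is } k\text{-free} \iff s(n) \text{ is } k\text{-free}. \]
   Context: For a positive integer $n$, $s(n):=\sum_{d\mid n,\ d<n} d$ is the sum of the proper divisors of $n$ (so $s(n)=\sigma(n)-n$, where $\sigma$ is the sum-of-divisors function). An integer is called $k$-free ($k$th-power-free) if it is not divisible by the $k$th power of any integer larger than $1$. *)

(* Defs.v *)
From mathcomp Require Import all_boot all_order all_algebra.
From mathcomp Require Import boolp classical_sets reals topology normedtype.
From mathcomp Require Import sequences.

Set Implicit Arguments.
Unset Strict Implicit.
Unset Printing Implicit Defensive.

Import numFieldNormedType.Exports.

Definition aliquot_sum (n : nat) : nat := \sum_(1 <= d < n | d %| n) d.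

(* With this definition 0 is not k-free; this concerns aliquot_sum 1 = 0. *)
Definition kfree (k n : nat) : Prop := forall d : nat, 1 < d -> ~~ (d ^ k %| n).

Definition counting_fun (S : set nat) (N : nat) : nat :=
  \sum_(1 <= n < N.+1 | n \in S) 1.

Definition has_asymptotic_density (R : realType) (S : set nat) (delta : R) :
    Prop :=
  ((fun N : nat => (counting_fun S N)%:R / N%:R : R)%R @ \oo --> delta)%classic.

(* Main.v *)
Require Import Defs.
From mathcomp Require Import all_boot all_order all_algebra.
From mathcomp Require Import boolp classical_sets reals topology normedtype.
From mathcomp Require Import sequences exp.
From mathcomp Require Import zify ring lra.

(** For a prime [p], almost every [n] has [p ^ k %| sigma n]: the reciprocals of
    the primes [q = -1] mod [p] have a divergent sum, so by Turan's inequality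
    almost every [n] is exactly divisible by at least [k] of them. For such [n],
    [p ^ k] divides [n] iff it divides [s(n) = sigma n - n]. It remains to see
    that few [n] have [p ^ 4 %| s(n)] for some [p] above a slowly growing bound.

    - If [n = m * q] with [q] a prime not dividing [m], then
      [s(n) = q * s(m) + sigma m], so [m] and [p] fix [q] modulo [p ^ 4], up to
      the factor [gcd(s(m), p ^ 4)], which must divide [m]. For [p] up to about
      the square root of [log n] the primes [p] are grouped into ranges
      [T < p <= T ^ 2] and [q] is taken between [2 ^ (2 T)] and [2 ^ (T ^ 2)];
      for larger [p] any [q > p * (log n) ^ 2] will do.
    - If all the prime factors of [n] are at most [p * (log n) ^ 2], then [p] is
      at least a power of [n], and [n = d * e] with [d] and [e] coprime, [e] odd
      and squarefree, and [p * (log n) ^ 2 < e <= p ^ 2 / log n]. Given [d] and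
      [p], the congruence [sigma d * sigma e = d * e] mod [p ^ 4] determines the
      rational number [sigma e / e], hence [e]; so there are few such [n].

    The divergence over primes [q = -1] mod [p] is proved with real functions
    only. If it failed, a limit point [a] of the distribution, with weights
    [ln q / q], of the primes among the residues mod [p] would vanish at [-1];
    log = Lambda * 1 and Moebius inversion give [a * a + a = 2 / (p - 1)]
    (convolution on the nonzero residues), which forces [a] to come from a
    quadratic character [chi] with [L(1, chi) = 0]. This is absurd because the
    Lambert series of [chi] is bounded at 1 while its coefficients
    [sum_(d | n) chi d] are nonnegative and equal to 1 at the powers of [p]. *)

Set Implicit Arguments.
Unset Strict Implicit.
Unset Printing Implicit Defensive.

Import Order.TTheory GRing.Theory Num.Theory.
Import numFieldNormedType.Exports.

(** * The sum of divisors *)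

(** The exponent 4 enters twice. A window of primes [q] up to [2 ^ b] costs about [b * N / p ^ 4]
    for each [p]; as [b <= p ^ 2], the sum over [p > T] is still [O(N / T)]. And [sigma e / e] can
    be recovered from its residue modulo [p ^ 4] because [e] stays below [p ^ 2 / log n], so that
    the cross products are smaller than the modulus. The ranges of [p] are forced by the integers
    that have no prime factor in the chosen window. Their proportion is [O(1 / r)], too large to be
    paid once for every [p]. Hence one window serves all [p] between [T = 2 * 4 ^ r] and about
    [T ^ 2]; the next range has [2 * r] in place of [r], and the costs form a geometric series. The
    scheme stops when the window no longer fits below [N]. From there on [q > p * (log n) ^ 2] costs
    [N / (p * (log n) ^ 2)], and the square of the logarithm beats the harmonic sum over [p]. *)

Definition sigma (n : nat) : nat := \sum_(d <- divisors n) d.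

Lemma divisorsE n : 0 < n -> perm_eq (divisors n) [seq d <- index_iota 1 n.+1 | d %| n].
Proof.
move=> n0; apply: uniq_perm; first exact: divisors_uniq.
  by rewrite filter_uniq // iota_uniq.
move=> d; rewrite -dvdn_divisors // mem_filter mem_index_iota.
case: (boolP (d %| n)) => //= dn; by rewrite ltnS (dvdn_leq n0 dn) andbT (dvdn_gt0 n0 dn).
Qed.

Lemma sigmaE n : 0 < n -> sigma n = aliquot_sum n + n.
Proof.
move=> n0; rewrite /sigma (perm_big _ (divisorsE n0)) /= big_filter.
by rewrite big_mkcond big_nat_recr //= dvdnn -big_mkcond.
Qed.

Lemma divisorsM m n : 0 < m -> 0 < n -> coprime m n ->
  perm_eq (divisors (m * n)) [seq a * b | a <- divisors m, b <- divisors n].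
Proof.
move=> m0 n0 cmn; apply: uniq_perm; first exact: divisors_uniq.
  apply: allpairs_uniq; rewrite ?divisors_uniq //.
  move=> [a b] [a' b'] /allpairsP[[x y]/= [xm yn [-> ->]]].
  move=> /allpairsP[[x' y']/= [xm' yn' [-> ->]]] {a b a' b'} /= E.
  move: xm yn xm' yn'; rewrite -!dvdn_divisors // => xm yn xm' yn'.
  have P u v : u %| m -> v %| n -> gcdn m (u * v) = u.
    by move=> um vn; rewrite Gauss_gcdl ?(coprime_dvdr vn) //; apply/gcdn_idPr.
  have Q u v : u %| m -> v %| n -> gcdn n (u * v) = v.
    move=> um vn; rewrite Gauss_gcdr; first by apply/gcdn_idPr.
    by rewrite coprime_sym (coprime_dvdl um).
  by rewrite -(P x y) // -{2}(Q x y) // E P // Q.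
move=> d; rewrite -dvdn_divisors ?muln_gt0 ?m0 //.
apply/idP/allpairsP => [dmn|[[a b] /= []]]; last first.
  by rewrite -!dvdn_divisors // => am bn ->; rewrite dvdn_mul.
exists (gcdn d m, gcdn d n) => /=; rewrite -!dvdn_divisors ?dvdn_gcdr //; split=> //.
apply/eqP; rewrite eqn_dvd; apply/andP; split.
  rewrite muln_gcdr !muln_gcdl !dvdn_gcd dmn dvdn_mulr // dvdn_mull //.
  by rewrite dvdn_mulr.
rewrite Gauss_dvd ?dvdn_gcdl //.
by rewrite (coprime_dvdl (dvdn_gcdr _ _)) // (coprime_dvdr (dvdn_gcdr _ _)).
Qed.

Lemma sigmaM m n : 0 < m -> 0 < n -> coprime m n -> sigma (m * n) = sigma m * sigma n.
Proof.
move=> m0 n0 cmn; rewrite /sigma (perm_big _ (divisorsM m0 n0 cmn)) /= big_allpairs_dep /=.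
rewrite big_distrl; apply: eq_bigr => i _ /=; by rewrite big_distrr.
Qed.


Lemma sigma_prime p : prime p -> sigma p = p.+1.
Proof.
move=> pp; have p1 := prime_gt1 pp.
have P : perm_eq (divisors p) [:: 1; p].
  apply: uniq_perm; [exact: divisors_uniq|by rewrite /= inE neq_ltn p1|].
  move=> d; rewrite -dvdn_divisors ?prime_gt0 // !inE.
  by apply/idP/orP => [|[]/eqP -> //]; case/primeP: pp => _ H /H /orP.
by rewrite /sigma (perm_big _ P) /= !big_cons big_nil addn0 add1n.
Qed.

Lemma leq_sigma n : 0 < n -> n <= sigma n.
Proof. by move=> n0; rewrite sigmaE // leq_addl. Qed.

(** The dyadic block starting at [2 ^ j] has [2 ^ j] terms, each at most [N %/ 2 ^ j]. *)
Lemma sum_divn_pow2 N j : \sum_(1 <= d < 2 ^ j) N %/ d <= N * j.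
Proof.
elim: j => [|j IH]; first by rewrite expn0 big_geq.
rewrite (big_cat_nat (n := 2 ^ j)) ?expn_gt0 ?leq_exp2l //= mulnS addnC leq_add //.
apply: (@leq_trans (\sum_(2 ^ j <= d < 2 ^ j.+1) N %/ 2 ^ j)).
  rewrite big_nat_cond [leqRHS]big_nat_cond; apply: leq_sum => d.
  by rewrite andbT => /andP[? _]; rewrite leq_div2l // expn_gt0.
rewrite big_const_nat iter_addn_0 expnS mul2n -addnn addnK.
exact: leq_trunc_div.
Qed.

(** Pairing [d] with [n / d] makes [sigma n] a sum of [n / d] over the divisors, which is enlarged
    to all [d] below a power of 2 exceeding [n]. The binary logarithm keeps the bound inside
    [nat]. *)
Lemma sigma_le n : 0 < n -> sigma n <= n * (trunc_log 2 n).+1.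
Proof.
move=> n0; apply: (leq_trans _ (sum_divn_pow2 n _)).
have P : perm_eq (divisors n) [seq n %/ d | d <- divisors n].
  apply: uniq_perm; first exact: divisors_uniq.
    rewrite map_inj_in_uniq ?divisors_uniq // => a b.
    rewrite -!dvdn_divisors // => an bn E.
    by rewrite -(mulKn a n0) -(divnA n an) E divnA // mulKn.
  move=> d; apply/idP/mapP => [|[c]]; rewrite -!dvdn_divisors // => dn.
    exists (n %/ d); first by rewrite -dvdn_divisors // dvdn_div.
    by rewrite divnA // mulKn.
  by move=> ->; rewrite dvdn_div.
rewrite /sigma (perm_big _ P) big_map (perm_big _ (divisorsE n0)) big_filter.
rewrite big_mkcond (big_cat_nat (n := n.+1) (p := 2 ^ _)) //=; last exact: trunc_log_ltn.
apply: (leq_trans _ (leq_addr _ _)); apply: leq_sum => d _; by case: ifP.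
Qed.

Definition sqfree (n : nat) : Prop := forall p, prime p -> ~~ (p ^ 2 %| n).

Lemma sqfreeM p m : prime p -> sqfree (p * m) -> coprime p m /\ sqfree m.
Proof.
move=> pp sq; split.
  by rewrite prime_coprime //; apply: contra (sq _ pp) => pm; rewrite dvdn_mul.
by move=> q qp; apply: contra (sq _ qp) => qm; rewrite dvdn_mull.
Qed.

Lemma prime_dvd_sigma l e : 0 < e -> prime l -> sqfree e -> l %| sigma e ->
  exists q, [/\ prime q, q %| e & l %| q.+1].
Proof.
move=> + lp; have [n] := ubnP e; elim: n e => // n IH e; rewrite ltnS => en e0 sq.
have [e1|e1] := leqP e 1.
  have -> : e = 1 by lia.
  rewrite /sigma (_ : divisors 1 = [:: 1]) // big_seq1.
  by rewrite dvdn1 => /eqP l1; rewrite l1 in lp.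
move: (pdiv e) (pdiv_prime e1) (pdiv_dvd e) => q qp qe.
move/dvdnP: (qe) => [f ef]; rewrite mulnC in ef.
have f0 : 0 < f by move: e0; rewrite ef muln_gt0 => /andP[].
rewrite ef in sq *; have [cqf sf] := sqfreeM qp sq.
rewrite sigmaM //; last exact: prime_gt0.
rewrite (sigma_prime qp) Euclid_dvdM // => /orP[lq|lf].
  by exists q; rewrite dvdn_mulr.
have [] := IH f _ f0 sf lf; last by move=> r [? ? ?]; exists r; rewrite dvdn_mull.
by apply: (leq_trans _ en); rewrite ef ltn_Pmull // prime_gt1.
Qed.

(* The largest prime factor of an odd [e] divides no [q + 1] with [q] a prime
   factor of [e], so it survives in the denominator of [sigma e / e]. *)
Lemma sigma_ratio_inj e e' : 0 < e -> 0 < e' -> odd e -> odd e' ->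
  sqfree e -> sqfree e' -> e * sigma e' = e' * sigma e -> e = e'.
Proof.
have [n] := ubnP (e + e'); elim: n e e' => // n IH e e'; rewrite ltnS.
wlog : e e' / max_pdiv e' <= max_pdiv e.
  move=> W; case: (leqP (max_pdiv e') (max_pdiv e)) => H; first exact: W.
  move=> en e0 e0' oe oe' se se' E; apply/esym/W => //; first exact: ltnW.
  by rewrite addnC.
move=> mm en e0 e0' oe oe' se se' E.
have [e1|e1] := leqP e 1.
  have [e1'|e1'] := leqP e' 1; first by lia.
  have ee : e = 1 by lia.
  by move: mm; rewrite ee (_ : max_pdiv 1 = 1) // leqNgt prime_gt1 // max_pdiv_prime.
have lp := max_pdiv_prime e1; have le := max_pdiv_dvd e.
have lmax q : prime q -> q %| e -> q <= max_pdiv e.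
  by move=> qp qe; apply: max_pdiv_max; rewrite mem_primes qp e0.
move: (max_pdiv e) mm lp le lmax => l mm lp le lmax.
have ol : odd l by apply: dvdn_odd oe.
have nl : ~~ (l %| sigma e).
  apply/negP => /(prime_dvd_sigma e0 lp se)[q [qp qe lq]].
  have oq : odd q by apply: dvdn_odd oe.
  have ql := lmax _ qp qe.
  (* As [l] and [q] are odd, [l] divides [(q + 1) / 2], which is smaller than [l] because
     [q <= l]. *)
  have := lq; rewrite -[q.+1]odd_double_half /= oq add0n -mul2n Gauss_dvdr; last first.
    by rewrite coprimen2.
  move=> /dvdn_leq; have := prime_gt1 lp; have := odd_double_half q; rewrite oq; lia.
have le' : l %| e'.
  have : l %| e' * sigma e by rewrite -E dvdn_mulr.
  by rewrite Euclid_dvdM // (negPf nl) orbF.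
move/dvdnP: (le) => [f ef]; move/dvdnP: (le') => [f' ef'].
rewrite mulnC in ef; rewrite mulnC in ef'.
have f0 : 0 < f by move: e0; rewrite ef muln_gt0 => /andP[].
have f0' : 0 < f' by move: e0'; rewrite ef' muln_gt0 => /andP[].
have l0 := prime_gt0 lp.
move: se se' oe oe' E; rewrite ef ef' !oddM => se se' /andP[_ oe] /andP[_ oe'].
have [c sf] := sqfreeM lp se; have [c' sf'] := sqfreeM lp se'.
rewrite !sigmaM // sigma_prime // => /eqP E; congr (_ * _); apply: IH => //.
  apply: (leq_trans _ en); rewrite ef ef' -mulnDr ltn_Pmull ?prime_gt1 //; lia.
move: E; rewrite -!mulnA eqn_pmul2l // !(mulnCA _ l.+1) eqn_pmul2l //.
by move/eqP.
Qed.

(** * Counting integers up to [N], and the two basic congruence counts *)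

Definition cnt (N : nat) (P : nat -> Prop) : nat :=
  count (fun n => `[< P n >]) (iota 1 N).

Lemma cnt_sub N (P Q : nat -> Prop) :
  (forall n, 0 < n <= N -> P n -> Q n) -> cnt N P <= cnt N Q.
Proof.
move=> H; rewrite /cnt -!size_filter; apply: uniq_leq_size.
  by rewrite filter_uniq // iota_uniq.
move=> n; rewrite !mem_filter mem_iota add1n ltnS => /andP[/asboolP Pn nN].
by rewrite nN andbT; apply/asboolP/H.
Qed.

Lemma cnt_or N (P Q : nat -> Prop) :
  cnt N (fun n => P n \/ Q n) <= cnt N P + cnt N Q.
Proof.
rewrite /cnt -count_predUI; apply: leq_trans (leq_addr _ _).
by apply: sub_count => n /= /asboolP[] ?; apply/orP; [left|right]; apply/asboolP.
Qed.

Lemma cnt_ex N (I : eqType) (s : seq I) (P : nat -> Prop) (Q : I -> nat -> Prop) :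
  (forall n, 0 < n <= N -> P n -> exists2 i, i \in s & Q i n) ->
  cnt N P <= \sum_(i <- s) cnt N (Q i).
Proof.
elim: s P => [|i s IH] P H.
  rewrite big_nil leqn0 /cnt -leqn0 leqNgt -has_count; apply/hasPn => n.
  rewrite mem_iota add1n ltnS => nN; apply/asboolP => Pn.
  by have [] := H _ nN Pn.
rewrite big_cons; apply: (leq_trans (cnt_sub (Q := fun n => Q i n \/
  exists2 j, j \in s & Q j n) _)).
  move=> n nN /(H _ nN)[j]; rewrite inE => /predU1P[->|js] Qj; first by left.
  by right; exists j.
by apply: (leq_trans (cnt_or _ _ _)); rewrite leq_add2l; apply: IH.
Qed.

Lemma cnt_le_size N (P : nat -> Prop) (T : eqType) (f : nat -> T) (s : seq T) :
  (forall n, 0 < n <= N -> P n -> f n \in s) ->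
  (forall m n, P m -> P n -> f m = f n -> m = n) -> cnt N P <= size s.
Proof.
move=> fs fi; rewrite /cnt -size_filter -(size_map f); apply: uniq_leq_size.
  rewrite map_inj_in_uniq ?filter_uniq ?iota_uniq // => m n.
  by rewrite !mem_filter => /andP[/asboolP ? _] /andP[/asboolP ? _]; apply: fi.
move=> t /mapP[n]; rewrite mem_filter mem_iota add1n ltnS => /andP[/asboolP Pn nN] ->.
exact: fs.
Qed.

Lemma cnt_le1 N (P : nat -> Prop) :
  (forall m n, P m -> P n -> m = n) -> cnt N P <= 1.
Proof. by move=> H; apply: (@cnt_le_size _ _ _ (fun=> tt) [:: tt]) => // m n Pm Pn _; apply: H. Qed.

Lemma cnt_dvd N d : 0 < d -> cnt N (fun n => d %| n) <= N %/ d.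
Proof.
move=> d0; rewrite -[leqRHS](size_iota 1).
apply: (@cnt_le_size _ _ _ (fun n => n %/ d)) => [n /andP[n0 nN] dn|m n dm dn E].
  by rewrite mem_iota add1n ltnS leq_div2r // andbT divn_gt0 // dvdn_leq.
by rewrite -(divnK dm) -(divnK dn) E.
Qed.

Lemma sum_dvdn N d : 0 < d -> \sum_(m <- iota 1 N) (d %| m) <= N %/ d.
Proof.
move=> d0; apply: leq_trans (cnt_dvd N d0); rewrite /cnt -sum1_count [leqRHS]big_mkcond /=.
by apply: leq_sum => m _; rewrite asboolb; case: (d %| m).
Qed.

Lemma modn_mul2l M d a b : coprime M d -> d * a = d * b %[mod M] -> a = b %[mod M].
Proof.
move=> c; wlog ab : a b / a <= b.
  by move=> W; case: (leqP a b) => [/W//|/ltnW/W H] E; apply/esym/H/esym.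
move=> /esym/eqP; rewrite eqn_mod_dvd ?leq_mul2l ?ab ?orbT // -mulnBr Gauss_dvdr //.
by move=> H; apply/esym/eqP; rewrite eqn_mod_dvd.
Qed.

(* If [n = d * e] with [d] given, then [e] is pinned down by [M %| s(n)]: the
   congruence [sigma d * sigma e = d * e] mod [M] fixes [sigma e / e] mod [M],
   hence exactly as [M] is large. *)
Lemma cnt_unitary_divisor N M E1 E2 : 0 < E1 ->
  (forall e e', 0 < e <= E2 -> 0 < e' <= E2 -> e * sigma e' < M) ->
  cnt N (fun n => [/\ coprime M n, M %| aliquot_sum n &
    exists d e, [/\ n = d * e, coprime d e, odd e, sqfree e & E1 < e <= E2]])
  <= N %/ E1.
Proof.
move=> E10 Hlt; pose Q d n := [/\ 0 < d, coprime M n, M %| aliquot_sum n &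
  exists e, [/\ n = d * e, coprime d e, odd e, sqfree e & E1 < e <= E2]].
apply: (leq_trans (cnt_ex (s := iota 1 (N %/ E1)) (Q := Q) _)).
  move=> n /andP[n0 nN] [cn Mn [d [e [nde cde oe se /andP[e1 e2]]]]]; exists d.
    rewrite mem_iota add1n ltnS; apply/andP; split.
      by move: n0; rewrite nde muln_gt0 => /andP[].
    rewrite leq_divRL //; apply: (leq_trans _ nN); rewrite nde.
    by rewrite leq_mul2l (ltnW e1) orbT.
  split=> //; first by move: n0; rewrite nde muln_gt0 => /andP[].
  by exists e; rewrite e1 e2; split.
apply: (@leq_trans (\sum_(i <- iota 1 (N %/ E1)) 1)).
  apply: leq_sum => d _; apply: cnt_le1 => m n.
  move=> [d0 cm Mm [e [mE cde oe se /andP[e1 e2]]]].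
  move=> [_ cn Mn [e' [nE cde' oe' se' /andP[e1' e2']]]]; subst m n.
  have e0 : 0 < e by apply: leq_ltn_trans e1.
  have e0' : 0 < e' by apply: leq_ltn_trans e1'.
  congr (_ * _); apply: sigma_ratio_inj => //.
  have cMd : coprime M d by exact: coprime_dvdr (dvdn_mulr e (dvdnn d)) cm.
  have H x : 0 < x -> coprime d x -> M %| aliquot_sum (d * x) ->
      sigma d * sigma x = d * x %[mod M].
    move=> x0 cx Mx; rewrite -sigmaM // sigmaE ?muln_gt0 ?d0 //.
    by rewrite -modnDml (eqP Mx) add0n.
  (* Both sides times [d] are congruent to [sigma d * sigma e * sigma e'], and [d] is invertible
     modulo [M]. *)
  have L : e * sigma e' = e' * sigma e %[mod M].
    apply: (modn_mul2l cMd).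
    rewrite !mulnA -modnMml -(H e) // modnMml -(modnMml (d * e')) -(H e') //.
    by rewrite modnMml mulnAC.
  move: L; rewrite !modn_small //; apply: Hlt; lia.
by rewrite sum1_size size_iota.
Qed.

(** Affine in [q]: for fixed [m], divisibility of [s(m * q)] is a linear congruence for [q]. *)
Lemma aliquot_sum_prime m q : 0 < m -> prime q -> coprime m q ->
  aliquot_sum (m * q) = q * aliquot_sum m + sigma m.
Proof.
move=> m0 qp c; have q0 := prime_gt0 qp.
have := sigmaM m0 q0 c; rewrite (sigma_prime qp) !sigmaE ?muln_gt0 ?m0 //; nia.
Qed.

(* With [n = m * q] one has [s(n) = q * s(m) + sigma m]; if [M] divides it, then
   [g = gcd(s(m), M)] divides [m = sigma m - s(m)] and [q] lies in one class
   modulo [M / g], so that the loss and the gain of a factor [g] cancel. *)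
Lemma cnt_prime_factor N M Q : 0 < M -> 0 < Q ->
  cnt N (fun n => M %| aliquot_sum n /\
    exists m q, [/\ n = m * q, prime q, coprime m q & Q < q <= Q.*2])
  <= size (divisors M) * (N %/ M + (N %/ Q).*2).
Proof.
move=> M0 Q0; pose P m n := M %| aliquot_sum n /\
  exists q, [/\ 0 < m, n = m * q, prime q, coprime m q & Q < q <= Q.*2].
apply: (leq_trans (cnt_ex (s := iota 1 (N %/ Q)) (Q := P) _)).
  move=> n /andP[n0 nN] [Mn [m [q [nE qp c /andP[q1 q2]]]]]; exists m.
    rewrite mem_iota add1n ltnS; apply/andP; split.
      by move: n0; rewrite nE muln_gt0 => /andP[].
    rewrite leq_divRL //; apply: (leq_trans _ nN); rewrite nE.
    by rewrite leq_mul2l (ltnW q1) orbT.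
  split=> //; exists q; rewrite q1 q2; split => //.
  by move: n0; rewrite nE muln_gt0 => /andP[].
(* The relevant gcd depends on [m]. Summing over every divisor [g] of [M] that divides [m] removes
   this dependence, at the price of the factor [size (divisors M)]. *)
apply: (@leq_trans (\sum_(m <- iota 1 (N %/ Q)) \sum_(g <- divisors M)
    (g %| m) * (Q %/ (M %/ g)).+2)).
  apply: leq_sum => m _.
  have [[n Pn]|noP] := pselect (exists n, P m n); last first.
    rewrite (_ : cnt N _ = 0) //; apply/eqP; rewrite -leqn0 leqNgt -has_count.
    by apply/hasPn => n _; apply/asboolP => Pn; apply: noP; exists n.
  set g := gcdn (aliquot_sum m) M.
  have g0 : 0 < g by rewrite gcdn_gt0 M0 orbT.
  have gM : g %| M by apply: dvdn_gcdr.
  have gs : g %| aliquot_sum m by apply: dvdn_gcdl.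
  have gm : g %| m.
    case: Pn => Mn [q [m0 nE qp c _]]; move: Mn.
    rewrite nE aliquot_sum_prime // sigmaE // addnA -mulSnr => /(dvdn_trans gM).
    by rewrite dvdn_addr // dvdn_mull.
  have gd : g \in divisors M by rewrite -dvdn_divisors.
  rewrite (perm_big _ (perm_to_rem gd)) /= big_cons gm mul1n.
  apply: (leq_trans _ (leq_addr _ _)); set D := M %/ g.
  have D0 : 0 < D by rewrite divn_gt0 // dvdn_leq.
  rewrite -[leqRHS](size_iota (Q %/ D)).
  (* Since [q] is fixed modulo [D], it is known from [q %/ D], which lies between [Q %/ D] and
     [2 * (Q %/ D) + 1]. *)
  apply: (@cnt_le_size _ _ _ (fun n => (n %/ m) %/ D)).
    move=> k _ [_ [q [m0 -> _ _ /andP[q1 q2]]]]; rewrite mulKn // mem_iota.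
    rewrite leq_div2r ?(ltnW q1) //=; apply: (leq_ltn_trans (leq_div2r D q2)).
    rewrite -muln2; have := divn_eq Q D; have := ltn_pmod Q D0.
    move: (Q %/ D) (Q %% D) => a b bD QE; rewrite ltn_divLR // QE; nia.
  move=> k k' [Mk [q [m0 kE qp c _]]] [Mk' [q' [_ kE' qp' c' _]]]; subst k k'.
  rewrite !mulKn // => E; congr (_ * _).
  suff R : q = q' %[mod D] by rewrite (divn_eq q D) (divn_eq q' D) E R.
  move: Mk Mk'; rewrite !aliquot_sum_prime // => Mk Mk'.
  wlog qq : q q' qp qp' c c' E Mk Mk' / q <= q'.
    by move=> W; case: (leqP q q') => H; [exact: W|apply/esym/W => //; exact: ltnW].
  apply/esym/eqP; rewrite eqn_mod_dvd //.
  have : M %| (q' - q) * aliquot_sum m.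
    by rewrite mulnBl -(subnDr (sigma m)) dvdn_sub.
  rewrite -{1}(divnK gM) -/D -{1}(divnK gs) mulnA dvdn_pmul2r // mulnC Gauss_dvdr //.
  rewrite /D /coprime -(eqn_pmul2r g0) mul1n muln_gcdl !divnK //.
  by rewrite gcdnC.
rewrite exchange_big /= -sum1_size big_distrl /= big_seq [leqRHS]big_seq.
apply: leq_sum => g; rewrite -dvdn_divisors // mul1n => gM.
have g0 := dvdn_gt0 M0 gM.
(* About [N / (Q * g)] values of [m] are divisible by [g], each with about [Q * g / M] candidates
   [q]: here [g] cancels. *)
rewrite -big_distrl /=; apply: (@leq_trans (N %/ Q %/ g * (Q %/ (M %/ g)).+2)).
  by rewrite leq_mul2r sum_dvdn ?orbT.
rewrite -addn2 mulnDr muln2; apply: leq_add; last by rewrite leq_double leq_div.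
rewrite leq_divRL //; set D := M %/ g.
have -> : M = D * g by rewrite divnK.
rewrite (mulnC (_ %/ g)) mulnACA.
apply: (leq_trans _ (leq_trunc_div N Q)).
by rewrite mulnC leq_mul // leq_trunc_div.
Qed.

Section Arithmetic.
Variable R : realType.
Local Open Scope ring_scope.

Lemma sum_multiples N d (G : nat -> R) : (0 < d)%N ->
  \sum_(1 <= n < N.+1 | (d %| n)%N) G (n %/ d)%N = \sum_(1 <= m < (N %/ d).+1) G m.
Proof.
move=> d0; rewrite -big_filter.
have P : perm_eq [seq n <- index_iota 1 N.+1 | (d %| n)%N]
                 [seq (d * m)%N | m <- index_iota 1 (N %/ d).+1].
  apply: uniq_perm; first by rewrite filter_uniq // iota_uniq.
    rewrite map_inj_uniq ?iota_uniq // => a b /eqP.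
    by rewrite eqn_pmul2l // => /eqP.
  move=> n; rewrite mem_filter mem_index_iota; apply/idP/mapP.
    case/andP=> dn /andP[n0 nN]; exists (n %/ d)%N; last by rewrite mulnC divnK.
    by rewrite mem_index_iota divn_gt0 // dvdn_leq //= ltnS leq_div2r.
  case=> m; rewrite mem_index_iota => /andP[m0 mN] ->.
  by rewrite dvdn_mulr //= muln_gt0 d0 m0 /= ltnS mulnC -leq_divRL.
rewrite (perm_big _ P) /= big_map; apply: eq_bigr => m _.
by rewrite mulKn.
Qed.

Lemma sum_divisorsE n N (F : nat -> R) : (0 < n <= N)%N ->
  \sum_(d <- divisors n) F d = \sum_(1 <= d < N.+1 | (d %| n)%N) F d.
Proof.
case/andP=> n0 nN; rewrite (perm_big _ (divisorsE n0)) /= big_filter.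
rewrite [RHS](big_cat_nat (n := n.+1)) //= [X in _ + X]big_nat_cond.
rewrite [X in _ + X]big1 ?addr0 // => d /andP[/andP[nd _] dn].
by move: (dvdn_leq n0 dn); rewrite leqNgt nd.
Qed.

Lemma sum_sum_divisors N (F : nat -> nat -> R) :
  \sum_(1 <= n < N.+1) \sum_(d <- divisors n) F d (n %/ d)%N =
  \sum_(1 <= d < N.+1) \sum_(1 <= m < (N %/ d).+1) F d m.
Proof.
transitivity (\sum_(1 <= n < N.+1) \sum_(1 <= d < N.+1 | (d %| n)%N) F d (n %/ d)%N).
  by apply: eq_big_nat => n nN; rewrite (sum_divisorsE _ nN).
under eq_bigr do rewrite big_mkcond.
rewrite exchange_big /=; apply: eq_big_nat => d /andP[d0 _].
by rewrite -big_mkcond -sum_multiples.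
Qed.

Lemma sum_divisors_swap n (F : nat -> nat -> R) : (0 < n)%N ->
  \sum_(d <- divisors n) \sum_(e <- divisors (n %/ d)) F d e =
  \sum_(e <- divisors n) \sum_(d <- divisors (n %/ e)) F d e.
Proof.
move=> n0.
have E (G : nat -> nat -> R) : \sum_(d <- divisors n) \sum_(e <- divisors (n %/ d)) G d e =
    \sum_(1 <= d < n.+1) \sum_(1 <= e < n.+1 | (d * e %| n)%N) G d e.
  rewrite (@sum_divisorsE n n) ?n0 ?leqnn // big_mkcond; apply: eq_big_nat => d /andP[d0 _].
  case: ifP => dn.
    have nd : (0 < n %/ d <= n)%N by rewrite divn_gt0 // leq_div andbT dvdn_leq.
    rewrite (sum_divisorsE _ nd).
    by apply: eq_bigl => e; rewrite dvdn_divRL // mulnC.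
  rewrite big1 // => e den.
  by rewrite (dvdn_trans (dvdn_mulr e (dvdnn d)) den) in dn.
rewrite !E (exchange_big_dep xpredT) //=; apply: eq_bigr => e _.
by apply: eq_bigl => d; rewrite mulnC.
Qed.

(** * The functions of von Mangoldt and Moebius *)

(** A sum over all pairs [(q, k)] with [n = q ^ k] instead of a case distinction, so that it can be
    exchanged with other sums; its ranges may be enlarged by [von_mangoldtE]. *)
Definition von_mangoldt (n : nat) : R :=
  \sum_(1 <= q < n.+1 | prime q) \sum_(1 <= k < n.+1 | (n == q ^ k)%N) ln q%:R.

Lemma ln_nat_ge0 n : 0 <= ln (n%:R : R).
Proof.
by case: n => [|n]; [rewrite ln0|rewrite ln_ge0 // ler1n].
Qed.

Lemma von_mangoldt_ge0 n : 0 <= von_mangoldt n.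
Proof. by rewrite /von_mangoldt !sumr_ge0 // => q _; rewrite sumr_ge0 // => k _; exact: ln_nat_ge0. Qed.

Lemma von_mangoldtE n N : (0 < n <= N)%N -> von_mangoldt n =
  \sum_(1 <= q < N.+1 | prime q) \sum_(1 <= k < N.+1 | (n == q ^ k)%N) ln q%:R.
Proof.
case/andP=> n0 nN; rewrite /von_mangoldt [RHS](big_cat_nat (n := n.+1)) //=.
rewrite [X in _ = _ + X]big_nat_cond [X in _ = _ + X]big1 ?addr0; last first.
  move=> q /andP[/andP[nq _] pq]; rewrite big_nat_cond big1 // => k /andP[/andP[k0 _] /eqP nE].
  by move: nq; rewrite nE ltnNge -{1}(expn1 q) leq_pexp2l // prime_gt0.
apply: eq_bigr => q pq; rewrite [RHS](big_cat_nat (n := n.+1)) //=.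
rewrite [X in _ = _ + X]big_nat_cond [X in _ = _ + X]big1 ?addr0 //.
move=> k /andP[/andP[nk _] /eqP nE].
by move: nk; rewrite nE ltnNge ltnW // ltn_expl // prime_gt1.
Qed.

Lemma sum_logn n N : (0 < n <= N)%N ->
  \sum_(1 <= q < N.+1 | prime q) ln (q%:R : R) *+ logn q n = ln n%:R.
Proof.
elim/ltn_ind: n => n IH /andP[n0 nN].
have [n1|n1] := leqP n 1.
  have -> : n = 1%N by lia.
  by rewrite ln1 big1 // => q _; rewrite logn1.
have pp := pdiv_prime n1; move/dvdnP: (pdiv_dvd n) => [m nE].
move: (pdiv n) pp nE => p pp nE; have p0 := prime_gt0 pp; have p1 := prime_gt1 pp.
have m0 : (0 < m)%N by move: n0; rewrite nE muln_gt0 => /andP[].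
have mn : (m < n)%N by rewrite nE ltn_Pmulr.
have pn : (p <= n)%N by rewrite nE leq_pmull.
transitivity (\sum_(1 <= q < N.+1 | prime q) (ln (q%:R : R) *+ logn q p)
              + \sum_(1 <= q < N.+1 | prime q) (ln (q%:R : R) *+ logn q m)).
  by rewrite -big_split; apply: eq_bigr => q _; rewrite nE lognM // mulrnDr addrC.
have mN : (0 < m <= N)%N by rewrite m0 (leq_trans (ltnW mn)).
rewrite (IH _ mn mN) [in RHS]nE natrM lnM ?posrE ?ltr0n // addrC.
congr (_ + _); have pN : p \in index_iota 1 N.+1.
  by rewrite mem_index_iota p0 ltnS (leq_trans pn).
rewrite big_mkcond (bigD1_seq p) ?iota_uniq //= pp logn_prime // eqxx.
rewrite big1 ?addr0 // => q qp; case: ifP => // pq.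
by rewrite logn_prime // (negPf qp).
Qed.

Lemma sum_von_mangoldt n : (0 < n)%N -> \sum_(d <- divisors n) von_mangoldt d = ln n%:R.
Proof.
move=> n0; rewrite (@sum_divisorsE _ n) ?n0 ?leqnn // -(@sum_logn n n) ?n0 ?leqnn //.
transitivity (\sum_(1 <= d < n.+1 | (d %| n)%N) \sum_(1 <= q < n.+1 | prime q)
   \sum_(1 <= k < n.+1 | (d == q ^ k)%N) ln (q%:R : R)).
  rewrite big_nat_cond [RHS]big_nat_cond; apply: eq_bigr => d /andP[dn _].
  exact: von_mangoldtE.
rewrite exchange_big /=; apply: eq_bigr => q pq.
rewrite (exchange_big_dep xpredT) //=.
transitivity (\sum_(1 <= k < n.+1) (if (q ^ k %| n)%N then ln (q%:R : R) else 0)).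
  apply: eq_big_nat => k /andP[k0 kn].
  have q1 := prime_gt1 pq; case: ifP => qn; last first.
    by rewrite big1 // => d /andP[dn /eqP dE]; rewrite dE qn in dn.
  have qkn : (q ^ k)%N \in index_iota 1 n.+1.
    by rewrite mem_index_iota expn_gt0 prime_gt0 //= ltnS dvdn_leq.
  rewrite big_mkcond (bigD1_seq _ qkn) ?iota_uniq //= qn eqxx.
  by rewrite big1 ?addr0 // => d dq; rewrite (negPf dq) andbF.
rewrite -big_mkcond big_const_seq iter_addr_0; congr (_ *+ _).
rewrite (eq_count (a2 := fun k => k <= logn q n)%N); last by move=> k; rewrite pfactor_dvdn.
have L : (logn q n <= n)%N by apply/ltnW/ltn_logl.
rewrite /index_iota subn1 /= -[in iota _ _](subnKC L) iotaD count_cat.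
rewrite (_ : count _ (iota 1 _) = logn q n); last first.
  rewrite -[RHS](size_iota 1); apply/eqP; rewrite -all_count; apply/allP => k.
  by rewrite mem_iota add1n ltnS => /andP[].
rewrite (_ : count _ _ = 0%N) ?addn0 //; apply/eqP; rewrite -leqn0 leqNgt -has_count.
by apply/hasPn => k; rewrite mem_iota add1n -ltnNge => /andP[].
Qed.
End Arithmetic.

Section Mertens.
Variable R : realType.
Local Open Scope ring_scope.
Notation von_mangoldt := (@von_mangoldt R).

Definition mobius (n : nat) : R :=
  if all (fun p => logn p n == 1%N) (primes n) then (-1) ^+ size (primes n) else 0.

Lemma norm_mobius_le1 n : `|mobius n| <= 1.
Proof. by rewrite /mobius; case: ifP; rewrite ?normr0 // normrX normrN1 expr1n. Qed.

Lemma perm_primesM p n : prime p -> (0 < n)%N -> coprime p n ->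
  perm_eq (primes (p * n)) (p :: primes n).
Proof.
move=> pp n0; rewrite prime_coprime // => pn; apply: uniq_perm.
- exact: primes_uniq.
- by rewrite /= primes_uniq mem_primes pp n0 (negPf pn).
by move=> q; rewrite (primesM q (prime_gt0 pp) n0) (primes_prime pp) !inE.
Qed.

Lemma mobius_primeM p n : prime p -> (0 < n)%N -> coprime p n -> mobius (p * n)%N = - mobius n.
Proof.
move=> pp n0 c; have P := perm_primesM pp n0 c.
rewrite /mobius (perm_all _ P) (perm_size P) /=.
have pn : ~~ (p %| n)%N by rewrite -prime_coprime.
have p0 := prime_gt0 pp; rewrite lognM // logn_prime // eqxx.
rewrite (_ : logn p n = 0%N) /=; last by apply/eqP; rewrite -leqn0 leqNgt logn_gt0 mem_primes pp n0 (negPf pn).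
rewrite (eq_in_all (a2 := fun q => logn q n == 1%N)) => [|q qn]; last first.
  have qp : q != p by apply: contraNneq pn => <-; move: qn; rewrite mem_primes => /and3P[].
  move: qn; rewrite mem_primes => /and3P[pq _ _].
  by rewrite lognM // logn_prime // (negPf qp).
by case: ifP => _; rewrite ?oppr0 // exprS mulN1r.
Qed.

Lemma mobius_square p n : prime p -> (0 < n)%N -> (p ^ 2 %| n)%N -> mobius n = 0.
Proof.
move=> pp n0 pn; rewrite /mobius; case: ifP => // /allP /(_ p).
have := pn; rewrite pfactor_dvdn // => l2; rewrite -logn_gt0 (leq_trans _ l2) //.
by move=> /(_ isT) /eqP E; rewrite E in l2.
Qed.

Lemma perm_divisors_pfactor p a : prime p ->
  perm_eq (divisors (p ^ a)) [seq (p ^ i)%N | i <- iota 0 a.+1].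
Proof.
move=> pp; apply: uniq_perm; first exact: divisors_uniq.
  rewrite map_inj_uniq ?iota_uniq // => i j /eqP.
  by rewrite eqn_exp2l ?prime_gt1 // => /eqP.
move=> x; rewrite -dvdn_divisors ?expn_gt0 ?prime_gt0 //.
apply/(dvdn_pfactor _ _ pp)/mapP => [[i ia ->]|[i]].
  by exists i => //; rewrite mem_iota.
by rewrite mem_iota => /= ia ->; exists i.
Qed.

(** For the least prime factor [p], the terms of [d] and [p * d] with [d] prime to [p] cancel, and
    the multiples of [p ^ 2] contribute 0. *)
Lemma sum_mobius n : (0 < n)%N -> \sum_(d <- divisors n) mobius d = (n == 1%N)%:R.
Proof.
move=> n0; have [n1|n1] := leqP n 1.
  have -> : n = 1%N by lia.
  by rewrite (_ : divisors 1 = [:: 1%N]) // big_seq1 /mobius.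
rewrite gtn_eqF //=; have pp := pdiv_prime n1.
have [m cpm nE] := pfactor_coprime pp n0.
have : (0 < logn (pdiv n) n)%N by rewrite logn_gt0 mem_primes pp n0 pdiv_dvd.
move: (pdiv n) (logn _ n) pp cpm nE => p [//|a] pp cpm nE _.
have m0 : (0 < m)%N by move: n0; rewrite nE muln_gt0 => /andP[].
have c : coprime (p ^ a.+1) m by rewrite coprimeXl.
rewrite nE mulnC (perm_big _ (divisorsM _ m0 c)) ?expn_gt0 ?prime_gt0 //=.
rewrite big_allpairs_dep /= exchange_big big_seq big1 // => d; rewrite -dvdn_divisors // => dm.
have cpd : coprime p d by rewrite (coprime_dvdr dm).
have d0 := dvdn_gt0 m0 dm.
rewrite (perm_big _ (perm_divisors_pfactor _ pp)) big_map !big_cons expn0 mul1n expn1 mobius_primeM //= addNKr ?addrA ?subrr.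
rewrite big_seq big1 ?addr0 ?subrr // => i; rewrite mem_iota => /andP[i2 _].
apply: (@mobius_square p); rewrite ?muln_gt0 ?expn_gt0 ?(prime_gt0 pp) ?d0 //.
by rewrite dvdn_mulr // dvdn_exp2l.
Qed.

(** * Estimates of Chebyshev and Mertens *)

Definition psi N : R := \sum_(1 <= d < N.+1) von_mangoldt d.

Lemma ln_natM m n : (0 < m)%N -> (0 < n)%N -> ln ((m * n)%:R : R) = ln m%:R + ln n%:R.
Proof. by move=> m0 n0; rewrite natrM lnM // posrE ltr0n. Qed.

Lemma ln_fact N : \sum_(1 <= d < N.+1) von_mangoldt d * (N %/ d)%:R = ln (N`!%:R).
Proof.
transitivity (\sum_(1 <= d < N.+1) \sum_(1 <= m < (N %/ d).+1) von_mangoldt d).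
  apply: eq_bigr => d _; rewrite big_const_nat subn1 /= iter_addr_0.
  by rewrite mulr_natr.
rewrite -(sum_sum_divisors N (fun d m => von_mangoldt d)).
transitivity (\sum_(1 <= n < N.+1) ln (n%:R : R)).
  by apply: eq_big_nat => n /andP[n0 _]; rewrite sum_von_mangoldt.
elim: N => [|N IH]; first by rewrite big_geq // fact0 ln1.
by rewrite big_nat_recr //= IH factS ln_natM ?fact_gt0 // addrC.
Qed.

Lemma ln_le_subr1 (x : R) : 0 < x -> ln x <= x - 1.
Proof.
move=> x0; have := @le_ln1Dx R (x - 1); rewrite (addrC 1) subrK; apply; lra.
Qed.

Lemma ln2_bounds : 2^-1 <= ln (2 : R) <= 1.
Proof.
apply/andP; split; last by have := @ln_le_subr1 2; lra.
have := @ln_le_subr1 2^-1; rewrite lnV ?posrE //; lra.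
Qed.

Lemma psi_mono M N : (M <= N)%N -> psi M <= psi N.
Proof.
move=> MN; rewrite /psi [leRHS](big_cat_nat (n := M.+1)) //= lerDl.
by rewrite sumr_ge0 // => d _; exact: von_mangoldt_ge0.
Qed.

(** Chebyshev's argument. By [ln_fact] the central binomial coefficient has logarithm the sum of
    [von_mangoldt d] weighted by [2M %/ d - 2 * (M %/ d)], a weight that is nonnegative, and at
    least 1 for [M < d <= 2M]; on the other hand the coefficient is at most [2 ^ (2M)]. *)
Lemma psi_double M : psi M.*2 <= psi M + M.*2%:R.
Proof.
have C : ('C(M.*2, M) * (M`! * M`!) = (M.*2)`!)%N.
  have M2 : (M <= M.*2)%N by rewrite -addnn leq_addr.
  by rewrite -(bin_fact M2) (_ : M.*2 - M = M)%N // -addnn addKn.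
have Cle : ('C(M.*2, M) <= 2 ^ M.*2)%N.
  rewrite -[2%N]/(1 + 1)%N expnDn (bigD1 (inord M)) //= inordK ?ltnS -?addnn ?leq_addr //.
  by rewrite !exp1n !muln1 leq_addr.
have C0 : (0 < 'C(M.*2, M))%N by rewrite bin_gt0 -addnn leq_addr.
have E : ln ((M.*2)`!%:R : R) <= M.*2%:R + ln (M`!%:R) + ln (M`!%:R).
  rewrite -C !ln_natM ?muln_gt0 ?fact_gt0 // -addrA lerD2r.
  apply: (@le_trans _ _ (ln ((2 ^ M.*2)%:R : R))).
    by rewrite ler_ln ?posrE ?ltr0n ?expn_gt0 // ler_nat.
  rewrite natrX lnXn // -[leLHS]mulr_natr; have /andP[_] := ln2_bounds.
  by move=> ?; rewrite ler_piMl.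
rewrite -!ln_fact in E.
suff : psi M.*2 - psi M <= \sum_(1 <= d < M.*2.+1) von_mangoldt d * (M.*2 %/ d)%:R
       - 2 * \sum_(1 <= d < M.+1) von_mangoldt d * (M %/ d)%:R by lra.
have M2 : (M <= M.*2)%N by rewrite -addnn leq_addr.
have S (F : nat -> R) : \sum_(1 <= d < M.*2.+1) F d =
    \sum_(1 <= d < M.+1) F d + \sum_(M.+1 <= d < M.*2.+1) F d.
  by rewrite -big_cat_nat.
rewrite /psi !S.
rewrite [X in X - _]addrC addrK mulr_sumr addrAC -sumrB.
rewrite -[leLHS]add0r; apply: lerD.
  apply: sumr_ge0 => d _; rewrite mulrCA -mulrBr mulr_ge0 ?von_mangoldt_ge0 //.
  rewrite subr_ge0 -natrM ler_nat mul2n -!muln2; case: d => // d.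
  by rewrite leq_divRL // -mulnA (mulnC 2%N) mulnA leq_mul2r leq_trunc_div orbT.
rewrite big_nat_cond [leRHS]big_nat_cond; apply: ler_sum => d /andP[/andP[Md dM] _].
by rewrite ler_peMr ?von_mangoldt_ge0 // ler1n divn_gt0 ?(leq_trans _ Md).
Qed.

Lemma psi_le N : psi N <= 4 * N%:R.
Proof.
have P j : psi (2 ^ j)%N <= 2 * (2 ^ j)%:R.
  elim: j => [|j IH].
    rewrite expn0 /psi big_nat1 /von_mangoldt big_nat_cond big1 ?mulr1 ?ler0n // => q /andP[/andP[]].
    by case: q => [|[]].
  rewrite expnS mul2n; apply: (le_trans (psi_double _)).
  rewrite -muln2 natrM; lra.
case: N => [|N]; first by rewrite /psi big_geq // mulr0.
apply: (le_trans (psi_mono (ltnW (trunc_log_ltn N.+1 (ltnSn 1))))).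
apply: (le_trans (P _)); rewrite expnS natrM.
have : ((2 ^ trunc_log 2 N.+1)%:R : R) <= N.+1%:R by rewrite ler_nat trunc_logP.
lra.
Qed.

Lemma ln_fact_bounds N : N%:R * ln (N%:R) - N%:R <= ln (N`!%:R : R) <= N%:R * ln (N%:R).
Proof.
elim: N => [|N /andP[IH1 IH2]]; first by rewrite fact0 ln1 !mul0r subr0 lexx.
rewrite factS ln_natM ?fact_gt0 //.
case: N IH1 IH2 => [|N] IH1 IH2.
  by rewrite fact0 !ln1; apply/andP; split; lra.
have N0 : 0 < N.+1%:R :> R by rewrite ltr0n.
have L1 : ln (N.+1%:R : R) <= ln N.+2%:R by rewrite ler_ln ?posrE ?ltr0n // ler_nat.
have L2 : N.+1%:R * ln (N.+2%:R : R) - N.+1%:R * ln N.+1%:R <= 1.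
  rewrite -mulrBr -ln_div ?posrE ?ltr0n //.
  have /ln_le_subr1 : 0 < N.+2%:R / N.+1%:R :> R by rewrite divr_gt0 ?ltr0n.
  move=> H; apply: (le_trans (ler_wpM2l (ltW N0) H)).
  by rewrite mulrBr mulr1 mulrCA divff ?gt_eqF // mulr1 -natrB // subSnn.
rewrite -[in X in _ <= _ <= X * _]natr1 -[in X in X * _ - X <= _]natr1.
have : N.+1%:R * ln N.+1%:R <= N.+1%:R * ln (N.+2%:R : R) by rewrite ler_pM2l.
by move=> ?; apply/andP; split; lra.
Qed.

Definition mertens N : R := \sum_(1 <= d < N.+1) von_mangoldt d / d%:R.

(** Replacing [N %/ d] by [N / d] in [ln_fact] costs at most [psi N <= 4 * N], and [ln N!] is
    [N * ln N] up to [N]; dividing by [N] gives the constants 4 and 1. *)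
Lemma mertens_bounds N : (0 < N)%N -> ln N%:R - 1 <= mertens N <= ln N%:R + 4.
Proof.
move=> N0; have /andP[F1 F2] := ln_fact_bounds N.
have N0' : 0 < N%:R :> R by rewrite ltr0n.
have H1 : ln (N`!%:R : R) <= N%:R * mertens N.
  rewrite -ln_fact /mertens mulr_sumr; rewrite big_nat_cond [leRHS]big_nat_cond.
  apply: ler_sum => d /andP[/andP[d0 _] _]; rewrite mulrCA ler_wpM2l ?von_mangoldt_ge0 //.
  by rewrite ler_pdivlMr ?ltr0n // -natrM ler_nat leq_trunc_div.
have H2 : N%:R * mertens N - psi N <= ln (N`!%:R : R).
  rewrite -ln_fact /mertens mulr_sumr /psi -sumrB; rewrite big_nat_cond [leRHS]big_nat_cond.
  apply: ler_sum => d /andP[/andP[d0 _] _].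
  rewrite mulrCA -{2}(mulr1 (von_mangoldt d)) -mulrBr ler_wpM2l ?von_mangoldt_ge0 //.
  rewrite lerBlDr ler_pdivrMr ?ltr0n // natr1 -natrM ler_nat.
  by rewrite ltnW // ltn_ceil.
have P := psi_le N.
apply/andP; split.
  by rewrite -(ler_pM2l N0'); lra.
by rewrite -(ler_pM2l N0'); lra.
Qed.
End Mertens.

(** * Sums over the primes of an interval *)

Section PrimeSums.
Variable R : realType.
Local Open Scope ring_scope.

Lemma sum_ln_telescope N :
  \sum_(2 <= q < N.+1) ln (q%:R : R) / (q%:R * (q%:R - 1)) <= 2.
Proof.
have ge (n : nat) : 0 <= (ln (n.+1%:R : R) + 2) / n.+1%:R.
  by rewrite divr_ge0 ?addr_ge0 ?ln_nat_ge0.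
case: N => [|N]; first by rewrite big_geq.
(* Strengthened for the induction: the decrease of the subtracted term dominates each new
   summand. *)
suff : \sum_(2 <= q < N.+2) ln (q%:R : R) / (q%:R * (q%:R - 1)) <= 2 - (ln (N.+1%:R : R) + 2) / N.+1%:R.
  by move=> H; apply: (le_trans H); rewrite gerBl.
elim: N => [|N IH]; first by rewrite big_geq // ln1 add0r divr1 subrr.
rewrite big_nat_recr //=; move: IH; set S := \sum_(2 <= q < N.+2) _ => IH.
have n0 : 0 < N.+1%:R :> R by rewrite ltr0n.
have L : N.+2%:R * (ln (N.+2%:R : R) - ln N.+1%:R) <= 2.
  rewrite -ln_div ?posrE ?ltr0n //.
  have /ln_le_subr1 : 0 < N.+2%:R / N.+1%:R :> R by rewrite divr_gt0 ?ltr0n.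
  rewrite -[X in _ <= _ - X](divff (lt0r_neq0 n0)) -mulrBl -natrB // subSnn => H.
  apply: (le_trans (ler_wpM2l _ H)) => //.
  rewrite mulrA ler_pdivrMr // mulr1 -natrM ler_nat; lia.
have n1 : N.+2%:R = N.+1%:R + 1 :> R by rewrite natr1.
rewrite n1 addrK in L *; move: n0 L IH; move: (N.+1%:R) (ln _) (ln _) => n a b n0 L IH.
have F : (a + 2) / n - (b + 2) / (n + 1) - b / ((n + 1) * n) =
    (2 - (n + 1) * (b - a)) / ((n + 1) * n).
  by field; rewrite !gt_eqF // addr_gt0.
have : 0 <= (2 - (n + 1) * (b - a)) / ((n + 1) * n).
  by apply: divr_ge0; [lra|apply: mulr_ge0; lra].
rewrite -F; lra.
Qed.

Lemma sum_geometric_inv q K : (1 < q)%N ->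
  \sum_(2 <= k < K.+1) ((q ^ k)%:R : R)^-1 <= (q%:R * (q%:R - 1))^-1.
Proof.
move=> q1; have q0 : 0 < q%:R :> R by rewrite ltr0n ltnW.
have q1' : 0 < q%:R - 1 :> R by rewrite subr_gt0 ltr1n.
case: K => [|K].
  by rewrite big_geq // invr_ge0 mulr_ge0 ?ltW.
suff -> : \sum_(2 <= k < K.+2) ((q ^ k)%:R : R)^-1 =
    (q%:R * (q%:R - 1))^-1 - ((q ^ K.+1)%:R * (q%:R - 1))^-1.
  by rewrite gerBl invr_ge0; apply: mulr_ge0; [exact: ler0n|exact: ltW].
elim: K => [|K IH]; first by rewrite big_geq // expn1 subrr.
rewrite big_nat_recr //= IH !natrX [in RHS]exprS [_ ^+ K.+2]exprS.
have := exprn_gt0 K.+1 q0; move: (_ ^+ K.+1) => x x0.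
by field; rewrite !gt_eqF.
Qed.

(** The powers with exponent at least 2 contribute at most the sum of [ln q / (q * (q - 1))],
    whichever of them [P] selects. *)
Lemma von_mangoldt_prime_ge (P : pred nat) N :
  \sum_(1 <= d < N.+1 | P d) von_mangoldt R d / d%:R <=
  \sum_(1 <= q < N.+1 | prime q && P q) ln (q%:R : R) / q%:R + 2.
Proof.
case: N => [|N]; first by rewrite !big_geq // add0r.
set M := N.+1; pose A d q : R := \sum_(2 <= k < M.+1 | (d == q ^ k)%N) ln q%:R.
have A0 d q : 0 <= A d q by rewrite sumr_ge0 // => k _; exact: ln_nat_ge0.
have E d : (0 < d <= M)%N -> von_mangoldt R d =
    (if prime d then ln d%:R else 0) + \sum_(1 <= q < M.+1 | prime q) A d q.
  move=> dM; rewrite (von_mangoldtE _ dM).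
  under eq_bigr => q pq do rewrite big_mkcond big_ltn // -big_mkcond expn1.
  rewrite big_split /=; congr (_ + _); case/andP: dM => d0 dM.
  rewrite big_mkcond (bigD1_seq d) ?iota_uniq ?mem_index_iota ?d0 //= eqxx.
  rewrite big1 ?addr0 // => q qd; rewrite eq_sym (negPf qd); by case: ifP.
apply: (@le_trans _ _ (\sum_(1 <= d < M.+1 | P d)
    ((if prime d then ln d%:R else 0) / d%:R + (\sum_(1 <= q < M.+1 | prime q) A d q) / d%:R))).
  rewrite big_nat_cond [leRHS]big_nat_cond; apply: ler_sum => d /andP[dM _].
  by rewrite E // mulrDl.
rewrite big_split /=; apply: lerD.
  rewrite big_mkcond [leRHS]big_mkcond; apply: ler_sum => d _.
  by case: (P d); case: (prime d); rewrite ?mul0r.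
apply: (@le_trans _ _ (\sum_(1 <= d < M.+1) \sum_(1 <= q < M.+1 | prime q) A d q / d%:R)).
  rewrite big_mkcond; apply: ler_sum => d _; rewrite mulr_suml; case: ifP => // _.
  by rewrite sumr_ge0 // => q _; rewrite divr_ge0.
rewrite exchange_big /=; apply: le_trans (sum_ln_telescope M).
rewrite big_mkcond [leLHS]big_ltn //= add0r big_nat_cond [leRHS]big_nat_cond; apply: ler_sum => q /andP[/andP[q1 qM] _].
have q0 : 0 < q%:R :> R by rewrite ltr0n ltnW.
case: ifP => pq; last first.
  rewrite divr_ge0 ?ln_nat_ge0 // mulr_ge0 ?(ltW q0) // subr_ge0 ler1n ltnW //.
rewrite /A; under eq_bigr do rewrite mulr_suml.
rewrite (exchange_big_dep xpredT) //=.
apply: (@le_trans _ _ (\sum_(2 <= k < M.+1) ln (q%:R : R) * ((q ^ k)%:R)^-1)).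
  apply: ler_sum => k _; have [qkM|qkM] := boolP ((q ^ k)%N \in index_iota 1 M.+1).
    rewrite big_mkcond (bigD1_seq _ qkM) ?iota_uniq //= eqxx.
    by rewrite big1 ?addr0 // => d dq; rewrite (negPf dq).
  rewrite big_seq_cond big1; first by rewrite mulr_ge0 ?ln_nat_ge0 ?invr_ge0.
  by move=> d /andP[dM /eqP dE]; rewrite dE (negPf qkM) in dM.
by rewrite -mulr_sumr ler_wpM2l ?ln_nat_ge0 // sum_geometric_inv.
Qed.

Definition mertens_prime N : R := \sum_(1 <= q < N.+1 | prime q) ln q%:R / q%:R.

Lemma von_mangoldt_ge_prime q : prime q -> ln q%:R <= von_mangoldt R q.
Proof.
move=> pq; have q0 := prime_gt0 pq; have q1 := prime_gt1 pq.
have ge0 (i : nat) : 0 <= \sum_(1 <= k < q.+1 | (q == i ^ k)%N) ln (i%:R : R).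
  by rewrite sumr_ge0 // => k _; exact: ln_nat_ge0.
rewrite /von_mangoldt big_mkcond (bigD1_seq q) ?iota_uniq ?mem_index_iota ?q0 ?ltnS //= pq.
rewrite -[leLHS]addr0; apply: lerD; last by apply: sumr_ge0 => i _; case: ifP.
rewrite big_mkcond big_ltn ?ltnS // expn1 eqxx lerDl; apply: sumr_ge0 => k _.
by case: ifP => // _; exact: ln_nat_ge0.
Qed.

Lemma mertens_prime_bounds N : (0 < N)%N -> ln N%:R - 3 <= mertens_prime N <= ln N%:R + 4.
Proof.
move=> /(@mertens_bounds R) /andP[H1 H2]; apply/andP; split.
  have := von_mangoldt_prime_ge xpredT N; rewrite -/(mertens R N) /mertens_prime.
  under [X in _ <= X + _]eq_bigl do rewrite andbT.
  lra.
apply: le_trans H2; rewrite /mertens_prime /mertens big_mkcond.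
apply: ler_sum => q _; case: ifP => pq; last by rewrite divr_ge0 ?von_mangoldt_ge0.
by rewrite ler_wpM2r ?invr_ge0 ?von_mangoldt_ge_prime.
Qed.

Definition prime_recip a b : R := \sum_(a.+1 <= q < b.+1 | prime q) q%:R^-1.

Lemma prime_recip_cat a b c : (a <= b)%N -> (b <= c)%N ->
  prime_recip a c = prime_recip a b + prime_recip b c.
Proof. by move=> ab bc; rewrite /prime_recip (big_cat_nat (n := b.+1)). Qed.

Lemma prime_recip_ge_half a : (14 <= a)%N -> 2^-1 <= prime_recip (2 ^ a) (2 ^ (4 * a)).
Proof.
move=> a14; have /andP[l2 _] := ln2_bounds R.
have lnE k : ln ((2 ^ k)%:R : R) = k%:R * ln 2 by rewrite natrX lnXn // mulr_natl.
have /andP[A _] := @mertens_prime_bounds (2 ^ (4 * a)) (expn_gt0 2 _).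
have /andP[_ B] := @mertens_prime_bounds (2 ^ a) (expn_gt0 2 _).
have a4 : (2 ^ a <= 2 ^ (4 * a))%N by rewrite leq_exp2l // leq_pmull.
rewrite !lnE natrM in A B.
have C : mertens_prime (2 ^ (4 * a)) - mertens_prime (2 ^ a) <=
    4 * a%:R * ln 2 * prime_recip (2 ^ a) (2 ^ (4 * a)).
  rewrite /mertens_prime (big_cat_nat (n := (2 ^ a).+1) (p := (2 ^ (4 * a)).+1)) //=.
  rewrite [leLHS]addrAC subrr add0r /prime_recip mulr_sumr.
  rewrite big_nat_cond [leRHS]big_nat_cond; apply: ler_sum => q /andP[/andP[_ qa] pq].
  rewrite ler_wpM2r ?invr_ge0 // -natrM -lnE ler_ln ?posrE ?ltr0n ?expn_gt0 ?prime_gt0 //.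
  by rewrite ler_nat -ltnS.
have a14' : 14 <= a%:R :> R by rewrite (ler_nat _ 14).
(* With [x = a * ln 2], the Mertens bounds give a gain of at least [3 * x - 7], to be compared with
   [4 * x / 2]. So [x >= 7] is needed, and [ln 2 >= 1 / 2] explains the threshold 14. *)
have T : 7 <= a%:R * ln (2 : R).
  by apply: (@le_trans _ _ (14 * 2^-1)); [lra|apply: ler_pM => //; lra].
have T0 : 0 < 4 * (a%:R * ln (2 : R)) by lra.
rewrite -(ler_pM2l T0); lra.
Qed.

(** A substitute for Mertens' second theorem: each multiplication of the exponent by 4 adds at least
    [1 / 2]. *)
Lemma prime_recip_ge a r : (14 <= a)%N -> r%:R / 2 <= prime_recip (2 ^ a) (2 ^ (4 ^ r * a)).
Proof.
move=> a14; elim: r => [|r IH].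
  by rewrite mul0r sumr_ge0 // => q _; rewrite invr_ge0.
have H : (14 <= 4 ^ r * a)%N by rewrite (leq_trans a14) // leq_pmull // expn_gt0.
rewrite (@prime_recip_cat _ (2 ^ (4 ^ r * a))).
- rewrite -natr1 mulrDl mul1r lerD // expnS -mulnA; exact: prime_recip_ge_half.
- by rewrite leq_exp2l // leq_pmull // expn_gt0.
- by rewrite leq_exp2l // leq_mul2r leq_exp2l // leqnSn orbT.
Qed.
End PrimeSums.

(** * Primes congruent to [-1] modulo a prime *)

Section Abel.
Variable R : realType.
Local Open Scope ring_scope.

Lemma abel_bound (g w : nat -> R) M N (C : R) : (M <= N)%N ->
  (forall k, (M <= k)%N -> `|\sum_(M <= n < k) g n| <= C) ->
  (forall k, (M <= k)%N -> w k.+1 <= w k) -> 0 <= w N ->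
  `|\sum_(M <= n < N) g n * w n| <= C * w M.
Proof.
move=> MN HC Hw wN.
(* Subtracting the boundary term of the summation by parts leaves partial sums of [g] against the
   increments of [w], which is a bound that passes through the induction. *)
suff : `|\sum_(M <= n < N) g n * w n - (\sum_(M <= n < N) g n) * w N| <= C * (w M - w N).
  have := HC _ MN; move: (\sum_(_ <= n < _) g n) (\sum_(_ <= n < _) _ * _) => h s hC H.
  have E : s = (s - h * w N) + h * w N by rewrite subrK.
  rewrite E (le_trans (ler_normD _ _)) // normrM (ger0_norm wN).
  have := ler_wpM2r wN hC; lra.
elim: N MN {wN} => [|N IH]; first by rewrite leqn0 => /eqP ->; rewrite !big_geq // mul0r !subrr normr0 mulr0.
rewrite leq_eqVlt => /predU1P[->|MN]; first by rewrite !big_geq // mul0r !subrr normr0 mulr0.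
have {}IH := IH MN; rewrite big_nat_recr //=.
have -> : \sum_(M <= n < N) g n * w n + g N * w N - (\sum_(M <= n < N.+1) g n) * w N.+1 =
  (\sum_(M <= n < N) g n * w n - (\sum_(M <= n < N) g n) * w N) +
  (\sum_(M <= n < N.+1) g n) * (w N - w N.+1).
  by rewrite big_nat_recr //=; ring.
apply: (le_trans (ler_normD _ _)); rewrite normrM (ger0_norm (x := w N - w N.+1)) ?subr_ge0 ?Hw //.
have D0 : 0 <= w N - w N.+1 by rewrite subr_ge0 Hw.
have := ler_wpM2r D0 (HC N.+1 (leqW MN)); lra.
Qed.

(** The limit is the supremum of the lower bounds [s M - C / (M + 1)]; each [s N + C / (N + 1)] is
    an upper bound of them, so the rate comes with the limit. *)
Lemma limit_with_rate (s : nat -> R) (C : R) :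
  (forall M N, (M <= N)%N -> `|s N - s M| <= C / M.+1%:R) ->
  {l | forall N, `|s N - l| <= C / N.+1%:R}.
Proof.
move=> H; pose E := range (fun M => s M - C / M.+1%:R).
have C0 M : 0 <= C / M.+1%:R by apply: le_trans (normr_ge0 _) (H M M (leqnn M)).
have ub N : ubound E (s N + C / N.+1%:R).
  move=> _ [M _ <-] /=; have := C0 N; have := C0 M.
  have [MN|/ltnW NM] := leqP M N.
    have := H _ _ MN; move: (C / M.+1%:R) (C / N.+1%:R) => x y.
    rewrite ler_norml => /andP[? ?] ? ?; lra.
  have := H _ _ NM; move: (C / M.+1%:R) (C / N.+1%:R) => x y.
  rewrite ler_norml => /andP[? ?] ? ?; lra.
have E0 : (E !=set0)%classic by exists (s 0%N - C / 1%:R); exists 0%N.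
exists (sup E) => N; have := ge_sup E0 (ub N).
have : s N - C / N.+1%:R <= sup E.
  by apply: ub_le_sup; [exists (s 0%N + C / 1%:R); exact: ub|exists N].
move: (C / N.+1%:R) (sup E) => x y ? ?; rewrite ler_norml; apply/andP; split; lra.
Qed.

(* [a h] is the limit of [A h N / ln N] along an ultrafilter; linear inequalities
   up to a bounded error pass to the limit. *)
Lemma log_limit_point (I : finType) (A : I -> nat -> R) (K : R) :
  (forall h N, (1 < N)%N -> `|A h N| <= K * ln N%:R) ->
  exists a : I -> R, forall (u : I -> R) (v C : R),
    (forall N, (1 < N)%N -> \sum_h u h * A h N <= v * ln N%:R + C) ->
    \sum_h u h * a h <= v.
Proof.
move=> HA; have [G [uG GF]] := @ultraFilterLemma nat \oo%classic _.
have ln0 N : (1 < N)%N -> 0 < ln (N%:R : R) by move=> N1; rewrite ln_gt0 // ltr1n.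
have N1 : G [set N | (1 < N)%N]%classic by apply: GF; exact: nbhs_infty_gt.
have Hc h : exists l : R, (A h N / ln N%:R @[N --> G] --> l)%classic.
  have GK : (fmap (fun N => A h N / ln (N%:R : R)) G) `[- K, K]%classic.
    apply: (@filterS nat G _ _ _ _ N1) => N /= N2; rewrite in_itv /= -ler_norml normrM normfV.
    by rewrite (gtr0_norm (ln0 _ N2)) ler_pdivrMr ?ln0 // HA.
  have [l [_ Hl]] := @segment_compact R (- K) K _ _ GK.
  exists l; apply/cvgrPdist_lt => e e0.
  (* Compactness provides a cluster point. Along an ultrafilter it is a limit: otherwise the
     complement of a neighbourhood would belong to the ultrafilter. *)
  have [//|GC] := @in_ultra_setVsetC _ G [set N | `|l - A h N / ln (N%:R : R)| < e]%classic uG.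
  have GC' : fmap (fun N => A h N / ln (N%:R : R)) G [set x | ~ `|l - x| < e]%classic.
    exact: GC.
  by have [x []] := Hl _ _ GC' (nbhsx_ballx l e e0).
have [a Ha] := choice Hc.
exists a => u v C H.
have L1 : (\sum_h u h * (A h N / ln N%:R) @[N --> G] --> \sum_h u h * a h)%classic.
  apply: cvg_big => [|h _]; first exact: add_continuous.
  by apply: cvgMr; exact: Ha.
apply/ler_addgt0Pr => e e0.
apply: (ler_cvg_to L1 (cvg_cst (v + e))).
(* On this set [C <= e * ln N], so the bounded error is absorbed in [e]. *)
have N2 : G [set N | expR (C / e) <= N%:R]%classic by apply: GF; exact: nbhs_infty_ger.
apply: filterS2 N1 N2 => N /= N1 N2; have l0 := ln0 _ N1.
have := H _ N1; rewrite -(ler_pM2r (x := (ln N%:R)^-1)) ?invr_gt0 // => HN.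
under eq_bigr do rewrite mulrA.
rewrite -mulr_suml; apply: (le_trans HN); rewrite mulrDl mulfK ?gt_eqF // lerD2l.
rewrite ler_pdivrMr // mulrC -ler_pdivrMr // -(expRK (C / e)).
by rewrite ler_ln ?posrE ?expR_gt0 ?ltr0n // ltnW.
Qed.
End Abel.

(** * Functions of mean zero modulo [p] and their values at 1 *)

Section Residues.
Variables (R : realType) (p : nat).
Hypothesis pp : prime p.
Local Open Scope ring_scope.
Notation F := 'F_p.
Implicit Types f : F -> R.

Lemma sum_period (T : nmodType) (G : F -> T) M : \sum_(M <= n < M + p) G n%:R = \sum_h G h.
Proof.
rewrite -{1}(add0n M) big_addn (addnC M) addnK big_mkord.
have inj : injective (fun i : 'I_p => (i + M)%:R : F).
  move=> i j /(congr1 (@nat_of_ord _)); rewrite !val_Fp_nat // => /eqP.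
  by rewrite eqn_modDr !modn_small // => /eqP /ord_inj.
rewrite [RHS](reindex (fun i : 'I_p => (i + M)%:R : F)) //=.
by apply/onW_bij/inj_card_bij => //; rewrite card_Fp ?card_ord.
Qed.

Definition l1 f : R := \sum_h `|f h|.

(** The real functions on the units orthogonal to the principal character. They stand in for the
    nonprincipal characters, so that no complex number is needed. *)
Definition mean_zero f : Prop := f 0 = 0 /\ \sum_h f h = 0.

(** Full periods cancel, and an incomplete one is at most [l1 f]. *)
Lemma sum_mean_zero_le f M k : mean_zero f -> `|\sum_(M <= n < k) f n%:R| <= l1 f.
Proof.
move=> [_ f0]; have [n] := ubnP (k - M)%N; elim: n M => // n IH M; rewrite ltnS => kn.
have [kp|kp] := leqP (k - M) p; last first.
  rewrite (big_cat_nat (n := M + p)) ?leq_addr //=; last by lia.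
  rewrite sum_period f0 add0r; apply: IH; have := prime_gt0 pp; lia.
apply: (le_trans (ler_norm_sum _ _ _)).
rewrite /l1 -(sum_period (fun h => `|f h|) M).
have [Mk|kM] := leqP M k; last by rewrite [leLHS]big_geq ?sumr_ge0 // ltnW.
by rewrite [leRHS](big_cat_nat (n := k)) //= ?lerDl ?sumr_ge0 //; lia.
Qed.

Lemma sum_harmonic_mean_zero f M N : mean_zero f -> (M <= N)%N ->
  `|\sum_(M.+1 <= n < N.+1) f n%:R / n%:R| <= l1 f / M.+1%:R.
Proof.
move=> mf MN; apply: (@abel_bound R (fun n => f n%:R) (fun n => n%:R^-1)) => //.
- by move=> k _; exact: sum_mean_zero_le.
- by case=> [//|k] _; rewrite lef_pV2 ?posrE ?ltr0n // ler_nat.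
- by rewrite invr_ge0.
Qed.

Definition card_units : R := (p.-1)%:R.

(** The projection of the indicator of [h] orthogonally to the principal character. These functions
    span the mean-zero ones, hence finitely many limits determine all the values at 1. *)
Definition centered_delta (h k : F) : R := (k == h)%:R - (k != 0)%:R / card_units.

Lemma card_units_gt0 : 0 < card_units.
Proof. by rewrite /card_units ltr0n -ltnS prednK ?prime_gt0 ?prime_gt1. Qed.

Lemma sum_nonzero : \sum_(h : F) (h != 0)%:R = card_units.
Proof.
transitivity (\sum_(h in predC1 (0 : F)) (1 : R)); last by rewrite sumr_const cardC1 card_Fp.
by rewrite [RHS]big_mkcond; apply: eq_bigr => h _; rewrite inE /=; case: (h != 0).
Qed.

Lemma sum_eq (h : F) : \sum_(k : F) (k == h)%:R = 1 :> R.
Proof. by rewrite (bigD1 h) //= eqxx big1 ?addr0 // => k /negPf ->. Qed.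

Lemma centered_delta_mean_zero h : h != 0 -> mean_zero (centered_delta h).
Proof.
move=> h0; split; first by rewrite /centered_delta eq_sym (negPf h0) eqxx mul0r subrr.
by rewrite sumrB sum_eq -mulr_suml sum_nonzero divff ?subrr // gt_eqF ?card_units_gt0.
Qed.

Lemma Lconst_exists : {c : F -> R | forall h, h != 0 -> forall N,
  `|\sum_(1 <= n < N.+1) centered_delta h n%:R / n%:R - c h| <= l1 (centered_delta h) / N.+1%:R}.
Proof.
suff H h : {c : R | h != 0 -> forall N,
  `|\sum_(1 <= n < N.+1) centered_delta h n%:R / n%:R - c| <= l1 (centered_delta h) / N.+1%:R}.
  by exists (fun h => sval (H h)) => h; exact: (svalP (H h)).
have [h0|h0] := boolP (h != 0); last by exists 0.
have [M N MN|c Hc] := @limit_with_rate R (fun N => \sum_(1 <= n < N.+1) centered_delta h n%:R / n%:R)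
  (l1 (centered_delta h)); last by exists c.
rewrite (big_cat_nat (n := M.+1) (p := N.+1)) //= addrAC subrr add0r.
by apply: sum_harmonic_mean_zero => //; exact: centered_delta_mean_zero.
Qed.

Definition Lconst : F -> R := sval Lconst_exists.

(* The value at 1 of the Dirichlet series of [f]. *)
Definition Lval f : R := \sum_(h | h != 0) f h * Lconst h.

Definition Lrate : R := \sum_(h : F) l1 (centered_delta h).

Lemma l1_ge0 f : 0 <= l1 f. Proof. by rewrite sumr_ge0. Qed.

Lemma le_l1 f h : `|f h| <= l1 f.
Proof. by rewrite /l1 (bigD1 h) //= lerDl sumr_ge0. Qed.

Lemma Lval_rate f N : mean_zero f ->
  `|\sum_(1 <= n < N.+1) f n%:R / n%:R - Lval f| <= l1 f * Lrate / N.+1%:R.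
Proof.
move=> [f0 sf].
have E k : f k = \sum_(h | h != 0) f h * centered_delta h k.
  have S0 : \sum_(h : F | h != 0) f h = 0.
    by rewrite -[RHS]sf [RHS](bigD1 0) //= f0 add0r.
  under eq_bigr do rewrite mulrBr.
  rewrite sumrB -mulr_suml S0 mul0r subr0.
  have [->|k0] := eqVneq k 0.
    by rewrite f0 big1 // => h h0; rewrite eq_sym (negPf h0) mulr0.
  rewrite (bigD1 k) //= eqxx mulr1 big1 ?addr0 // => h /andP[_ hk].
  by rewrite eq_sym (negPf hk) mulr0.
have -> : \sum_(1 <= n < N.+1) f n%:R / n%:R - Lval f =
   \sum_(h | h != 0) f h * (\sum_(1 <= n < N.+1) centered_delta h n%:R / n%:R - Lconst h).
  under [RHS]eq_bigr do rewrite mulrBr.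
  rewrite sumrB; congr (_ - _).
  under [RHS]eq_bigr do rewrite mulr_sumr.
  rewrite exchange_big /=; apply: eq_bigr => n _.
  by rewrite E mulr_suml; apply: eq_bigr => h _; rewrite mulrA.
apply: (le_trans (ler_norm_sum _ _ _)).
apply: (@le_trans _ _ (\sum_(h | h != 0) `|f h| * (Lrate / N.+1%:R))).
  apply: ler_sum => h h0; rewrite normrM ler_wpM2l //.
  apply: (le_trans (svalP Lconst_exists h h0 N)); rewrite ler_wpM2r ?invr_ge0 //.
  by rewrite /Lrate (bigD1 h) //= lerDl sumr_ge0 // => k _; exact: l1_ge0.
rewrite -mulr_suml -mulrA ler_wpM2r //.
  by rewrite divr_ge0 // sumr_ge0 // => k _; exact: l1_ge0.
by rewrite /l1 [leRHS](bigD1 0) //= lerDr.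
Qed.

Definition shift (g : F) f : F -> R := fun h => f (g * h).

Lemma shift_mean_zero g f : mean_zero f -> mean_zero (shift g f).
Proof.
move=> [f0 sf]; split; first by rewrite /shift mulr0.
have [->|g0] := eqVneq g 0.
  by rewrite /shift big1 // => h _; rewrite mul0r.
rewrite -[RHS]sf [RHS](reindex (fun h => g * h)) //=.
by apply/onW_bij; exists (fun h => g^-1 * h) => h; rewrite ?mulKf ?mulVKf.
Qed.

Lemma l1_shift g f : l1 (shift g f) <= p%:R * l1 f.
Proof.
apply: (@le_trans _ _ (\sum_(h : F) l1 f)); first by apply: ler_sum => h _; exact: (le_l1 f (g * h)).
by rewrite sumr_const card_Fp // mulr_natl.
Qed.

Definition rate f : R := p%:R * l1 f * Lrate.

Lemma rate_ge0 f : 0 <= rate f.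
Proof. by rewrite !mulr_ge0 ?l1_ge0 ?sumr_ge0 // => h _; exact: l1_ge0. Qed.

(** The error is proportional to [d]: once divided by [d] it is uniform, and its sum against
    [von_mangoldt d] is controlled by [psi N / N]. *)
Lemma Lval_shift_rate f d N : mean_zero f -> (0 < d)%N -> (d <= N)%N ->
  `|\sum_(1 <= m < (N %/ d).+1) f (d * m)%:R / m%:R - Lval (shift d%:R f)| <= rate f * d%:R / N%:R.
Proof.
move=> mf d0 dN; have := Lval_rate (N %/ d) (shift_mean_zero d%:R mf).
rewrite (eq_bigr (fun m => f (d * m)%:R / m%:R)) => [H|m _]; last by rewrite /shift natrM.
apply: (le_trans H); rewrite /rate -[leRHS]mulrA; apply: ler_pM.
- by rewrite mulr_ge0 ?l1_ge0 // sumr_ge0 // => h _; exact: l1_ge0.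
- by rewrite invr_ge0.
- by rewrite ler_wpM2r ?l1_shift // sumr_ge0 // => h _; exact: l1_ge0.
rewrite ler_pdivlMr ?ltr0n ?(leq_trans d0) // ler_pdivrMl // ?ltr0n //.
by rewrite mulrC -natrM ler_nat ltnW // mulnC ltn_ceil.
Qed.
End Residues.

(** * Linear relations satisfied by the von Mangoldt sums *)

Section Relations.
Variables (R : realType) (p : nat).
Hypothesis pp : prime p.
Local Open Scope ring_scope.
Notation F := 'F_p.
Implicit Types f : F -> R.
Notation Lam := (@von_mangoldt R).

(** The monotonicity needs [ln n >= 1], which [ln 4 = 2 * ln 2] and [ln2_bounds] provide from 4
    on. *)
Lemma ln_over_n_decreasing n : (4 <= n)%N -> ln (n.+1%:R : R) / n.+1%:R <= ln n%:R / n%:R.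
Proof.
move=> n4; have nN0 : (0 < n)%N by lia.
have n0 : 0 < n%:R :> R by rewrite ltr0n.
rewrite ler_pdivrMr ?ltr0n // mulrAC ler_pdivlMr //.
have l1 : 1 <= ln (n%:R : R).
  apply: (@le_trans _ _ (ln 4%:R)); last by rewrite ler_ln ?posrE ?ltr0n ?ler_nat //; lia.
  have /andP[l2 _] := ln2_bounds R.
  rewrite -[4%N]/(2 * 2)%N ln_natM //; lra.
have L : n%:R * (ln (n.+1%:R : R) - ln n%:R) <= 1.
  rewrite -ln_div ?posrE ?ltr0n //.
  have /ln_le_subr1 : 0 < n.+1%:R / n%:R :> R by rewrite divr_gt0 ?ltr0n.
  move=> H; apply: (le_trans (ler_wpM2l (ltW n0) H)).
  by rewrite mulrBr mulr1 mulrCA divff ?gt_eqF // mulr1 -natrB // subSnn.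
rewrite -natr1; move: L; rewrite mulrBr -natr1; lra.
Qed.

Lemma sum_ln_over_n_bounded f : mean_zero f ->
  exists C, forall N, `|\sum_(1 <= n < N.+1) f n%:R * (ln n%:R / n%:R)| <= C.
Proof.
move=> mf; exists (\sum_(1 <= n < 4) `|f n%:R * (ln n%:R / n%:R)| + l1 f * (ln 4%:R / 4%:R)) => N.
have T0 : 0 <= l1 f * (ln (4%:R : R) / 4%:R) by rewrite !mulr_ge0 ?l1_ge0 ?ln_nat_ge0 ?invr_ge0.
have [N4|N4] := leqP N.+1 4.
  apply: (le_trans (ler_norm_sum _ _ _)); rewrite -[leLHS]addr0; apply: lerD => //.
  by rewrite [leRHS](big_cat_nat (n := N.+1)) //= lerDl sumr_ge0.
rewrite (big_cat_nat (n := 4)) //=; last exact: ltnW.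
apply: (le_trans (ler_normD _ _)); apply: lerD; first exact: ler_norm_sum.
apply: (@abel_bound R (fun n => f n%:R) (fun n => ln n%:R / n%:R)); first exact: ltnW.
- by move=> k _; exact: sum_mean_zero_le.
- by move=> k; exact: ln_over_n_decreasing.
- by rewrite divr_ge0 ?ln_nat_ge0.
Qed.

(** For a nonprincipal character in place of [f] this is the classical bound on [L(1, chi)] times
    the sum of [chi d * von_mangoldt d / d]. It comes from inserting [ln = von_mangoldt * 1] in the
    bounded sum of [f n * ln n / n]. *)
Lemma von_mangoldt_Lval_bounded f : mean_zero f ->
  exists C, forall N, `|\sum_(1 <= d < N.+1) Lam d / d%:R * Lval pp (shift d%:R f)| <= C.
Proof.
move=> mf; have [B HB] := sum_ln_over_n_bounded mf.
exists (B + rate f * 4) => N.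
pose S d := \sum_(1 <= m < (N %/ d).+1) f (d * m)%:R / m%:R.
have E : \sum_(1 <= n < N.+1) f n%:R * (ln n%:R / n%:R) = \sum_(1 <= d < N.+1) Lam d / d%:R * S d.
  transitivity (\sum_(1 <= n < N.+1) \sum_(d <- divisors n)
      Lam d / d%:R * (f (d * (n %/ d))%:R / (n %/ d)%:R)).
    apply: eq_big_nat => n /andP[n0 _]; rewrite -sum_von_mangoldt // mulr_suml mulr_sumr.
    rewrite big_seq [RHS]big_seq; apply: eq_bigr => d; rewrite -dvdn_divisors // => dn.
    have d0 := dvdn_gt0 n0 dn; rewrite [in RHS]mulnC divnK // -{2}(divnK dn) natrM.
    by rewrite invfM; ring.
  rewrite (sum_sum_divisors N (fun d m => Lam d / d%:R * (f (d * m)%:R / m%:R))).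
  by apply: eq_bigr => d _; rewrite mulr_sumr.
have [->|N0] := posnP N.
  rewrite big_geq // normr0; apply: addr_ge0; last by rewrite mulr_ge0 ?rate_ge0 ?ler0n.
  by have := HB 0%N; rewrite big_geq // normr0.
rewrite (_ : \sum_(1 <= d < N.+1) _ = \sum_(1 <= n < N.+1) f n%:R * (ln n%:R / n%:R)
  - \sum_(1 <= d < N.+1) Lam d / d%:R * (S d - Lval pp (shift d%:R f))); last first.
  rewrite E -sumrB; apply: eq_bigr => d _; ring.
apply: (le_trans (ler_normB _ _)); apply: lerD => //.
apply: (le_trans (ler_norm_sum _ _ _)).
apply: (@le_trans _ _ (\sum_(1 <= d < N.+1) Lam d * (rate f / N%:R))).
  rewrite big_nat_cond [leRHS]big_nat_cond; apply: ler_sum => d /andP[/andP[d0 dN] _].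
  have d0' : 0 < d%:R :> R by rewrite ltr0n.
  rewrite normrM ger0_norm ?divr_ge0 ?von_mangoldt_ge0 // -mulrA ler_wpM2l ?von_mangoldt_ge0 //.
  rewrite ler_pdivrMl //; apply: (le_trans (Lval_shift_rate pp mf d0 dN)).
  by rewrite le_eqVlt; apply/orP; left; apply/eqP; ring.
rewrite -mulr_suml -/(psi R N); have N0' : 0 < N%:R :> R by rewrite ltr0n.
rewrite mulrA ler_pdivrMr // [leLHS]mulrC -[leRHS]mulrA ler_wpM2l ?rate_ge0 //; exact: psi_le.
Qed.

Lemma sum_mobius_ln n : (0 < n)%N ->
  \sum_(d <- divisors n) mobius R d * ln (n %/ d)%:R = Lam n.
Proof.
move=> n0.
transitivity (\sum_(d <- divisors n) \sum_(e <- divisors (n %/ d)) mobius R d * Lam e).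
  rewrite big_seq [RHS]big_seq; apply: eq_bigr => d; rewrite -dvdn_divisors // => dn.
  by rewrite -mulr_sumr sum_von_mangoldt // divn_gt0 ?(dvdn_gt0 n0) // dvdn_leq.
rewrite (sum_divisors_swap (fun d e => mobius R d * Lam e)) //.
rewrite (bigD1_seq n) ?divisors_uniq ?divisors_id //= divnn n0.
rewrite -mulr_suml sum_mobius // mul1r big_seq_cond big1 ?addr0 // => e.
rewrite -dvdn_divisors // => /andP[en ne]; rewrite -mulr_suml sum_mobius; last first.
  by rewrite divn_gt0 ?(dvdn_gt0 n0) // dvdn_leq.
case: eqP => [E|]; last by rewrite mul0r.
by move: ne; rewrite -(divnK en) E mul1n eqxx.
Qed.

(** The term [ln n] drops out because the Moebius function sums to 0 over the divisors of [n > 1];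
    for the same reason a constant may be added to [- ln d] at the cost of a term at [n = 1]
    only. *)
Lemma sum_mobius_lnN n : (0 < n)%N ->
  Lam n = \sum_(d <- divisors n) mobius R d * - ln d%:R.
Proof.
move=> n0; rewrite -sum_mobius_ln //.
have -> : \sum_(d <- divisors n) mobius R d * ln (n %/ d)%:R =
    (\sum_(d <- divisors n) mobius R d) * ln n%:R + \sum_(d <- divisors n) mobius R d * - ln d%:R.
  rewrite mulr_suml -big_split big_seq [RHS]big_seq; apply: eq_bigr => d.
  rewrite -dvdn_divisors // => dn /=; have d0 := dvdn_gt0 n0 dn.
  rewrite -mulrDr -[in RHS](divnK dn) ln_natM ?addrK //.
  by rewrite divn_gt0 // dvdn_leq.
rewrite sum_mobius //; case: eqP => [->|_]; first by rewrite ln1 mulr0 add0r.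
by rewrite mul0r add0r.
Qed.

(* When all the translates of [f] vanish at 1, Moebius inversion shows that the
   von Mangoldt sum of [f] behaves as if [f(1)] carried a pole of opposite sign. *)
Lemma von_mangoldt_Lval_zero f : mean_zero f -> (forall g, Lval pp (shift g f) = 0) ->
  exists C, forall N, (0 < N)%N ->
  `|\sum_(1 <= d < N.+1) Lam d / d%:R * f d%:R + f 1 * ln N%:R| <= C.
Proof.
move=> mf Lf; exists (rate f) => N N0.
have N0' : 0 < N%:R :> R by rewrite ltr0n.
pose S d := \sum_(1 <= m < (N %/ d).+1) f (d * m)%:R / m%:R.
(* The constant added to [- ln d] is [ln N]: it makes the weights nonnegative and produces the term
   [f 1 * ln N]. *)
have -> : \sum_(1 <= d < N.+1) Lam d / d%:R * f d%:R + f 1 * ln N%:R =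
    \sum_(1 <= d < N.+1) mobius R d / d%:R * (ln N%:R - ln d%:R) * S d.
  transitivity (\sum_(1 <= n < N.+1) \sum_(d <- divisors n)
      (mobius R d / d%:R * (ln N%:R - ln d%:R)) * (f (d * (n %/ d))%:R / (n %/ d)%:R)); last first.
    rewrite (sum_sum_divisors N (fun d m => mobius R d / d%:R * (ln N%:R - ln d%:R) * (f (d * m)%:R / m%:R))).
    by apply: eq_bigr => d _; rewrite mulr_sumr.
  transitivity (\sum_(1 <= n < N.+1) (f n%:R / n%:R) * ((n == 1%N)%:R * ln N%:R + Lam n)).
    under [RHS]eq_bigr do rewrite mulrDr.
    rewrite big_split /= [LHS]addrC; congr (_ + _); last by apply: eq_bigr => d _; ring.
    rewrite big_ltn ?ltnS // eqxx invr1 mulr1 mul1r.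
    rewrite big_nat_cond big1 ?addr0 // => n /andP[/andP[n1 _] _].
    by rewrite gtn_eqF // mul0r mulr0.
  apply: eq_big_nat => n /andP[n0 _].
  rewrite (sum_mobius_lnN n0) -(sum_mobius R n0) mulr_suml -big_split mulr_sumr /=.
  rewrite big_seq [RHS]big_seq; apply: eq_bigr => d; rewrite -dvdn_divisors // => dn.
  rewrite [in RHS]mulnC divnK //.
  have -> : (n%:R : R)^-1 = (n %/ d)%:R^-1 / d%:R by rewrite -invfM -natrM divnK.
  by ring.
apply: (le_trans (ler_norm_sum _ _ _)).
apply: (@le_trans _ _ (\sum_(1 <= d < N.+1) (ln N%:R - ln d%:R) * (rate f / N%:R))).
  rewrite big_nat_cond [leRHS]big_nat_cond; apply: ler_sum => d /andP[/andP[d0 dN] _].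
  have d0' : 0 < d%:R :> R by rewrite ltr0n.
  have lnd : 0 <= ln (N%:R : R) - ln d%:R.
    by rewrite subr_ge0 ler_ln ?posrE // ler_nat.
  rewrite !normrM (ger0_norm lnd) normfV (ger0_norm (ltW d0')).
  have := Lval_shift_rate pp mf d0 dN; rewrite Lf subr0 -/(S d) => HS.
  rewrite mulrAC [leRHS]mulrC; apply: ler_wpM2r => //.
  apply: (@le_trans _ _ (1 / d%:R * (rate f * d%:R / N%:R))).
    by rewrite ler_pM ?mulr_ge0 ?invr_ge0 ?normr_ge0 // ler_wpM2r ?invr_ge0 // norm_mobius_le1.
  by rewrite le_eqVlt; apply/orP; left; apply/eqP; field; rewrite !gt_eqF.
rewrite -mulr_suml mulrA ler_pdivrMr // mulrC ler_wpM2l ?rate_ge0 //.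
(* The weights [ln N - ln d] add up to [N * ln N - ln N!], at most [N], which cancels the [1 / N] of
   the error. *)
rewrite sumrB; have /andP[H _] := ln_fact_bounds R N.
have <- : ln (N`!%:R : R) = \sum_(1 <= d < N.+1) ln (d%:R : R).
  elim: (N) => [|n IH]; first by rewrite big_geq // fact0 ln1.
  by rewrite big_nat_recr //= -IH factS ln_natM ?fact_gt0 // addrC.
rewrite big_const_nat subn1 /= iter_addr_0 -[X in X - _]mulr_natl; lra.
Qed.
End Relations.

(** * The Lambert kernel near 1 *)

Section Lambert.
Variable R : realType.
Local Open Scope ring_scope.
Variable t : R.
Hypothesis t01 : 0 < t < 1.
Let z := 1 - t.

Let t0 : 0 < t. Proof. by case/andP: t01. Qed.
Let z0 : 0 < z. Proof. by case/andP: t01 => _ ?; rewrite /z subr_gt0. Qed.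
Let z1 : z < 1. Proof. by rewrite /z gtrBl. Qed.

Lemma bernoulli n : 1 - n%:R * t <= z ^+ n.
Proof.
elim: n => [|n IH]; first by rewrite mul0r subr0.
rewrite exprS; apply: (@le_trans _ _ (z * (1 - n%:R * t))); last by rewrite ler_pM2l.
have : 0 <= n%:R * t ^+ 2 by rewrite mulr_ge0 ?sqr_ge0.
rewrite -natr1 /z expr2; lra.
Qed.

Definition geom n : R := \sum_(0 <= i < n) z ^+ i.

Lemma geomE n : geom n * t = 1 - z ^+ n.
Proof.
elim: n => [|n IH]; first by rewrite /geom big_geq // mul0r subrr.
rewrite /geom big_nat_recr //= mulrDl -/(geom n) IH exprSr /z; ring.
Qed.

Lemma geom_ge n : n.+1%:R * (1 - n%:R * t / 2) <= geom n.+1.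
Proof.
elim: n => [|n IH]; first by rewrite /geom big_nat1 mul0r mul0r subr0 mulr1.
rewrite /geom big_nat_recr //=; have := bernoulli n.+1; rewrite -/(geom n.+1).
move: IH; rewrite -[n.+2%:R]natr1 -[n.+1%:R]natr1; lra.
Qed.

(** This is the monotonicity of [lambert_diff] with denominators cleared. *)
Lemma geom_mul_ge n : n%:R * n.+1%:R * z ^+ n <= geom n * geom n.+1.
Proof.
elim: n => [|n IH]; first by rewrite !mul0r /geom big_geq // mul0r.
have zn : 0 < z ^+ n by rewrite exprn_gt0.
have -> : geom n.+1 * geom n.+2 = geom n * geom n.+1 + geom n.+1 * (z ^+ n + z ^+ n.+1).
  have -> : geom n.+2 = geom n + (z ^+ n + z ^+ n.+1) by rewrite /geom !big_nat_recr //= addrA.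
  by rewrite mulrDr mulrC.
apply: (@le_trans _ _ (z ^+ n * (n%:R * n.+1%:R + geom n.+1 * (1 + z)))); last first.
  move: IH; rewrite exprS; lra.
rewrite exprS -natr1 mulrA [leLHS]mulrC; apply: ler_wpM2l; first exact: ltW.
have H : (1 + z) * (n.+1%:R * (1 - n%:R * t / 2)) <= (1 + z) * geom n.+1.
  by apply: ler_wpM2l; [rewrite addr_ge0 // ltW|exact: geom_ge].
apply: (@le_trans _ _ (n%:R * n.+1%:R + (1 + z) * (n.+1%:R * (1 - n%:R * t / 2)))); last by lra.
have n0 : 0 <= n%:R :> R by []. 
rewrite -[n.+2%:R]natr1 -[n.+1%:R]natr1 /z; move: (n%:R) n0 t0 => x x0 t0'.
have : 0 <= (x + 1) * (x * t ^+ 2 / 2 + t) by apply: mulr_ge0; [lra|apply: addr_ge0; [apply: mulr_ge0; [apply: mulr_ge0; [|exact: sqr_ge0]|]|]; lra].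
rewrite expr2; lra.
Qed.

(** The Lambert kernel subtracted from its leading term as [t] tends to 0. It is nonnegative and
    decreasing in [n], with value 1 at [n = 1], so Abel summation bounds its sums against [chi]
    uniformly in [t]. *)
Definition lambert_diff n : R := (n%:R * t)^-1 - z ^+ n / (1 - z ^+ n).

Lemma subr1z_gt0 n : (0 < n)%N -> 0 < 1 - z ^+ n.
Proof. by move=> n0; rewrite subr_gt0 exprn_ilt1 // ?gt_eqF // -?lt0n // ltW. Qed.

Lemma geom_gt0 n : (0 < n)%N -> 0 < geom n.
Proof. by move=> n0; rewrite -(pmulr_lgt0 _ t0) geomE subr1z_gt0. Qed.

Lemma lambert_diff_decr n : (0 < n)%N -> lambert_diff n.+1 <= lambert_diff n.
Proof.
move=> n0; have n0' : 0 < n%:R :> R by rewrite ltr0n.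
rewrite -subr_ge0 /lambert_diff -!geomE.
have g0 := geom_gt0 n0; have g1 := geom_gt0 (ltn0Sn n).
have G := geom_mul_ge n.
have E : geom n.+1 = geom n + z ^+ n by rewrite /geom big_nat_recr.
have Gt := geomE n.
have -> : (n%:R * t)^-1 - z ^+ n / (geom n * t) - ((n.+1%:R * t)^-1 - z ^+ n.+1 / (geom n.+1 * t))
   = (geom n * geom n.+1 - n%:R * n.+1%:R * z ^+ n) / (n%:R * n.+1%:R * (geom n * geom n.+1) * t).
  rewrite exprS E -natr1; move: Gt g0 g1; rewrite E /z.
  move: (geom n) ((1 - t) ^+ n) (n%:R) n0' => g y x x0 Gt g0 g1.
  have -> : y = 1 - g * t by rewrite Gt; ring.
  have g1' : 0 < g + (1 - g * t) by rewrite Gt subKr in g1 *.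
  field; rewrite !gt_eqF // ?addr_gt0 //.
apply: divr_ge0; first by rewrite subr_ge0.
by rewrite !mulr_ge0 // ltW.
Qed.

Lemma lambert_diff_ge0 n : (0 < n)%N -> 0 <= lambert_diff n.
Proof.
move=> n0; have n0' : 0 < n%:R :> R by rewrite ltr0n.
have g0 := geom_gt0 n0; rewrite /lambert_diff -geomE subr_ge0 ler_pdivrMr ?mulr_gt0 //.
rewrite ler_pdivlMl ?mulr_gt0 // mulrAC ler_pM2r // /geom mulr_natl.
apply: (@le_trans _ _ (\sum_(0 <= i < n) z ^+ n)); first by rewrite big_const_nat subn0 iter_addr_0.
rewrite big_nat_cond [leRHS]big_nat_cond; apply: ler_sum => i /andP[/andP[_ im] _].
by apply: ler_wiXn2l; [exact: ltW|exact: ltW|exact: ltnW].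
Qed.

Lemma lambert_diff1 : lambert_diff 1 = 1.
Proof. by rewrite /lambert_diff mul1r expr1 /z subKr; field; rewrite gt_eqF. Qed.

(** A finite expansion with explicit remainder, so that no infinite series occurs. *)
Lemma lambert_expand n J : (0 < n)%N -> z ^+ n / (1 - z ^+ n) =
  \sum_(1 <= j < J.+1) z ^+ (n * j) + z ^+ (n * J.+1) / (1 - z ^+ n).
Proof.
move=> n0; have d0 := subr1z_gt0 n0; elim: J => [|J IH].
  by rewrite big_geq // add0r muln1.
rewrite IH [in RHS]big_nat_recr //= -addrA; congr (_ + _).
rewrite (mulnSr n J.+1) exprD; field.
by rewrite gt_eqF.
Qed.

Lemma pow_le_inv M : (0 < M)%N -> z ^+ M <= (M%:R * t)^-1.
Proof.
move=> M0; have M0' : 0 < M%:R :> R by rewrite ltr0n.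
have H : z ^+ M * (1 + M%:R * t) <= 1.
  elim: (M) => [|m IH]; first by rewrite mul0r addr0 mulr1.
  apply: le_trans IH; rewrite exprSr -mulrA ler_wpM2l ?exprn_ge0 // ?(ltW z0) //.
  have : 0 <= m.+1%:R * t ^+ 2 by rewrite mulr_ge0 ?sqr_ge0.
  rewrite -natr1 /z expr2; lra.
rewrite -[leRHS]mul1r ler_pdivlMr ?mulr_gt0 //; apply: le_trans H.
by rewrite ler_wpM2l ?exprn_ge0 ?(ltW z0) // lerDr.
Qed.
End Lambert.

(** * A quadratic character does not vanish at 1 *)

Section RealCharacter.
Variables (R : realType) (p : nat).
Hypothesis pp : prime p.
Local Open Scope ring_scope.
Notation F := 'F_p.
Variable chi : F -> R.
Hypothesis chi0 : chi 0 = 0.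
Hypothesis chi_sign : forall h, h != 0 -> chi h = 1 \/ chi h = -1.
Hypothesis chiM : forall g h, chi (g * h) = chi g * chi h.
Hypothesis chi_mean_zero : mean_zero chi.
Hypothesis Lchi : Lval pp chi = 0.

Lemma real_char_norm_le1 h : `|chi h| <= 1.
Proof.
have [->|/chi_sign[]->] := eqVneq h 0; first by rewrite chi0 normr0.
  by rewrite normr1.
by rewrite normrN1.
Qed.

Lemma real_char1 : chi 1 = 1.
Proof.
have := chiM 1 1; rewrite mulr1; have [->//|->] := chi_sign (oner_neq0 F).
by rewrite mulrNN mulr1.
Qed.

Lemma real_charX (q i : nat) : chi (q ^ i)%:R = chi q%:R ^+ i.
Proof.
by elim: i => [|i IH]; rewrite ?real_char1 // expnS natrM chiM IH exprS.
Qed.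

Definition conv1 (n : nat) : R := \sum_(d <- divisors n) chi d%:R.

Lemma conv1_pfactorM q a m : prime q -> (0 < m)%N -> coprime q m ->
  conv1 (q ^ a * m)%N = (\sum_(i <- iota 0 a.+1) chi q%:R ^+ i) * conv1 m.
Proof.
move=> qp m0 c; have c' : coprime (q ^ a) m by apply: coprimeXl.
have qa0 : (0 < q ^ a)%N by rewrite expn_gt0 prime_gt0.
rewrite /conv1 (perm_big _ (divisorsM qa0 m0 c')) big_allpairs_dep /=.
rewrite (perm_big _ (perm_divisors_pfactor _ qp)) big_map mulr_suml.
apply: eq_bigr => i _; rewrite mulr_sumr; apply: eq_bigr => d _.
by rewrite natrM chiM real_charX.
Qed.

Lemma conv1_1 : conv1 1 = 1.
Proof. by rewrite /conv1 (_ : divisors 1 = [:: 1%N]) // big_seq1 real_char1. Qed.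

Lemma conv1_ge0 n : (0 < n)%N -> 0 <= conv1 n.
Proof.
elim/ltn_ind: n => n IH n0; have [n1|n1] := leqP n 1.
  by rewrite (_ : n = 1%N) ?conv1_1 //; lia.
have qp := pdiv_prime n1; have [m cqm nE] := pfactor_coprime qp n0.
have : (0 < logn (pdiv n) n)%N by rewrite logn_gt0 mem_primes qp n0 pdiv_dvd.
move: (pdiv n) (logn _ n) qp cqm nE => q a qp cqm nE a0.
have m0 : (0 < m)%N by move: n0; rewrite nE muln_gt0 => /andP[].
rewrite nE mulnC conv1_pfactorM // mulr_ge0 ?IH //; last first.
  by rewrite nE ltn_Pmulr // -(expn0 q) ltn_exp2l // prime_gt1.
have [q0|/chi_sign[]->] := eqVneq (q%:R : F) 0.
- by rewrite q0 chi0; apply: sumr_ge0 => i _; rewrite exprn_ge0.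
- by apply: sumr_ge0 => i _; rewrite expr1n.
suff -> : \sum_(i <- iota 0 a.+1) (-1) ^+ i = (~~ odd a)%:R :> R by [].
elim: a {nE a0} => [|a IHa]; first by rewrite big_seq1.
rewrite -(addn1 a.+1) iotaD big_cat big_seq1 /= IHa add0n -signr_odd /=.
by case: (odd a); rewrite ?add0r ?subrr ?expr0.
Qed.

(** Powers of the modulus play the part usually given to perfect squares: they are sparser, but an
    unbounded number of terms equal to 1 is enough. *)
Lemma conv1_ppow a : conv1 (p ^ a)%N = 1.
Proof.
rewrite /conv1 (perm_big _ (perm_divisors_pfactor _ pp)) big_map big_cons expn0 real_char1.
rewrite big_seq big1 /= ?addr0 // => i; rewrite mem_iota => /andP[i1 _].
by rewrite real_charX pchar_Fp_0 // chi0 expr0n gtn_eqF.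
Qed.

(** Of the three terms, the first comes from [lambert_diff], the second from the sum of [chi d / d],
    which is within its rate of [Lval pp chi = 0], and the third from cutting the geometric series
    at [N]. *)
Lemma lambert_bound (t : R) N : 0 < t < 1 ->
  \sum_(1 <= n < N.+1) conv1 n * (1 - t) ^+ n <=
  l1 chi + l1 chi * Lrate R p / N.+1%:R / t + N%:R * (1 - t) ^+ N / t.
Proof.
move=> t01; have /andP[t0 t1] := t01; set z := 1 - t.
have z0 : 0 < z by rewrite subr_gt0.
have z1 : z < 1 by rewrite gtrBl.
have -> : \sum_(1 <= n < N.+1) conv1 n * z ^+ n =
    - \sum_(1 <= d < N.+1) chi d%:R * lambert_diff t d
    + (\sum_(1 <= d < N.+1) chi d%:R / d%:R) / t
    - \sum_(1 <= d < N.+1) chi d%:R * (z ^+ (d * (N %/ d).+1) / (1 - z ^+ d)).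
  transitivity (\sum_(1 <= n < N.+1) \sum_(d <- divisors n) chi d%:R * z ^+ (d * (n %/ d))).
    apply: eq_big_nat => n /andP[n0 _]; rewrite mulr_suml big_seq [RHS]big_seq.
    by apply: eq_bigr => d; rewrite -dvdn_divisors // => dn; rewrite [in RHS]mulnC divnK.
  rewrite (sum_sum_divisors N (fun d m => chi d%:R * z ^+ (d * m))).
  rewrite mulr_suml -sumrN -sumrN -!big_split /=.
  apply: eq_big_nat => d /andP[d0 _]; rewrite -mulr_sumr /lambert_diff -/z.
  rewrite (lambert_expand t01 (N %/ d) d0) -/z.
  have -> : (d%:R * t)^-1 = d%:R^-1 / t by rewrite invfM.
  by ring.
have H1 : `|\sum_(1 <= d < N.+1) chi d%:R * lambert_diff t d| <= l1 chi.
  have := @abel_bound R (fun d => chi d%:R) (lambert_diff t) 1 N.+1 (l1 chi) isT.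
  rewrite lambert_diff1 // mulr1; apply.
  - by move=> k _; exact: sum_mean_zero_le.
  - by move=> k k1; exact: lambert_diff_decr.
  - exact: lambert_diff_ge0.
have H2 : `|\sum_(1 <= d < N.+1) chi d%:R / d%:R| <= l1 chi * Lrate R p / N.+1%:R.
  by have := Lval_rate pp N chi_mean_zero; rewrite Lchi subr0.
have H3 : `|\sum_(1 <= d < N.+1) chi d%:R * (z ^+ (d * (N %/ d).+1) / (1 - z ^+ d))| <=
    N%:R * z ^+ N / t.
  apply: (le_trans (ler_norm_sum _ _ _)).
  apply: (@le_trans _ _ (\sum_(1 <= d < N.+1) z ^+ N / t)); last first.
    by rewrite big_const_nat subn1 iter_addr_0 -[leLHS]mulr_natl mulrA.
  rewrite big_nat_cond [leRHS]big_nat_cond; apply: ler_sum => d /andP[/andP[d0 dN] _].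
  have D0 := subr1z_gt0 t01 d0; rewrite -/z in D0.
  rewrite normrM; apply: (@le_trans _ _ (1 * `|z ^+ (d * (N %/ d).+1) / (1 - z ^+ d)|)).
    by rewrite ler_wpM2r // real_char_norm_le1.
  rewrite mul1r ger0_norm ?divr_ge0 ?exprn_ge0 ?(ltW z0) ?(ltW D0) //.
  (* The exponent [d * (N %/ d + 1)] exceeds [N], and [1 - z ^ d >= 1 - z = t]. *)
  apply: ler_pM; rewrite ?invr_ge0 ?exprn_ge0 ?(ltW z0) ?(ltW D0) //.
    by apply: ler_wiXn2l; rewrite ?(ltW z0) ?(ltW z1) // mulnC ltnW // ltn_ceil.
  rewrite lef_pV2 ?posrE // -[leLHS](subKr 1) -/z lerD2l lerN2.
  by rewrite -[leRHS]expr1; apply: ler_wiXn2l; rewrite ?(ltW z0) ?(ltW z1).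
have H4 : (\sum_(1 <= d < N.+1) chi d%:R / d%:R) / t <= l1 chi * Lrate R p / N.+1%:R / t.
  by rewrite ler_pM2r ?invr_gt0 //; apply: le_trans (ler_norm _) H2.
move: H1 H3 H4; move: (N%:R * z ^+ N / t) (l1 chi) => v l.
move: (\sum_(1 <= d < N.+1) _ * lambert_diff t d) (_ / t) (\sum_(1 <= d < N.+1) _ * (_ / _)) => a b c.
move: (l * _ / _ / _) => u; rewrite !ler_norml => /andP[? ?] /andP[? ?] ?; lra.
Qed.

Lemma real_character_contradiction : False.
Proof.
have [K HK] : exists K : nat, l1 chi + 2 < K%:R / 2 :> R.
  exists (Num.bound ((l1 chi + 2) * 2)); rewrite ltr_pdivlMr //.
  by apply: archi_boundP; rewrite mulr_ge0 ?addr_ge0 ?l1_ge0.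
(* For [a < K] Bernoulli's inequality gives [z ^ (p ^ a) >= 1 - p ^ a * t >= 1 / 2], so the powers
   of [p] alone contribute [K / 2]. *)
pose t : R := (2 * (p ^ K)%:R)^-1.
have pK0 : 0 < (p ^ K)%:R :> R by rewrite ltr0n expn_gt0 prime_gt0.
have pK1 : 1 <= (p ^ K)%:R :> R by rewrite ler1n expn_gt0 prime_gt0.
have t01 : 0 < t < 1.
  by rewrite invr_gt0 mulr_gt0 //= invf_lt1 ?mulr_gt0 //; lra.
have /andP[t0 t1] := t01; set z := 1 - t.
have z0 : 0 < z by rewrite subr_gt0.
set D := l1 chi * Lrate R p.
have D0 : 0 <= D by rewrite mulr_ge0 ?l1_ge0 ?sumr_ge0 // => h _; exact: l1_ge0.
have t3 : 0 < t ^+ 3 by rewrite exprn_gt0.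
have [M HM] : exists M : nat, [/\ (p ^ K <= M)%N, D / t <= M%:R & 2 / t ^+ 3 <= M%:R :> R].
  exists (p ^ K + Num.bound (D / t) + Num.bound (2 / t ^+ 3))%N.
  have B1 : D / t < (Num.bound (D / t))%:R by apply: archi_boundP; rewrite divr_ge0 // ltW.
  have B2 : 2 / t ^+ 3 < (Num.bound (2 / t ^+ 3))%:R.
    by apply: archi_boundP; rewrite divr_ge0 // ltW.
  rewrite !natrD; split; first by rewrite -addnA leq_addr.
    by have : 0 <= (Num.bound (2 / t ^+ 3))%:R :> R by []; lra.
  by have : 0 <= (Num.bound (D / t))%:R :> R by []; lra.
case: HM => M1 M2 M3; have M0 : (0 < M)%N by apply: leq_trans M1; rewrite expn_gt0 prime_gt0.
have M0' : 0 < M%:R :> R by rewrite ltr0n.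
have := lambert_bound M.*2 t01; rewrite -/z -/D.
have A1 : D / M.*2.+1%:R / t <= 1.
  rewrite mulrAC ler_pdivrMr ?ltr0n // mul1r; apply: (le_trans M2).
  by rewrite ler_nat -addnn -addnS leq_addr.
(* The truncation is at [2 * M] because the bound of [pow_le_inv] must be squared to beat the factor
   [M]. *)
have A2 : M.*2%:R * z ^+ M.*2 / t <= 1.
  have H := pow_le_inv t01 M0; rewrite -/z in H.
  rewrite ler_pdivrMr // mul1r -addnn exprD natrD.
  apply: (@le_trans _ _ ((M%:R + M%:R) * ((M%:R * t)^-1 * (M%:R * t)^-1))).
    rewrite ler_wpM2l ?addr_ge0 //; apply: ler_pM => //; exact: exprn_ge0 (ltW z0).
  have -> : (M%:R + M%:R) * ((M%:R * t)^-1 * (M%:R * t)^-1) = 2 / t ^+ 3 / M%:R * t.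
    by field; rewrite !gt_eqF.
  by rewrite ger_pMl // ler_pdivrMr // mul1r.
suff A3 : K%:R / 2 <= \sum_(1 <= n < M.*2.+1) conv1 n * z ^+ n.
  move: A1 A2 A3 HK; move: (M.*2%:R * z ^+ M.*2 / t) (\sum_(1 <= n < _) _) => a b.
  move: (D / _ / t) (K%:R / 2) (l1 chi) => c d e; lra.
apply: (@le_trans _ _ (\sum_(n <- [seq (p ^ a)%N | a <- iota 0 K]) conv1 n * z ^+ n)).
  rewrite big_map; apply: (@le_trans _ _ (\sum_(a <- iota 0 K) 2^-1)).
    by rewrite big_const_seq count_predT size_iota iter_addr_0 mulr_natl.
  rewrite big_seq [leRHS]big_seq; apply: ler_sum => a; rewrite mem_iota add0n => /andP[_ aK].
  rewrite conv1_ppow mul1r; apply: le_trans (bernoulli t01 (p ^ a)).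
  have : (p ^ a)%:R * t <= (p ^ K)%:R * t.
    by rewrite ler_pM2r // ler_nat leq_exp2l ?prime_gt1 // ltnW.
  have -> : (p ^ K)%:R * t = 2^-1 by rewrite /t; field; rewrite gt_eqF.
  lra.
set s := [seq (p ^ a)%N | a <- iota 0 K].
have P : perm_eq s [seq n <- index_iota 1 M.*2.+1 | n \in s].
  apply: uniq_perm; last 1 first.
  - move=> n; rewrite mem_filter mem_index_iota; case: (boolP (n \in s)) => //= /mapP[a].
    rewrite mem_iota add0n => aK ->.
    have pa0 : (0 < p ^ a)%N by rewrite expn_gt0 prime_gt0.
    rewrite pa0 ltnS /=; apply/esym.
    apply: (@leq_trans (p ^ K)); first by rewrite leq_exp2l ?prime_gt1 // ltnW //; case/andP: aK.
    by apply: (leq_trans M1); rewrite -addnn leq_addr.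
  - rewrite map_inj_uniq ?iota_uniq // => i j /eqP.
    by rewrite eqn_exp2l ?prime_gt1 // => /eqP.
  - by rewrite filter_uniq // iota_uniq.
rewrite (perm_big _ P) big_filter big_mkcond big_nat_cond [leRHS]big_nat_cond.
apply: ler_sum => n /andP[/andP[n0 _] _]; case: ifP => // _.
by rewrite mulr_ge0 ?conv1_ge0 // exprn_ge0 // ltW.
Qed.
End RealCharacter.

(** * The limit distribution of the primes among the residues *)

Section LimitMeasure.
Variables (R : realType) (p : nat).
Hypothesis pp : prime p.
Local Open Scope ring_scope.
Notation F := 'F_p.
Variable a : F -> R.
Hypothesis a0 : a 0 = 0.
Hypothesis a_ge0 : forall h, 0 <= a h.
Hypothesis a_sum : \sum_h a h = 1.
Hypothesis aN1 : a (-1) = 0.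
Hypothesis a_range : forall f : F -> R, mean_zero f -> \sum_h Lval pp (shift h f) * a h = 0.
Hypothesis a_ker : forall f : F -> R, mean_zero f -> (forall g, Lval pp (shift g f) = 0) ->
  \sum_h f h * a h = - f 1.

Let c := Lconst R pp.
Let G u := \sum_h a h * c (h^-1 * u).

Lemma sum_divl (T : nmodType) (H : F -> T) u : u != 0 -> \sum_k H (u / k) = \sum_k H k.
Proof.
move=> u0; rewrite [RHS](reindex (fun k => u / k)) //=.
have K : involutive (fun k : F => u / k).
  move=> k /=; rewrite invfM invrK; have [->|k0] := eqVneq k 0; first by rewrite mulr0 mulr0.
  by rewrite mulrA divff // mul1r.
by apply/onW_bij; exists (fun k => u / k).
Qed.

Lemma sum_delta (H : F -> R) h u : h != 0 -> u != 0 ->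
  \sum_(k | k != 0) (h * k == u)%:R * H k = H (h^-1 * u).
Proof.
move=> h0 u0; rewrite (bigD1 (h^-1 * u)) /=; last by rewrite mulf_neq0 ?invr_eq0.
rewrite mulVKf // eqxx mul1r big1 ?addr0 // => k /andP[_ kn].
case: eqP => [E|]; last by rewrite mul0r.
by move: kn; rewrite -E mulKf // eqxx.
Qed.

(** [G] is the convolution of [a] with [Lconst]; this is [a_range] for the difference of two
    indicators. *)
Lemma G_const u v : u != 0 -> v != 0 -> G u = G v.
Proof.
move=> u0 v0; pose f k : R := (k == u)%:R - (k == v)%:R.
have mf : mean_zero f.
  split; first by rewrite /f ![0 == _]eq_sym (negPf u0) (negPf v0) subrr.
  by rewrite sumrB !sum_eq // subrr.
apply/eqP; rewrite -subr_eq0; apply/eqP; rewrite -[RHS](a_range mf) /G -sumrB; apply: eq_bigr => h _.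
have [->|h0] := eqVneq h 0; first by rewrite a0 mulr0 !mul0r subrr.
rewrite /Lval /shift /f; under [X in _ = X * _]eq_bigr do rewrite mulrBl.
by rewrite sumrB !sum_delta // mulrBl -!(mulrC (a h)).
Qed.

(** Built from [a] itself so that [G_const] makes the values at 1 of all its translates vanish, as
    [a_ker] requires. *)
Definition fdiff u v k : R := a (u / k) - a (v / k).

Lemma fdiff_mean_zero u v : u != 0 -> v != 0 -> mean_zero (fdiff u v).
Proof.
move=> u0 v0; split; first by rewrite /fdiff invr0 !mulr0 subrr.
by rewrite sumrB !sum_divl // subrr.
Qed.

Lemma fdiff_Lval u v g : u != 0 -> v != 0 -> Lval pp (shift g (fdiff u v)) = 0.
Proof.
move=> u0 v0; have [->|g0] := eqVneq g 0.
  by rewrite /Lval /shift /fdiff big1 // => h _; rewrite mul0r invr0 !mulr0 subrr mul0r.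
have H w : w != 0 -> \sum_(k | k != 0) a (w / (g * k)) * c k = G (w / g).
  move=> w0; have wg0 : w / g != 0 by rewrite mulf_neq0 ?invr_eq0.
  transitivity (\sum_k a (w / (g * k)) * c k).
    by rewrite [RHS](bigD1 0) //= mulr0 invr0 mulr0 a0 mul0r add0r.
  rewrite -(sum_divl _ wg0) /G; apply: eq_bigr => h _.
  rewrite [w / g / h]mulrC; congr (a _ * c _).
  have [->|h0] := eqVneq h 0; first by rewrite invr0 !mul0r mulr0 invr0 mulr0.
  rewrite [g * _]mulrCA (mulrC w g^-1) mulVKf // invfM invrK mulrCA divff ?mulr1 //.
rewrite /Lval /shift /fdiff; under eq_bigr do rewrite mulrBl.
by rewrite sumrB !H // (@G_const _ (v / g)) ?subrr // mulf_neq0 ?invr_eq0.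
Qed.

Let conv u := \sum_h a (u / h) * a h.
Let kappa := conv 1 + a 1.
Let phi := card_units R p.

Let phi0 : 0 < phi. Proof. exact: card_units_gt0. Qed.

Lemma conv_add u : u != 0 -> conv u + a u = kappa.
Proof.
move=> u0; have u1 : (1 : F) != 0 by exact: oner_neq0.
have := a_ker (fdiff_mean_zero u0 u1) (fun g => fdiff_Lval g u0 u1).
rewrite /fdiff !divr1; under eq_bigr do rewrite mulrBl.
rewrite sumrB -/(conv u) -/(conv 1) /kappa; lra.
Qed.

Lemma sum_conv : \sum_u conv u = 1.
Proof.
rewrite exchange_big /= -[RHS]a_sum; apply: eq_bigr => h _.
have [->|h0] := eqVneq h 0; first by rewrite a0 big1 // => u _; rewrite mulr0.
rewrite -mulr_suml (_ : \sum_i a (i / h) = 1) ?mul1r //.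
rewrite -[RHS]a_sum [RHS](reindex (fun i => i / h)) //=.
by apply/onW_bij; exists (fun i => i * h) => i; rewrite ?divfK ?mulfK.
Qed.

Lemma phi_kappa : phi * kappa = 2.
Proof.
have c0 : conv 0 = 0 by rewrite /conv big1 // => h _; rewrite mul0r a0 mul0r.
rewrite -[RHS]/(1 + 1 : R) -{1}sum_conv -a_sum -big_split /= (bigD1 0) //= c0 a0 !add0r.
rewrite (eq_bigr (fun=> kappa)) => [|u u0]; last exact: conv_add.
have -> : phi = \sum_(h : F) (h != 0)%:R by rewrite sum_nonzero.
rewrite mulr_suml [LHS](bigD1 0) //= ?eqxx mul0r add0r.
by apply: eq_bigr => u u0; rewrite u0 mul1r.
Qed.

Lemma kappa_gt0 : 0 < kappa.
Proof. by rewrite -(pmulr_rgt0 _ phi0) phi_kappa. Qed.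

Lemma a_le_kappa h : a h <= kappa.
Proof.
have [->|h0] := eqVneq h 0; first by rewrite a0 ltW // kappa_gt0.
by rewrite -(conv_add h0) lerDr sumr_ge0 // => k _; rewrite mulr_ge0.
Qed.

(* Since [a (-1) = 0], the average [conv (-1)] of [a] attains its maximum. *)
Lemma a_values h : a h = 0 \/ a h = kappa.
Proof.
have N10 : (-1 : F) != 0 by rewrite oppr_eq0 oner_neq0.
(* As [a (-1) = 0], [conv_add] gives [conv (-1) = kappa]. The terms are nonnegative by [a_le_kappa],
   so each of them vanishes. *)
have Z : \sum_h (kappa - a (-1 / h)) * a h = 0.
  under eq_bigr do rewrite mulrBl.
  by rewrite sumrB -mulr_sumr a_sum mulr1 -/(conv (-1)) -(conv_add N10) aN1 addr0 subrr.
have Z' k : (kappa - a (-1 / k)) * a k = 0.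
  apply/eqP; move: Z => /eqP; rewrite psumr_eq0 => [/allP/(_ k)|i _].
    by rewrite mem_index_enum => /(_ isT).
  by rewrite mulr_ge0 // subr_ge0 a_le_kappa.
have S k : a k != 0 -> a (-1 / k) = kappa.
  by move=> ak; have /eqP := Z' k; rewrite mulf_eq0 (negPf ak) orbF subr_eq0 eq_sym => /eqP.
have [->|ah] := eqVneq (a h) 0; [by left|right].
(* The map sending [h] to [-1 / h] is an involution, so two applications return to [h]. *)
have hk := S h ah; have := S (-1 / h); rewrite hk gt_eqF ?kappa_gt0 // => /(_ isT) <-.
by congr a; rewrite !mulN1r invrN invrK opprK.
Qed.

(** Since [kappa = 2 / phi], this affine change sends the values 0 and [kappa] of [a] on the units
    to 1 and -1. *)
Definition limit_char h : R := (h != 0)%:R - phi * a h.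
Notation chi := limit_char.

Lemma limit_char_sign h : h != 0 -> chi h = 1 \/ chi h = -1.
Proof.
move=> h0; rewrite /chi h0; have [->|->] := a_values h.
  by left; rewrite mulr0 subr0.
by right; rewrite phi_kappa /=; lra.
Qed.

Lemma limit_char0 : chi 0 = 0. Proof. by rewrite /chi eqxx a0 mulr0 subrr. Qed.

Lemma sum_limit_char : \sum_h chi h = 0.
Proof. by rewrite sumrB sum_nonzero // -mulr_sumr a_sum mulr1 subrr. Qed.

Lemma limit_char_sq h : h != 0 -> chi h * chi h = 1.
Proof. by move=> /limit_char_sign[]->; rewrite ?mulr1 ?mulrNN ?mulr1. Qed.

Lemma limit_char_conv u : u != 0 -> \sum_h chi (u / h) * chi h = phi * chi u.
Proof.
move=> u0; have E h : chi (u / h) * chi h =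
    (h != 0)%:R - phi * a h - phi * a (u / h) + phi ^+ 2 * (a (u / h) * a h).
  rewrite /chi; have [->|h0] := eqVneq h 0.
    by rewrite invr0 mulr0 eqxx a0 /=; ring.
  by rewrite mulf_neq0 ?invr_eq0 //=; ring.
under eq_bigr do rewrite E.
rewrite big_split /= sumrB sumrB sum_nonzero // -!mulr_sumr sum_divl // a_sum -/(conv u).
have C : conv u = kappa - a u by rewrite -(conv_add u0) addrK.
have K : phi * phi * kappa = phi * 2 by rewrite -mulrA phi_kappa.
rewrite /chi u0 -/phi C expr2 mulrBr K !mulr1 mulrBr mulr1; ring.
Qed.

(** An equality case: by [limit_char_conv] the [p - 1] signs [chi u * chi (u / k) * chi k] add up to
    [p - 1], so each is 1. *)
Lemma limit_char_div u h : u != 0 -> h != 0 -> chi (u / h) = chi u * chi h.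
Proof.
move=> u0 h0.
have Z : \sum_(k | k != 0) (1 - chi u * (chi (u / k) * chi k)) = 0.
  transitivity (\sum_k ((k != 0)%:R - chi u * (chi (u / k) * chi k))).
    rewrite big_mkcond; apply: eq_bigr => k _; have [->|//] := eqVneq k 0.
    by rewrite limit_char0 !mulr0 subrr.
  by rewrite sumrB sum_nonzero // -mulr_sumr limit_char_conv // mulrCA limit_char_sq // mulr1 subrr.
have : 1 - chi u * (chi (u / h) * chi h) = 0.
  apply/eqP; move: Z => /eqP; rewrite psumr_eq0 => [/allP/(_ h)|k k0].
    by rewrite mem_index_enum h0 => /(_ isT).
  have uk0 : u / k != 0 by rewrite mulf_neq0 ?invr_eq0.
  by case: (limit_char_sign u0) (limit_char_sign uk0) (limit_char_sign k0) => -> [] -> [] ->; lra.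
have uh0 : u / h != 0 by rewrite mulf_neq0 ?invr_eq0.
by case: (limit_char_sign u0) (limit_char_sign uh0) (limit_char_sign h0) => -> [] -> [] ->; lra.
Qed.

Lemma limit_charM g h : chi (g * h) = chi g * chi h.
Proof.
have [->|g0] := eqVneq g 0; first by rewrite mul0r limit_char0 mul0r.
have [->|h0] := eqVneq h 0; first by rewrite mulr0 limit_char0 mulr0.
have := limit_char_div (mulf_neq0 g0 h0) h0; rewrite mulfK // => ->.
by rewrite -mulrA limit_char_sq // mulr1.
Qed.

(** When [chi v = -1], [fdiff 1 v] equals [- 2 / phi * chi] on the units, and its value at 1 is
    0. *)
Lemma Lval_limit_char : Lval pp chi = 0.
Proof.
have u1 : (1 : F) != 0 by exact: oner_neq0.
have [v av] : exists v, a v != 0.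
  apply: contrapT => H; have := a_sum.
  rewrite big1 => [/eqP|h _]; first by rewrite eq_sym oner_eq0.
  by apply/eqP/negPn/negP => ah; apply: H; exists h.
have v0 : v != 0 by apply: contraNneq av => ->; rewrite a0.
have cv : chi v = -1.
  by rewrite /chi v0; have [E|->] := a_values v; [rewrite E eqxx in av|rewrite phi_kappa /=; lra].
have c1 : chi 1 = 1.
  by have := limit_charM 1 1; rewrite mulr1; case: (limit_char_sign u1) => -> //; lra.
have := fdiff_Lval 1 u1 v0; rewrite /Lval /shift.
have E k : k != 0 -> fdiff 1 v (1 * k) = - 2 / phi * chi k.
  move=> k0; rewrite mul1r /fdiff.
  have A h : h != 0 -> a h = (1 - chi h) / phi.
    by move=> h0; rewrite /chi h0 /=; field; rewrite gt_eqF.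
  by rewrite !A ?mulf_neq0 ?invr_eq0 // !limit_char_div // cv c1; field; rewrite gt_eqF.
rewrite (_ : \sum_(_ | _) _ = - 2 / phi * Lval pp chi); last first.
  by rewrite /Lval mulr_sumr; apply: eq_bigr => k k0; rewrite E // mulrA.
move/eqP; rewrite mulf_eq0 => /orP[|/eqP //].
by rewrite mulf_eq0 invr_eq0 (gt_eqF phi0) orbF oppr_eq0 pnatr_eq0.
Qed.

Lemma limit_measure_contradiction : False.
Proof.
apply: (@real_character_contradiction R p pp chi limit_char0 limit_char_sign limit_charM) Lval_limit_char.
split; [exact: limit_char0|exact: sum_limit_char].
Qed.
End LimitMeasure.

(** * Divergence over the primes congruent to [-1] *)

Section Dirichlet.
Variables (R : realType) (p : nat).
Hypothesis pp : prime p.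
Local Open Scope ring_scope.
Notation F := 'F_p.
Notation Lam := (@von_mangoldt R).

Definition class_sum (h : F) N : R := \sum_(1 <= d < N.+1 | d%:R == h) Lam d / d%:R.

Lemma sum_class (u : F -> R) N :
  \sum_h u h * class_sum h N = \sum_(1 <= d < N.+1) Lam d / d%:R * u d%:R.
Proof.
rewrite /class_sum; under eq_bigr do rewrite mulr_sumr big_mkcond.
rewrite exchange_big; apply: eq_bigr => d _ /=.
rewrite (bigD1 (d%:R : F)) //= eqxx big1 ?addr0 1?mulrC // => h hd.
by rewrite eq_sym (negPf hd).
Qed.

Lemma class_sum_ge0 h N : 0 <= class_sum h N.
Proof. by rewrite sumr_ge0 // => d _; rewrite divr_ge0 ?von_mangoldt_ge0. Qed.

Lemma ln_ge_half N : (1 < N)%N -> 2^-1 <= ln (N%:R : R).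
Proof.
move=> N1; have /andP[l _] := ln2_bounds R; apply: (le_trans l).
by rewrite ler_ln ?posrE ?ltr0n ?ler_nat // ltnW.
Qed.

Lemma sum_class_sum N : \sum_h class_sum h N = mertens R N.
Proof.
transitivity (\sum_h 1 * class_sum h N); first by apply: eq_bigr => h _; rewrite mul1r.
by rewrite (sum_class (fun=> 1)); apply: eq_bigr => d _; rewrite mulr1.
Qed.

Lemma class_sum_le h N : (1 < N)%N -> `|class_sum h N| <= 9 * ln N%:R.
Proof.
move=> N1; rewrite ger0_norm ?class_sum_ge0 //.
apply: (@le_trans _ _ (mertens R N)).
  by rewrite -sum_class_sum (bigD1 h) //= lerDl sumr_ge0 // => k _; exact: class_sum_ge0.
have /andP[_ M] := mertens_bounds R (ltnW N1); have := ln_ge_half N1; lra.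
Qed.

Lemma class_sum_le_primes (P : pred nat) h N : (forall d, (d%:R == h) = P d) ->
  class_sum h N <= \sum_(1 <= q < N.+1 | prime q && P q) ln (q%:R : R) / q%:R + 2.
Proof.
move=> E; rewrite /class_sum (eq_bigl P) //; exact: von_mangoldt_prime_ge.
Qed.

Lemma natF_eq0 d : (d%:R == 0 :> F) = (p %| d)%N.
Proof. by rewrite (dvdn_pcharf (pchar_Fp pp)). Qed.

Lemma natF_eqN1 d : (d%:R == -1 :> F) = (p %| d.+1)%N.
Proof. by rewrite -addr_eq0 natr1 natF_eq0. Qed.

Lemma primes_neg1_diverge (B : R) :
  exists N, B <= \sum_(1 <= q < N.+1 | prime q && (p %| q.+1)%N) q%:R^-1.
Proof.
apply: contrapT => noN.
pose S N : R := \sum_(1 <= q < N.+1 | prime q && (p %| q.+1)%N) q%:R^-1.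
have SB N : S N <= B.
  by rewrite leNgt; apply/negP => H; apply: noN; exists N; exact: ltW.
have tail e : 0 < e -> exists y, forall N, (y <= N)%N -> S N <= S y + e.
  move=> e0; pose E := range S.
  have E0 : has_sup E by split; [exists (S 0%N); exists 0%N|exists B => _ [N _ <-]].
  have [_ [y _ <-] Hy] := sup_adherent e0 E0; exists y => N _.
  have : S N <= sup E by apply: ub_le_sup; [exists B => _ [M _ <-]|exists N].
  move: Hy; rewrite -/E; lra.
(* Beyond [y] the weight [ln q / q] is at most [ln N / q], and the reciprocals there add up to at
   most [e]; so the class of [-1] has limit weight 0. *)
have Am1 (e : R) : 0 < e -> exists C, forall N, (1 < N)%N -> class_sum (-1) N <= e * ln N%:R + C.
  move=> e0; have [y Hy] := tail e e0.
  exists (\sum_(1 <= q < y.+1 | prime q && (p %| q.+1)%N) ln (q%:R : R) / q%:R + 2) => N N1.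
  apply: (le_trans (class_sum_le_primes _ natF_eqN1)); rewrite [leRHS]addrA lerD2r.
  have lnN : 0 <= ln (N%:R : R) by exact: ln_nat_ge0.
  have T0 (a b : nat) : 0 <= \sum_(a <= q < b | prime q && (p %| q.+1)%N) ln (q%:R : R) / q%:R.
    by rewrite sumr_ge0 // => q _; rewrite divr_ge0 ?ln_nat_ge0.
  have [yN|Ny] := leqP y N; last first.
    rewrite [X in _ <= _ + X](big_cat_nat (n := N.+1)) //=; last by rewrite ltnW.
    by have := mulr_ge0 (ltW e0) lnN; have := T0 N.+1 y.+1; lra.
  rewrite (big_cat_nat (n := y.+1)) //= addrC lerD2r.
  apply: (@le_trans _ _ (\sum_(y.+1 <= q < N.+1 | prime q && (p %| q.+1)%N) ln (N%:R : R) / q%:R)).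
    rewrite big_nat_cond [leRHS]big_nat_cond; apply: ler_sum => q /andP[/andP[yq qN] /andP[pq _]].
    rewrite ler_wpM2r ?invr_ge0 // ler_ln ?posrE ?ltr0n ?ler_nat ?(prime_gt0 pq) ?(ltnW N1) //.
  rewrite -mulr_sumr mulrC; apply: ler_wpM2r => //.
  by have := Hy N yN; rewrite /S [X in X <= _](big_cat_nat (n := y.+1)) //= lerD2l.
have [a Ha] := log_limit_point class_sum_le.
have Heq (u : F -> R) (v C : R) : (forall N, (1 < N)%N ->
    `|\sum_h u h * class_sum h N - v * ln N%:R| <= C) -> \sum_h u h * a h = v.
  move=> H; apply/eqP; rewrite eq_le; apply/andP; split.
    by apply: (Ha _ _ C) => N /H; rewrite ler_norml => /andP[_]; rewrite lerBlDl.
  rewrite -lerN2 -sumrN; under eq_bigr do rewrite -mulNr.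
  apply: (Ha _ _ C) => N /H; rewrite ler_norml => /andP[H1 _].
  under eq_bigr do rewrite mulNr.
  rewrite sumrN mulNr; move: H1; lra.
have delta (k : F) (b : F -> R) (e : R) : \sum_h (h == k)%:R * e * b h = e * b k.
  by rewrite (bigD1 k) //= eqxx mul1r big1 ?addr0 // => h /negPf ->; rewrite !mul0r.
have a_ge0 k : 0 <= a k.
  rewrite -oppr_le0 -mulN1r -(delta k a (-1)); apply: (Ha _ _ 0) => N N1.
  by rewrite delta mulN1r mul0r addr0 oppr_le0 class_sum_ge0.
have a_le k v C : (forall N, (1 < N)%N -> class_sum k N <= v * ln N%:R + C) -> a k <= v.
  move=> H; rewrite -[a k]mul1r -(delta k a 1); apply: (Ha _ _ C) => N N1.
  by rewrite delta mul1r H.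
(* The only prime in the class of 0 is [p], so its sum stays bounded. *)
have a0 : a 0 = 0.
  apply/eqP; rewrite eq_le a_ge0 andbT.
  apply: (a_le _ _ (ln (p%:R : R) / p%:R + 2)) => N N1; rewrite mul0r add0r.
  apply: (le_trans (class_sum_le_primes _ natF_eq0)); rewrite lerD2r.
  have T0 : 0 <= ln (p%:R : R) / p%:R by rewrite divr_ge0 ?ln_nat_ge0.
  have E q : prime q && (p %| q)%N = (q == p).
    by apply/andP/eqP => [[pq]|->]; [rewrite dvdn_prime2 // => /eqP|].
  under eq_bigl do rewrite E.
  have [pN|pN] := boolP (p \in index_iota 1 N.+1).
    rewrite big_mkcond (bigD1_seq p) ?iota_uniq //= eqxx big1 ?addr0 // => q qp.
    by rewrite (negPf qp).
  by rewrite big_seq_cond big1 // => q /andP[qN /eqP qp]; rewrite qp (negPf pN) in qN.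
have aN1 : a (-1) = 0.
  apply/eqP; rewrite eq_le a_ge0 andbT; apply/ler_addgt0Pr => e e0; rewrite add0r.
  by have [C HC] := Am1 e e0; apply: (a_le _ _ C).
have a_sum : \sum_h a h = 1.
  transitivity (\sum_h 1 * a h); first by apply: eq_bigr => h _; rewrite mul1r.
  apply: (Heq _ _ 4) => N N1; under eq_bigr do rewrite mul1r.
  rewrite sum_class_sum mul1r ler_norml.
  by have /andP[? ?] := mertens_bounds R (ltnW N1); apply/andP; split; lra.
apply: (@limit_measure_contradiction R p pp a a0 a_ge0 a_sum aN1) => [f mf|f mf Lf].
  have [C HC] := von_mangoldt_Lval_bounded pp mf.
  by apply: (Heq _ _ C) => N N1; rewrite mul0r subr0 sum_class.
have [C HC] := von_mangoldt_Lval_zero mf Lf.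
by apply: (Heq _ _ C) => N N1; rewrite mulNr opprK sum_class HC // ltnW.
Qed.
End Dirichlet.

(** * Turan's inequality *)

Section Turan.
Variable R : realType.
Local Open Scope ring_scope.

Lemma cntE N (P : nat -> Prop) : (cnt N P)%:R = \sum_(1 <= n < N.+1) (`[< P n >])%:R :> R.
Proof.
rewrite /cnt -sum1_count big_mkcond natr_sum /index_iota subn1 /=.
by apply: eq_bigr => n _; case: asbool.
Qed.

Lemma sum_dvdnE N d : (0 < d)%N -> \sum_(1 <= n < N.+1) ((d %| n)%N)%:R = (N %/ d)%:R :> R.
Proof.
move=> d0; rewrite (eq_bigr (fun n => if (d %| n)%N then 1 else 0)) => [|n _]; last by case: ifP.
by rewrite -big_mkcond (sum_multiples N (fun=> 1)) // big_const_nat subn1 iter_addr_0.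
Qed.

Lemma divn_le_div N d : (0 < d)%N -> (N %/ d)%:R <= N%:R / d%:R :> R.
Proof. by move=> d0; rewrite ler_pdivlMr ?ltr0n // -natrM ler_nat leq_trunc_div. Qed.

Lemma divn_ge_div N d : (0 < d)%N -> N%:R / d%:R - 1 <= (N %/ d)%:R :> R.
Proof.
move=> d0; rewrite lerBlDr natr1 ler_pdivrMr ?ltr0n // -natrM ler_nat ltnW //.
exact: ltn_ceil.
Qed.

Section TuranSeq.
Variables (N : nat) (s : seq nat).
Hypothesis us : uniq s.
Hypothesis ps : all prime s.
Hypothesis sN : all (fun q => q <= N)%N s.
Let S : R := \sum_(q <- s) q%:R^-1.
Let omega n : R := \sum_(q <- s) ((q %| n)%N)%:R.

(** In the constant 3, one [N * S] is the diagonal of the second moment. The other two come from the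
    first moment, where rounding loses at most 1 for each of the at most [N] primes, multiplied by
    [2 * S]. *)
Lemma turan_variance : \sum_(1 <= n < N.+1) (omega n - S) ^+ 2 <= 3 * N%:R * S.
Proof.
have S0 : 0 <= S by rewrite sumr_ge0 // => q _; rewrite invr_ge0.
have N0 : 0 <= N%:R :> R by [].
have sz : (size s)%:R <= N%:R :> R.
  rewrite ler_nat -[leqRHS](size_iota 1); apply: uniq_leq_size => // q qs.
  rewrite mem_iota add1n ltnS (allP sN _ qs) andbT; exact: prime_gt0 (allP ps _ qs).
have A1 : N%:R * S - N%:R <= \sum_(1 <= n < N.+1) omega n.
  rewrite exchange_big /= (le_trans (y := \sum_(q <- s) (N%:R / q%:R - 1))) //.
    rewrite sumrB -mulr_sumr -/S lerD2l lerN2 big_const_seq count_predT iter_addr_0.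
    by [].
  rewrite big_seq [leRHS]big_seq; apply: ler_sum => q qs.
  by rewrite sum_dvdnE ?divn_ge_div ?(prime_gt0 (allP ps _ qs)).
have A2 : \sum_(1 <= n < N.+1) omega n ^+ 2 <= N%:R * S ^+ 2 + N%:R * S.
  have -> : \sum_(1 <= n < N.+1) omega n ^+ 2 = \sum_(q <- s) \sum_(r <- s)
      \sum_(1 <= n < N.+1) ((q %| n)%N && (r %| n)%N)%:R.
    under eq_bigr do rewrite expr2 /omega mulr_suml.
    rewrite exchange_big; apply: eq_bigr => q _ /=.
    under eq_bigr do rewrite mulr_sumr.
    rewrite exchange_big; apply: eq_bigr => r _ /=; apply: eq_bigr => n _.
    by rewrite -natrM mulnb.
  apply: (@le_trans _ _ (\sum_(q <- s) \sum_(r <- s)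
      (N%:R * (q%:R^-1 * r%:R^-1) + (r == q)%:R * (N%:R * q%:R^-1)))).
    rewrite big_seq [leRHS]big_seq; apply: ler_sum => q qs.
    rewrite big_seq [leRHS]big_seq; apply: ler_sum => r rs.
    have pq := allP ps _ qs; have pr := allP ps _ rs.
    have q0 := prime_gt0 pq; have r0 := prime_gt0 pr.
    have T0 : 0 <= N%:R * (q%:R^-1 * r%:R^-1) :> R by rewrite !mulr_ge0 ?invr_ge0.
    have [rq|rq] := eqVneq r q.
      subst r; under eq_bigr do rewrite andbb.
      by rewrite sum_dvdnE // mul1r; have := divn_le_div N q0; have := T0; lra.
    rewrite mul0r addr0; have c : coprime q r by rewrite prime_coprime // dvdn_prime2 // eq_sym.
    under eq_bigr do rewrite -Gauss_dvd //.
    by rewrite sum_dvdnE ?muln_gt0 ?q0 // -invfM -natrM divn_le_div // muln_gt0 q0.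
  under eq_bigr do rewrite big_split /= -mulr_sumr -mulr_sumr.
  rewrite big_split /= -mulr_sumr; under eq_bigr do rewrite -/S.
  rewrite -mulr_suml -/S -expr2 lerD2l mulr_sumr.
  rewrite big_seq [leRHS]big_seq; apply: ler_sum => q qs.
  rewrite (bigD1_seq q) //= eqxx mul1r big1 ?addr0 // => r /negPf ->.
  by rewrite mul0r.
have -> : \sum_(1 <= n < N.+1) (omega n - S) ^+ 2 =
   \sum_(1 <= n < N.+1) omega n ^+ 2 - 2 * S * \sum_(1 <= n < N.+1) omega n + N%:R * S ^+ 2.
  rewrite mulr_sumr -sumrB.
  rewrite (_ : N%:R * S ^+ 2 = \sum_(1 <= n < N.+1) S ^+ 2).
    by rewrite -big_split /=; apply: eq_bigr => n _; ring.
  by rewrite big_const_nat subn1 iter_addr_0 mulr_natl.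
have := ler_wpM2l S0 A1; move: A2; move: (\sum_(1 <= n < N.+1) omega n ^+ 2) => u.
move: (\sum_(1 <= n < N.+1) omega n) => v; rewrite expr2; nra.
Qed.

Lemma turan k : k%:R < S ->
  (cnt N (fun n => count (fun q => q %| n) s <= k)%N)%:R <= 3 * N%:R * S / (S - k%:R) ^+ 2.
Proof.
move=> kS; have D0 : 0 < S - k%:R by rewrite subr_gt0.
rewrite ler_pdivlMr ?exprn_gt0 //; apply: le_trans turan_variance.
rewrite cntE mulr_suml; apply: ler_sum => n _; case: asboolP => [H|_]; last first.
  by rewrite mul0r sqr_ge0.
have W : omega n <= k%:R.
  rewrite /omega -natr_sum ler_nat; apply: leq_trans H.
  by rewrite -sum1_count [leqRHS]big_mkcond.
rewrite mul1r -[leRHS]sqrrN opprB ler_pXn2r // ?nnegrE ?(ltW D0) //.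
  by rewrite lerD2l lerN2.
by rewrite subr_ge0 (le_trans W) // ltW.
Qed.
End TuranSeq.

Lemma prime_recipE a b : prime_recip R a b =
  \sum_(q <- [seq q <- index_iota a.+1 b.+1 | prime q]) q%:R^-1.
Proof. by rewrite big_filter. Qed.

Lemma no_prime_factor N a b : (b <= N)%N -> 0 < prime_recip R a b ->
  (cnt N (fun n => forall q, prime q -> (a < q <= b)%N -> ~~ (q %| n)%N))%:R
   <= 3 * N%:R / prime_recip R a b.
Proof.
move=> bN S0; set s := [seq q <- index_iota a.+1 b.+1 | prime q].
have us : uniq s by rewrite filter_uniq // iota_uniq.
have ps : all prime s by apply/allP => q; rewrite mem_filter => /andP[].
have sN : all (fun q => q <= N)%N s.
  by apply/allP => q; rewrite mem_filter mem_index_iota => /and3P[_ _ qb]; apply: leq_trans bN.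
have := @turan N s us ps sN 0; rewrite -prime_recipE subr0 => /(_ S0) T.
apply: (@le_trans _ _ (3 * N%:R * prime_recip R a b / prime_recip R a b ^+ 2)); last first.
  by rewrite expr2 invfM mulrA mulfK ?gt_eqF.
apply: le_trans T; rewrite ler_nat; apply: cnt_sub => n _ H.
rewrite leqn0 -leqn0 leqNgt -has_count; apply/hasPn => q.
by rewrite mem_filter mem_index_iota => /andP[pq]; exact: H.
Qed.

Lemma sum_inv_sq a b : (0 < a)%N -> \sum_(a.+1 <= d < b.+1) (d%:R : R) ^- 2 <= a%:R^-1.
Proof.
move=> a0; have a0' : 0 < a%:R :> R by rewrite ltr0n.
have [ba|ab] := ltnP b a; first by rewrite big_geq ?invr_ge0 // ltnW.
suff : \sum_(a.+1 <= d < b.+1) (d%:R : R) ^- 2 <= a%:R^-1 - b%:R^-1.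
  by move=> H; apply: (le_trans H); rewrite gerBl invr_ge0.
rewrite -(subnKC ab); elim: (b - a)%N => [|n IH]; first by rewrite addn0 big_geq // subrr.
rewrite addnS big_nat_recr //=; last by rewrite ltnS leq_addr.
have x0 : 0 < (a + n)%:R :> R by rewrite ltr0n addn_gt0 a0.
move: IH; rewrite -[(a + n).+1%:R]natr1; move: (a + n)%:R x0 (\sum_(_ <= _ < _) _) => x x0 s.
suff : (x + 1) ^- 2 <= x^-1 - (x + 1)^-1 by lra.
have -> : x^-1 - (x + 1)^-1 = (x * (x + 1))^-1 by field; rewrite !gt_eqF // addr_gt0.
rewrite lef_pV2 ?posrE ?exprn_gt0 ?mulr_gt0 ?addr_gt0 // expr2 ler_pM2r ?addr_gt0 //.
by rewrite lerDl.
Qed.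

Lemma cnt_square_factor N a : (0 < a)%N ->
  (cnt N (fun n => exists2 d, (a < d)%N & (d ^ 2 %| n)%N))%:R <= N%:R / a%:R :> R.
Proof.
move=> a0; pose Q d n := (d ^ 2 %| n)%N.
have H : (cnt N (fun n => exists2 d, (a < d)%N & (d ^ 2 %| n)%N)
    <= \sum_(d <- index_iota a.+1 N.+1) cnt N (Q d))%N.
  apply: cnt_ex => n /andP[n0 nN] [d ad dn]; exists d => //.
  rewrite mem_index_iota ad ltnS; apply: leq_trans nN; apply: leq_trans (dvdn_leq n0 dn).
  by rewrite -mulnn leq_pmull // (leq_trans _ ad).
apply: (@le_trans _ _ (\sum_(a.+1 <= d < N.+1) (N%:R * (d%:R : R) ^- 2))).
  apply: (le_trans (y := (\sum_(d <- index_iota a.+1 N.+1) cnt N (Q d))%N%:R)); first by rewrite ler_nat.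
  rewrite natr_sum big_seq [leRHS]big_seq; apply: ler_sum => d.
  rewrite mem_index_iota => /andP[ad _]; have d0 : (0 < d ^ 2)%N by rewrite expn_gt0 (leq_trans _ ad).
  apply: (@le_trans _ _ (N %/ d ^ 2)%:R); first by rewrite ler_nat cnt_dvd.
  by apply: (le_trans (divn_le_div N d0)); rewrite natrX.
by rewrite -mulr_sumr ler_wpM2l // sum_inv_sq.
Qed.

Lemma dvd_sigma_prime_factors p s n : (0 < n)%N -> uniq s ->
  (forall q, q \in s -> [/\ prime q, (q %| n)%N, ~~ (q ^ 2 %| n)%N & (p %| q.+1)%N]) ->
  (p ^ size s %| sigma n)%N.
Proof.
elim: s n => [|q s IH] n n0; first by rewrite dvd1n.
case/andP=> qs us H; have [pq qn q2n pq1] := H q (mem_head _ _).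
move/dvdnP: (qn) => [m nE]; rewrite mulnC in nE.
have m0 : (0 < m)%N by move: n0; rewrite nE muln_gt0 => /andP[].
have c : coprime q m.
  by rewrite prime_coprime //; apply: contra q2n => qm; rewrite nE -mulnn dvdn_mul.
rewrite nE sigmaM ?(prime_gt0 pq) // (sigma_prime pq) /= expnS dvdn_mul // IH // => r rs.
have [pr rn r2n pr1] := H r (mem_behead (s := q :: s) rs); split=> //.
  move: rn; rewrite nE Euclid_dvdM // dvdn_prime2 // => /orP[/eqP rq|//].
  by rewrite -rq rs in qs.
by apply: contra r2n => rm; rewrite nE dvdn_mull.
Qed.

Lemma dvd_sigma_almost_all p k (e : R) : prime p -> 0 < e -> exists N0, forall N, (N0 <= N)%N ->
  (cnt N (fun n => ~~ (p ^ k %| sigma n)%N))%:R <= e * N%:R.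
Proof.
move=> pp e0; pose a := (Num.bound (2 / e)).+1.
have aE : 2 / e < a%:R.
  apply: (@lt_trans _ _ (Num.bound (2 / e))%:R); last by rewrite ltr_nat.
  by apply: archi_boundP; rewrite divr_ge0 // ltW.
(* The summand [a] pays for dropping the primes up to [a], which keeps square factors rare. Then
   [S >= 2 * k] gives [S - k >= S / 2], and [S >= 24 / e] makes Turan's bound [12 * N / S] at most
   [e / 2 * N]. *)
have [b Hb] := @primes_neg1_diverge R p pp (a%:R + 2 * k%:R + 24 / e + 1).
pose s := [seq q <- index_iota a.+1 b.+1 | prime q && (p %| q.+1)%N].
pose S : R := \sum_(q <- s) q%:R^-1.
have SE : 2 * k%:R + 24 / e + 1 <= S.
  rewrite /S big_filter.
  have Pa : \sum_(1 <= q < a.+1 | prime q && (p %| q.+1)%N) (q%:R : R)^-1 <= a%:R.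
    apply: (@le_trans _ _ (\sum_(1 <= q < a.+1) 1)).
      rewrite big_mkcond big_nat_cond [leRHS]big_nat_cond; apply: ler_sum => q /andP[/andP[q0 _] _].
      by case: ifP => // _; rewrite invf_le1 ?ltr0n // ler1n.
    by rewrite big_const_nat subn1 iter_addr_0.
  have [ba|ab] := leqP b a.
    have : \sum_(1 <= q < b.+1 | prime q && (p %| q.+1)%N) (q%:R : R)^-1 <=
           \sum_(1 <= q < a.+1 | prime q && (p %| q.+1)%N) (q%:R : R)^-1.
      by rewrite [leRHS](big_cat_nat (n := b.+1)) //= lerDl sumr_ge0 // => q _; rewrite invr_ge0.
    have : 0 <= 24 / e by rewrite divr_ge0 // ltW.
    have : 0 <= k%:R :> R by [].
    lra.
  by move: Hb; rewrite (big_cat_nat (n := a.+1)) //=; [lra|exact: ltnW].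
have E0 : 0 < 24 / e by rewrite divr_gt0.
have K0 : 0 <= k%:R :> R by [].
have kS : k%:R < S by lra.
exists b => N bN.
have us : uniq s by rewrite filter_uniq // iota_uniq.
have ps : all prime s by apply/allP => q; rewrite mem_filter => /andP[/andP[]].
have sN : all (fun q => q <= N)%N s.
  by apply/allP => q; rewrite mem_filter mem_index_iota => /and3P[_ _ qb]; apply: leq_trans bN.
have T := turan us ps sN kS.
have Sq := @cnt_square_factor N a (ltn0Sn _).
apply: (@le_trans _ _ ((cnt N (fun n => count (fun q => q %| n) s <= k)%N)%:R +
   (cnt N (fun n => exists2 d, (a < d)%N & (d ^ 2 %| n)%N))%:R)).
  rewrite -natrD ler_nat; apply: leq_trans (cnt_or _ _ _); apply: cnt_sub => n /andP[n0 _] nd.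
  apply: contrapT => /not_orP[/negP c1 c2]; rewrite -ltnNge in c1.
  move/negP: nd; apply; pose t := [seq q <- s | (q %| n)%N].
  apply: (@dvdn_trans (p ^ size t)); first by rewrite dvdn_exp2l // size_filter ltnW.
  apply: dvd_sigma_prime_factors => //; first by rewrite filter_uniq.
  move=> q; rewrite !mem_filter mem_index_iota => /and3P[qn /andP[pq pq1] /andP[aq _]].
  by split=> //; apply/negP => q2; apply: c2; exists q.
have N0 : 0 <= N%:R :> R by [].
have H1 : N%:R / a%:R <= e / 2 * N%:R.
  rewrite mulrC ler_wpM2r //; rewrite -[leRHS]invrK lef_pV2 ?posrE ?ltr0n ?invr_gt0 ?divr_gt0 //.
  by rewrite invf_div ltW.
have H2 : 3 * N%:R * S / (S - k%:R) ^+ 2 <= e / 2 * N%:R.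
  have S0 : 0 < S by lra.
  rewrite ler_pdivrMr ?exprn_gt0 ?subr_gt0 //.
  have -> : 3 * N%:R * S = N%:R * (3 * S) by ring.
  rewrite (mulrC (e / 2)) -mulrA ler_wpM2l //.
  have S2 : S / 2 <= S - k%:R by lra.
  apply: (@le_trans _ _ (e / 2 * (S / 2) ^+ 2)); last first.
    by rewrite ler_pM2l ?divr_gt0 // ler_pXn2r ?nnegrE //; lra.
  have eS : 24 <= e * S by rewrite -ler_pdivrMl // mulrC; lra.
  rewrite expr2; have := ler_wpM2r (ltW S0) eS; lra.
have -> : e * N%:R = e / 2 * N%:R + e / 2 * N%:R by field.
exact: lerD (le_trans T H2) (le_trans Sq H1).
Qed.
End Turan.

(** * Fourth powers dividing the aliquot sum *)

Section SmallRange.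
Variable R : realType.
Local Open Scope ring_scope.

Lemma size_divisors_pow p a : prime p -> size (divisors (p ^ a)) = a.+1.
Proof. by move=> pp; rewrite (perm_size (perm_divisors_pfactor a pp)) size_map size_iota. Qed.

Definition has_prime_in (lo hi n : nat) : Prop :=
  exists m q, [/\ n = (m * q)%N, prime q, coprime m q & (lo < q <= hi)%N].

(** Dyadic blocks for [q]. The factor 5 is the number of divisors of [p ^ 4], and the error
    [10 * N / 2 ^ i] of each block sums to [20 * N / 2 ^ a]. *)
Lemma cnt_has_prime_in N p a b : prime p ->
  (cnt N (fun n => (p ^ 4 %| aliquot_sum n)%N /\ has_prime_in (2 ^ a) (2 ^ b) n))%:R
  <= 5 * N%:R * b%:R / p%:R ^+ 4 + 20 * N%:R / 2 ^+ a :> R.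
Proof.
move=> pp; pose Q i n := (p ^ 4 %| aliquot_sum n)%N /\
    exists m q, [/\ n = (m * q)%N, prime q, coprime m q & (2 ^ i < q <= (2 ^ i).*2)%N].
have p0 := prime_gt0 pp; have p40 : (0 < p ^ 4)%N by rewrite expn_gt0 p0.
have H : (cnt N (fun n => (p ^ 4 %| aliquot_sum n)%N /\ has_prime_in (2 ^ a) (2 ^ b) n)
    <= \sum_(i <- index_iota a b) cnt N (Q i))%N.
  apply: cnt_ex => n _ [pn [m [q [nE pq c /andP[q1 q2]]]]].
  have q0 : (0 < q.-1)%N.
    by have := prime_gt1 pq; lia.
  (* The blocks are open on the left and closed on the right, hence the logarithm of [q - 1]. *)
  pose i := trunc_log 2 q.-1.
  have i1 : (2 ^ i <= q.-1)%N by exact: trunc_logP.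
  have i2 : (q.-1 < 2 ^ i.+1)%N by exact: trunc_log_ltn.
  rewrite expnS mul2n in i2.
  exists i; last by split=> //; exists m, q; split=> //; apply/andP; split; lia.
  rewrite mem_index_iota; apply/andP; split.
    have : (2 ^ a < 2 ^ i.+1)%N by rewrite expnS mul2n; lia.
    by rewrite ltn_exp2l.
  have : (2 ^ i < 2 ^ b)%N by lia.
  by rewrite ltn_exp2l.
have N0 : 0 <= N%:R :> R by [].
have p40' : 0 < p%:R ^+ 4 :> R by rewrite exprn_gt0 // ltr0n.
have Qi i : (cnt N (Q i))%:R <= 5 * N%:R / p%:R ^+ 4 + 10 * N%:R / 2 ^+ i :> R.
  have := @cnt_prime_factor N (p ^ 4) (2 ^ i) p40 (expn_gt0 2 i); rewrite size_divisors_pow // => C.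
  apply: (@le_trans _ _ (5 * (N %/ p ^ 4 + (N %/ 2 ^ i).*2))%N%:R); first by rewrite ler_nat.
  have D1 := divn_le_div R N p40; have D2 := @divn_le_div R N (2 ^ i) (expn_gt0 2 i).
  rewrite !natrX in D1 D2; rewrite natrM natrD -muln2 natrM.
  have -> : 5 * N%:R / p%:R ^+ 4 = 5 * (N%:R / p%:R ^+ 4) :> R by ring.
  have -> : 10 * N%:R / 2 ^+ i = 10 * (N%:R / 2 ^+ i) :> R by ring.
  move: D1 D2; move: (N%:R / p%:R ^+ 4) (N%:R / 2 ^+ i) => x y.
  move: (N %/ p ^ 4)%:R (N %/ 2 ^ i)%:R => u v; lra.
have T0 : 0 <= 20 * N%:R / 2 ^+ a :> R by rewrite divr_ge0 ?mulr_ge0 // exprn_ge0.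
have T1 : 0 <= 5 * N%:R * b%:R / p%:R ^+ 4 :> R by rewrite divr_ge0 ?mulr_ge0 // ltW.
apply: (le_trans (y := (\sum_(i <- index_iota a b) cnt N (Q i))%N%:R)); first by rewrite ler_nat.
have [ab|ba] := leqP a b; last by rewrite big_geq ?addr_ge0 // ltnW.
suff : (\sum_(i <- index_iota a b) cnt N (Q i))%N%:R <=
   5 * N%:R * b%:R / p%:R ^+ 4 + 20 * N%:R / 2 ^+ a - 20 * N%:R / 2 ^+ b :> R.
  move=> S; apply: (le_trans S); rewrite gerBl.
  by rewrite divr_ge0 ?mulr_ge0 // exprn_ge0.
rewrite -(subnKC ab); elim: (b - a)%N => [|n IH].
  rewrite addn0 big_geq // addrK.
  by rewrite divr_ge0 ?mulr_ge0 // ltW.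
rewrite addnS big_nat_recr ?leq_addr //= natrD.
have := Qi (a + n)%N; move: IH; rewrite -[(a + n).+1%:R]natr1 (exprS 2 (a + n)).
have t0 : 0 < 2 ^+ (a + n) :> R by rewrite exprn_gt0.
have -> : 20 * N%:R / (2 * 2 ^+ (a + n)) = 10 * N%:R / 2 ^+ (a + n) :> R by field; rewrite gt_eqF.
have -> : 20 * N%:R / 2 ^+ (a + n) = 2 * (10 * N%:R / 2 ^+ (a + n)) :> R by field; rewrite gt_eqF.
have -> : 5 * N%:R * ((a + n)%:R + 1) / p%:R ^+ 4 =
  5 * N%:R * (a + n)%:R / p%:R ^+ 4 + 5 * N%:R / p%:R ^+ 4 :> R by field; rewrite gt_eqF // ltr0n.
move: (10 * _ / _) (20 * _ / _) (5 * _ * _ / _) (5 * _ / _) => u v w x; lra.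
Qed.

(** Normalised so that [T = scale r] satisfies [T ^ 2 = 4 ^ r * (2 * T)], the form that
    [prime_recip_ge] takes, while [scale (2 * r) = T ^ 2 / 2] is the end of the batch. *)
Definition scale r := (2 * 4 ^ r)%N.

Lemma scale_gt0 r : (0 < scale r)%N.
Proof. by rewrite muln_gt0 expn_gt0. Qed.

Lemma scale_ge r : (2 * r <= scale r)%N.
Proof. by rewrite /scale leq_mul2l /= ltnW // ltn_expl. Qed.

Lemma cnt_batch N r : (3 < r)%N -> (2 ^ (scale r ^ 2) <= N)%N ->
  (cnt N (fun n => exists p, [/\ prime p, (scale r < p <= scale (2 * r))%N &
     (p ^ 4 %| aliquot_sum n)%N]))%:R <= 20 * N%:R / r%:R :> R.
Proof.
move=> r1 TN; set T := scale r; set a := (2 * T)%N; set b := (T ^ 2)%N.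
have bE : b = (4 ^ r * a)%N by rewrite /b /a /T /scale; lia.
have a14 : (14 <= a)%N by rewrite /a /T; have := scale_ge r; lia.
have T0 : 0 < T%:R :> R by rewrite ltr0n scale_gt0.
have r0 : 0 < r%:R :> R by rewrite ltr0n; lia.
have N0 : 0 <= N%:R :> R by [].
have Tr : T%:R^-1 <= (2 * r%:R)^-1 :> R.
  by rewrite lef_pV2 ?posrE ?mulr_gt0 // -natrM ler_nat scale_ge.
pose Q p n := (p ^ 4 %| aliquot_sum n)%N /\ has_prime_in (2 ^ a) (2 ^ b) n.
pose ps := [seq p <- index_iota T.+1 (scale (2 * r)).+1 | prime p].
pose X1 n := forall q, prime q -> (2 ^ a < q <= 2 ^ b)%N -> ~~ (q %| n)%N.
pose X2 n := exists2 d, (2 ^ a < d)%N & (d ^ 2 %| n)%N.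
pose X3 n := exists2 p, p \in ps & Q p n.
have C : (cnt N (fun n => exists p, [/\ prime p, (T < p <= scale (2 * r))%N &
     (p ^ 4 %| aliquot_sum n)%N]) <= cnt N X1 + (cnt N X2 + \sum_(p <- ps) cnt N (Q p)))%N.
  apply: (@leq_trans (cnt N (fun n => X1 n \/ (X2 n \/ X3 n)))); last first.
    apply: (leq_trans (cnt_or _ _ _)); rewrite leq_add2l.
    apply: (leq_trans (cnt_or _ _ _)); rewrite leq_add2l.
    by apply: cnt_ex.
  apply: cnt_sub => n /andP[n0 _] [p [pp pT pn]].
  have [|nX1] := pselect (X1 n); [by left|right].
  have [|nX2] := pselect (X2 n); [by left|right].
  exists p; first by rewrite mem_filter pp mem_index_iota.
  split=> //; apply: contrapT => nH; apply: nX1 => q pq qab; apply/negP => qn; apply: nH.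
  exists (n %/ q)%N, q; split=> //; first by rewrite divnK.
  rewrite coprime_sym prime_coprime //; apply/negP => qq; apply: nX2; exists q.
    by case/andP: qab.
  by rewrite -(divnK qn) -mulnn dvdn_mul.
have PR : r%:R / 2 <= prime_recip R (2 ^ a) (2 ^ b) by rewrite bE; exact: prime_recip_ge.
have C1 : (cnt N X1)%:R <= 6 * N%:R / r%:R :> R.
  have P0 : 0 < prime_recip R (2 ^ a) (2 ^ b) by apply: lt_le_trans PR; rewrite divr_gt0.
  apply: (le_trans (no_prime_factor TN P0)).
  have -> : 6 * N%:R / r%:R = 3 * N%:R / (r%:R / 2) :> R by field; rewrite gt_eqF.
  rewrite ler_wpM2l ?mulr_ge0 // lef_pV2 ?posrE ?divr_gt0 //.
have C2 : (cnt N X2)%:R <= N%:R / T%:R :> R.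
  apply: (le_trans (@cnt_square_factor R N (2 ^ a) (expn_gt0 2 a))).
  rewrite ler_wpM2l // lef_pV2 ?posrE ?ltr0n ?scale_gt0 ?expn_gt0 // ler_nat /a.
  by rewrite ltnW // (leq_ltn_trans _ (ltn_expl _ _)) // leq_pmull.
have C3 : (\sum_(p <- ps) cnt N (Q p))%N%:R <= 25 * N%:R / T%:R :> R.
  rewrite natr_sum /ps big_filter.
  apply: (@le_trans _ _ (\sum_(T.+1 <= p < (scale (2 * r)).+1)
      (5 * N%:R * (p%:R ^- 2) + 20 * N%:R / 2 ^+ a))).
    rewrite big_mkcond big_nat_cond [leRHS]big_nat_cond; apply: ler_sum => p /andP[/andP[Tp _] _].
    have p0 : 0 < p%:R :> R by rewrite ltr0n (leq_trans _ Tp).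
    case: ifP => [pp|_]; last first.
      by rewrite addr_ge0 // ?mulr_ge0 ?invr_ge0 ?exprn_ge0 // ltW.
    apply: (le_trans (cnt_has_prime_in N a b pp)); rewrite lerD2r.
    rewrite -!mulrA !ler_wpM2l // /b natrX.
    (* As [b = T ^ 2 < p ^ 2], the main term drops to [5 * N / p ^ 2], which is summable over
       [p > T]. *)
    have -> : p%:R ^- 2 = p%:R ^+ 2 / p%:R ^+ 4 :> R by field; rewrite gt_eqF.
    rewrite ler_pM2r ?invr_gt0 ?exprn_gt0 // ler_pXn2r ?nnegrE ?ltW //.
    by rewrite ltr_nat.
  rewrite big_split /= -mulr_sumr.
  have -> : 25 * N%:R / T%:R = 5 * N%:R * T%:R^-1 + 20 * N%:R / T%:R :> R by ring.
  apply: lerD; first by rewrite ler_wpM2l ?mulr_ge0 // sum_inv_sq // scale_gt0.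
  rewrite big_const_nat subSS iter_addr_0.
  (* The lower end [2 ^ a] of the window is large enough to absorb the number of [p] in the batch:
     [T * scale (2 * r) <= 2 ^ a]. *)
  apply: (@le_trans _ _ (20 * N%:R / 2 ^+ a * (scale (2 * r))%:R)).
    rewrite -[leLHS]mulr_natr ler_wpM2l ?divr_ge0 ?mulr_ge0 ?exprn_ge0 // ler_nat leq_subr //.
  rewrite -!mulrA !ler_wpM2l // mulrC ler_pdivrMr ?exprn_gt0 // ler_pdivlMl //.
  rewrite -natrX -natrM ler_nat /a /T /scale.
  have E4 m : (4 ^ m = 2 ^ (2 * m))%N by rewrite expnM.
  have H : (1 + 3 * r <= 4 ^ r)%N by elim: (r) => [//|m IH]; rewrite expnS; lia.
  rewrite E4 in H; rewrite !E4 -!expnS -expnD leq_exp2l // ?expnS.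
  by move: (2 ^ (2 * r))%N H => x; lia.
apply: (le_trans (y := (cnt N X1 + (cnt N X2 + \sum_(p <- ps) cnt N (Q p)))%N%:R)).
  by rewrite ler_nat.
rewrite !natrD.
apply: (le_trans (lerD C1 (lerD C2 C3))).
have : N%:R / T%:R <= N%:R / r%:R / 2 :> R.
  by rewrite -mulrA ler_wpM2l // -invfM mulrC.
have -> : 6 * N%:R / r%:R = 6 * (N%:R / r%:R) :> R by ring.
have -> : 20 * N%:R / r%:R = 20 * (N%:R / r%:R) :> R by ring.
have -> : 25 * N%:R / T%:R = 25 * (N%:R / T%:R) :> R by ring.
move: (N%:R / T%:R) (divr_ge0 N0 (ltW r0)); move: (N%:R / r%:R) => x y; lra.
Qed.

(** Batch [j] costs [20 * N / (2 ^ j * r)]. The hypothesis keeps every window below [N], as Turan's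
    inequality demands. *)
Lemma cnt_small_range N r J : (3 < r)%N ->
  (forall j, (j < J)%N -> (2 ^ (scale (2 ^ j * r) ^ 2) <= N)%N) ->
  (cnt N (fun n => exists p, [/\ prime p, (scale r < p <= scale (2 ^ J * r))%N &
     (p ^ 4 %| aliquot_sum n)%N]))%:R <= 40 * N%:R / r%:R :> R.
Proof.
move=> r1 HJ; have r0 : 0 < r%:R :> R by rewrite ltr0n; lia.
suff : (cnt N (fun n => exists p, [/\ prime p, (scale r < p <= scale (2 ^ J * r))%N &
     (p ^ 4 %| aliquot_sum n)%N]))%:R <= 40 * N%:R / r%:R - 40 * N%:R / r%:R / 2 ^+ J :> R.
  move=> H; apply: (le_trans H); rewrite gerBl.
  by rewrite !divr_ge0 ?mulr_ge0 ?exprn_ge0 // ltW.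
elim: J HJ => [|J IH] HJ.
  rewrite expr0 divr1 subrr lern0 -leqn0 leqNgt -has_count; apply/hasPn => n _.
  by apply/asboolP => -[p [_ /andP[]]]; rewrite mul1n; lia.
have {}IH := IH (fun j jJ => HJ j (ltnW jJ)).
have rJ : (3 < 2 ^ J * r)%N by rewrite (leq_trans r1) // leq_pmull // expn_gt0.
have B := cnt_batch rJ (HJ J (ltnSn J)).
apply: (@le_trans _ _ ((cnt N (fun n => exists p, [/\ prime p, (scale r < p <= scale (2 ^ J * r))%N &
     (p ^ 4 %| aliquot_sum n)%N])) + (cnt N (fun n => exists p, [/\ prime p,
     (scale (2 ^ J * r) < p <= scale (2 * (2 ^ J * r)))%N & (p ^ 4 %| aliquot_sum n)%N])))%N%:R).
  rewrite ler_nat; apply: leq_trans (cnt_or _ _ _); apply: cnt_sub => n _ [p [pp /andP[p1 p2] pn]].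
  rewrite expnS -mulnA in p2.
  have [pJ|Jp] := leqP p (scale (2 ^ J * r)); [left|right]; exists p; split=> //.
    by rewrite p1.
  by rewrite p2 Jp.
rewrite natrD; apply: (le_trans (lerD IH B)); rewrite natrM natrX exprS.
have t0 : 0 < 2 ^+ J :> R by rewrite exprn_gt0.
rewrite le_eqVlt; apply/orP; left; apply/eqP; field.
by rewrite !gt_eqF.
Qed.
End SmallRange.

(** * Integers without large square divisors *)

Section Structure.

(** The square of [q ^ (a / 2)] divides [n], so [q ^ (a / 2) <= m]; and [a <= 3 * (a / 2)], rounded
    down, once [a >= 2]. *)
Lemma pfactor_le m n q : 0 < q -> (forall d, m < d -> ~~ (d ^ 2 %| n)) ->
  1 < logn q n -> q ^ logn q n <= m ^ 3.
Proof.
move=> q0 H; move: (logn q n) (pfactor_dvdnn q n) => a qa a1.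
have aE := odd_double_half a; have o1 := leq_b1 (odd a).
have dm : q ^ a./2 <= m.
  rewrite leqNgt; apply/negP => /H; rewrite -expnM muln2 => /negP; apply.
  apply: dvdn_trans qa; rewrite dvdn_exp2l //.
  by move: aE o1 {H}; lia.
apply: (@leq_trans ((q ^ a./2) ^ 3)); last by rewrite leq_exp2r.
by rewrite -expnM leq_pexp2l //; move: aE o1 a1 {H}; lia.
Qed.

Lemma smooth_part_le m n : 0 < n -> (forall d, m < d -> ~~ (d ^ 2 %| n)) ->
  n`_[pred q | q <= m] <= m ^ (3 * m.+1).
Proof.
move=> n0 H; have m0 : 0 < m.
  by rewrite lt0n; apply/negP => /eqP m0; have := H 1; rewrite m0 dvd1n => /(_ isT).
have T q : q <= m -> q ^ logn q n <= m ^ 3.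
  move=> qm; have [a1|a1] := leqP (logn q n) 1; last first.
    by apply: pfactor_le => //; case: (q) a1; rewrite ?logn0.
  apply: (@leq_trans m); last by rewrite -{1}(expn1 m) leq_pexp2l.
  move: (logn q n) a1 => [|[|//]] _; first by rewrite expn0.
  by rewrite expn1.
rewrite expnM; apply: (@leq_trans (\prod_(0 <= q < m.+1) m ^ 3)); last first.
  by rewrite prod_nat_const_nat subn0.
rewrite /partn big_mkcond.
have [mn|nm] := leqP m n.
  rewrite (big_cat_nat (n := m.+1)) //= [X in _ * X]big_nat_cond [X in _ * X]big1 ?muln1; last first.
    by move=> q /andP[/andP[mq _] _]; rewrite inE leqNgt mq.
  rewrite big_nat_cond [leqRHS]big_nat_cond; apply: leq_prod => q /andP[/andP[_ qm] _].
  by rewrite ltnS in qm; rewrite inE qm T.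
rewrite [leqRHS](big_cat_nat (n := n.+1)) //=; last exact: ltnW.
rewrite -[leqLHS]muln1 leq_mul //.
  rewrite big_nat_cond [leqRHS]big_nat_cond; apply: leq_prod => q /andP[/andP[_ qn] _].
  by rewrite inE; case: ifP => [/T//|_]; rewrite expn_gt0 m0.
by rewrite prod_nat_const_nat !expn_gt0 m0.
Qed.

(** Take the least divisor above [y]: removing one of its primes, at most [p / w], brings it down to
    [y] or less. *)
Lemma minimal_divisor B y w p : 0 < B -> 0 < y -> y < B ->
  (forall q, prime q -> q %| B -> q * w <= p) ->
  exists e, [/\ e %| B, y < e & e * w <= y * p].
Proof.
move=> B0 y0 yB Hq.
have ex : exists e, (e %| B) && (y < e) by exists B; rewrite dvdnn.
case: (ex_minnP ex) => e /andP[eB ye] emin; exists e; split=> //.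
have e1 : 1 < e by apply: leq_ltn_trans ye.
have qp := pdiv_prime e1; have qe := pdiv_dvd e.
have : ~~ (y < e %/ pdiv e).
  apply/negP => H; have := emin (e %/ pdiv e).
  rewrite H (dvdn_trans (dvdn_div qe) eB) => /(_ isT); rewrite leqNgt ltn_Pdiv ?prime_gt1 //.
  exact: leq_trans ye.
rewrite -leqNgt => H; have := Hq _ qp (dvdn_trans qe eB).
by rewrite -{2}(divnK qe) -mulnA => Hw; apply: leq_mul.
Qed.

Lemma prime_dvd_sigma_pfactor p n : prime p -> 0 < n -> p %| sigma n ->
  exists q, [/\ prime q, q %| n & p %| sigma (q ^ logn q n)].
Proof.
move=> pp; have [k] := ubnP n; elim: k n => // k IH n; rewrite ltnS => nk n0 pn.
have [n1|n1] := leqP n 1.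
  have nE : n = 1 by lia.
  have S1 : sigma 1 = 1 by rewrite /sigma big_seq1.
  by move: pn; rewrite nE S1 dvdn1 => /eqP E; rewrite E in pp.
have qp := pdiv_prime n1; have [m c nE] := pfactor_coprime qp n0.
have a0 : 0 < logn (pdiv n) n by rewrite logn_gt0 mem_primes qp n0 pdiv_dvd.
have qn := pdiv_dvd n.
have [r rE] : exists r, r = pdiv n by exists (pdiv n).
rewrite -rE in qp c nE a0 qn.
have [a aE] : exists a, a = logn r n by exists (logn r n).
rewrite -aE in nE a0.
have m0 : 0 < m by move: n0; rewrite nE muln_gt0 => /andP[].
have ra0 : 0 < r ^ a by rewrite expn_gt0 prime_gt0.
have c' : coprime m (r ^ a) by rewrite coprime_sym coprimeXl.
move: pn; rewrite {1}nE sigmaM // Euclid_dvdM // => /orP[pm|pq]; last by exists r; rewrite -aE.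
have mn : m < k.
  apply: leq_trans nk; rewrite nE ltn_Pmulr // -(expn0 r).
  by rewrite ltn_exp2l // prime_gt1.
have [q [pq qm psq]] := IH m mn m0 pm.
exists q; split=> //; first by rewrite nE dvdn_mulr.
rewrite nE lognM // lognX (logn_prime _ qp); have [E|_] := eqVneq q r; last by rewrite /= muln0 addn0.
by move: c; rewrite prime_coprime // -E qm.
Qed.

Lemma sigma_ppow_le q a : prime q -> sigma (q ^ a) <= 2 * q ^ a.
Proof.
move=> qp; rewrite /sigma (perm_big _ (perm_divisors_pfactor a qp)) big_map.
have q2 := prime_gt1 qp.
suff : (\sum_(0 <= i < a.+1) q ^ i).+1 <= 2 * q ^ a by move/ltnW.
elim: a => [|a IH]; first by rewrite big_nat1.
rewrite big_nat_recr //= expnS.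
have : 2 * q ^ a <= q * q ^ a by rewrite leq_mul2r q2 orbT.
by move: IH; move: (\sum_(0 <= i < a.+1) _) (q ^ a) => x y; lia.
Qed.

(** The prime [p] divides some [sigma (q ^ a)] with [q ^ a] exactly dividing [n]. If [a >= 2], this
    number is at most [2 * m ^ 3 < p]; so [a = 1] and [p] divides [q + 1], a rare event by
    [cnt_common_prime]. *)
Lemma common_prime_sigma m p n : 0 < n -> prime p -> (forall d, m < d -> ~~ (d ^ 2 %| n)) ->
  2 * m ^ 3 < p -> p %| n -> p %| sigma n ->
  exists q, [/\ prime q, p %| q.+1 & p * q %| n].
Proof.
move=> n0 pp H mp pn ps; have [q [pq qn psq]] := prime_dvd_sigma_pfactor pp n0 ps.
exists q; have a0 : 0 < logn q n by rewrite logn_gt0 mem_primes pq n0.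
have [a1|a1] := leqP (logn q n) 1.
  have aE : logn q n = 1 by lia.
  rewrite aE expn1 (sigma_prime pq) in psq; split=> //.
  rewrite Gauss_dvd ?pn // prime_coprime // dvdn_prime2 //; apply/eqP => pqE.
  move: psq; rewrite pqE -addn1 dvdn_addr // dvdn1 => /eqP q1.
  by rewrite q1 in pq.
have q0 := prime_gt0 pq; have qa := pfactor_le q0 H a1.
have s0 : 0 < sigma (q ^ logn q n) by rewrite (leq_trans _ (leq_sigma _)) ?expn_gt0 ?q0.
have : p <= 2 * m ^ 3.
  apply: (leq_trans (dvdn_leq s0 psq)); apply: (leq_trans (sigma_ppow_le _ pq)).
  by rewrite leq_mul2l qa.
by rewrite leqNgt mp.
Qed.
End Structure.

(** * Exceptional sets for large [p] *)

Section TopCounts.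
Variable R : realType.
Local Open Scope ring_scope.

Lemma sum_inv_pow2 j : \sum_(1 <= d < 2 ^ j) (d%:R : R)^-1 <= j%:R.
Proof.
elim: j => [|j IH]; first by rewrite expn0 big_geq.
rewrite (big_cat_nat (n := 2 ^ j)) ?expn_gt0 ?leq_exp2l //= -natr1; apply: lerD => //.
apply: (@le_trans _ _ (\sum_(2 ^ j <= d < 2 ^ j.+1) ((2 ^ j)%:R : R)^-1)).
  rewrite big_nat_cond [leRHS]big_nat_cond; apply: ler_sum => d /andP[/andP[jd _] _].
  by rewrite lef_pV2 ?posrE ?ltr0n ?expn_gt0 ?ler_nat // (leq_trans _ jd) // expn_gt0.
rewrite big_const_nat iter_addr_0 expnS mul2n -addnn addnK -[leLHS]mulr_natl divff //.
by rewrite pnatr_eq0 -lt0n expn_gt0.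
Qed.

Lemma sum_inv_le a N l : (0 < a)%N -> (N < 2 ^ l)%N ->
  \sum_(a <= d < N.+1) (d%:R : R)^-1 <= l%:R.
Proof.
move=> a0 Nl; have [Na|aN] := ltnP N a; first by rewrite big_geq.
apply: le_trans (sum_inv_pow2 l).
rewrite [leRHS](big_cat_nat (n := N.+1)) //= [X in _ <= X + _](big_cat_nat (n := a)) //=; last exact: leqW.
by rewrite -addrA addrCA lerDl; apply: addr_ge0; apply: sumr_ge0 => d _; rewrite invr_ge0.
Qed.

(** Writing [q = j * p - 1 >= j * p / 2] bounds the count by the sum of [2 * N / (j * p ^ 2)]; the
    sum over [j] gives [l]. *)
Lemma cnt_common_prime N l P : (0 < P)%N -> (N < 2 ^ l)%N ->
  (cnt N (fun n => exists p q, [/\ (P < p)%N, prime p, prime q, (p %| q.+1)%N & (p * q %| n)%N]))%:R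
  <= 2 * N%:R * l%:R / P%:R :> R.
Proof.
move=> P0 Nl; pose Q j p n := (p * (j * p).-1 %| n)%N.
have H : (cnt N (fun n => exists p q, [/\ (P < p)%N, prime p, prime q, (p %| q.+1)%N & (p * q %| n)%N])
    <= \sum_(p <- index_iota P.+1 N.+1 | prime p) \sum_(j <- index_iota 1 N.+1) cnt N (Q j p))%N.
  rewrite -big_filter.
  apply: (leq_trans (cnt_ex (Q := fun p n => exists2 j, j \in index_iota 1 N.+1 & Q j p n)
     (s := [seq p <- index_iota P.+1 N.+1 | prime p]) _)).
    move=> n /andP[n0 nN] [p [q [Pp pp pq pq1 pqn]]]; exists p.
      rewrite mem_filter pp mem_index_iota Pp ltnS (leq_trans _ nN) // (leq_trans _ (dvdn_leq n0 pqn)) //.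
      by rewrite leq_pmulr // prime_gt0.
    have [j jE] := dvdnP pq1; exists j; last by rewrite /Q -jE.
    have j0 : (0 < j)%N by case: j jE => //; rewrite mul0n.
    rewrite mem_index_iota j0 ltnS (leq_trans _ nN) // (leq_trans _ (dvdn_leq n0 pqn)) //.
    have := prime_gt1 pp; have := prime_gt1 pq; nia.
  by apply: leq_sum => p _; apply: cnt_ex.
apply: (le_trans (y := (\sum_(p <- index_iota P.+1 N.+1 | prime p)
    \sum_(j <- index_iota 1 N.+1) cnt N (Q j p))%N%:R)); first by rewrite ler_nat.
rewrite natr_sum.
apply: (@le_trans _ _ (\sum_(P.+1 <= p < N.+1) 2 * N%:R * l%:R * p%:R ^- 2)); last first.
  by rewrite -mulr_sumr ler_wpM2l ?mulr_ge0 // sum_inv_sq.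
rewrite big_mkcond big_nat_cond [leRHS]big_nat_cond; apply: ler_sum => p /andP[/andP[Pp _] _].
case: ifP => pp; last by rewrite !mulr_ge0 ?invr_ge0 ?exprn_ge0.
have p0 : 0 < p%:R :> R by rewrite ltr0n prime_gt0.
rewrite natr_sum.
apply: (@le_trans _ _ (\sum_(1 <= j < N.+1) 2 * N%:R * p%:R ^- 2 * j%:R^-1)); last first.
  rewrite -mulr_sumr -[leRHS]mulrA [l%:R * _]mulrC mulrA ler_wpM2l //.
    by rewrite !mulr_ge0 ?invr_ge0 ?exprn_ge0.
  exact: sum_inv_le.
rewrite big_nat_cond [leRHS]big_nat_cond; apply: ler_sum => j /andP[/andP[j0 _] _].
have p1 := prime_gt1 pp.
have d0 : (0 < p * (j * p).-1)%N by rewrite muln_gt0 prime_gt0 //=; nia.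
apply: (@le_trans _ _ (N %/ (p * (j * p).-1))%:R); first by rewrite ler_nat cnt_dvd.
apply: (le_trans (divn_le_div R N d0)).
have j0' : 0 < j%:R :> R by rewrite ltr0n.
have -> : 2 * N%:R * p%:R ^- 2 * j%:R^-1 = N%:R / (j%:R * p%:R ^+ 2 / 2) :> R.
  by field; rewrite !gt_eqF.
rewrite ler_wpM2l // lef_pV2 ?posrE ?ltr0n ?divr_gt0 ?mulr_gt0 ?exprn_gt0 //.
rewrite ler_pdivrMr // -natrX -!natrM ler_nat; nia.
Qed.

(** The window for [q] ends at [2 ^ l], and [l <= P ^ 2 < p ^ 2] makes the main term summable. The
    other term is at most [40 * N / (p * l ^ 2)], and the harmonic sum over [p] costs one factor
    [l]. *)
Lemma cnt_large_prime_factor N l P : (0 < P)%N -> (0 < l)%N -> (N < 2 ^ l)%N -> (l <= P ^ 2)%N ->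
  (cnt N (fun n => exists p, [/\ (P < p <= N)%N, prime p, (p ^ 4 %| aliquot_sum n)%N &
     has_prime_in (p * l ^ 2) N n]))%:R <= 5 * N%:R / P%:R + 40 * N%:R / l%:R :> R.
Proof.
move=> P0 l0 Nl lP; pose a p := trunc_log 2 (p * l ^ 2)%N.
pose Q p n := (p ^ 4 %| aliquot_sum n)%N /\ has_prime_in (2 ^ a p) (2 ^ l) n.
have H : (cnt N (fun n => exists p, [/\ (P < p <= N)%N, prime p, (p ^ 4 %| aliquot_sum n)%N &
     has_prime_in (p * l ^ 2) N n]) <= \sum_(p <- index_iota P.+1 N.+1 | prime p) cnt N (Q p))%N.
  rewrite -big_filter; apply: cnt_ex => n _ [p [/andP[Pp pN] pp pn [m [q [nE pq c /andP[q1 q2]]]]]].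
  exists p; first by rewrite mem_filter pp mem_index_iota Pp.
  split=> //; exists m, q; split=> //; rewrite (leq_trans q2 (ltnW Nl)) andbT.
  apply: leq_ltn_trans q1; apply: trunc_logP => //.
  by rewrite muln_gt0 (prime_gt0 pp) expn_gt0 l0.
apply: (le_trans (y := (\sum_(p <- index_iota P.+1 N.+1 | prime p) cnt N (Q p))%N%:R)).
  by rewrite ler_nat.
have l0' : 0 < l%:R :> R by rewrite ltr0n.
have N0 : 0 <= N%:R :> R by [].
rewrite natr_sum.
apply: (@le_trans _ _ (\sum_(P.+1 <= p < N.+1) (5 * N%:R * p%:R ^- 2 + 40 * N%:R / l%:R ^+ 2 * p%:R^-1))).
  rewrite big_mkcond big_nat_cond [leRHS]big_nat_cond; apply: ler_sum => p /andP[/andP[Pp _] _].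
  case: ifP => pp; last by rewrite addr_ge0 // !mulr_ge0 ?invr_ge0 ?exprn_ge0.
  have p0 : 0 < p%:R :> R by rewrite ltr0n prime_gt0.
  apply: (le_trans (cnt_has_prime_in R N (a p) l pp)); apply: lerD.
    rewrite -!mulrA !ler_wpM2l //.
    have -> : p%:R ^- 2 = p%:R ^+ 2 / p%:R ^+ 4 :> R by field; rewrite gt_eqF.
    rewrite ler_pM2r ?invr_gt0 ?exprn_gt0 // -natrX ler_nat.
    by apply: (leq_trans lP); rewrite leq_exp2r // ltnW.
  have -> : 40 * N%:R / l%:R ^+ 2 * p%:R^-1 = 20 * N%:R / (p%:R * l%:R ^+ 2 / 2) :> R.
    by field; rewrite !gt_eqF.
  rewrite ler_wpM2l ?mulr_ge0 // lef_pV2 ?posrE ?divr_gt0 ?mulr_gt0 ?exprn_gt0 //.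
  rewrite ler_pdivrMr // -!natrX -!natrM ler_nat -expnSr ltnW //; exact: trunc_log_ltn.
rewrite big_split /= -!mulr_sumr; apply: lerD.
  by rewrite ler_wpM2l ?mulr_ge0 // sum_inv_sq.
apply: (@le_trans _ _ (40 * N%:R / l%:R ^+ 2 * l%:R)).
  by rewrite ler_wpM2l ?divr_ge0 ?mulr_ge0 ?exprn_ge0 // sum_inv_le.
rewrite le_eqVlt; apply/orP; left; apply/eqP; field; by rewrite gt_eqF.
Qed.

(** For [e] and [e'] up to [p ^ 2 / l], [sigma_le] bounds [e * sigma e'] by
    [e * e' * l <= p ^ 4 / l], below the modulus. The lower bound on [e] gives [N / (p * l ^ 2)] for
    each [p]. *)
Lemma cnt_medium_divisor N l : (1 < l)%N -> (N < 2 ^ l)%N ->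
  (cnt N (fun n => exists p, [/\ prime p, (p ^ 4 <= N * l)%N, coprime p n, (p ^ 4 %| aliquot_sum n)%N &
     exists d e, [/\ n = (d * e)%N, coprime d e, odd e, sqfree e & (p * l ^ 2 < e)%N && (e * l <= p ^ 2)%N]]))%:R
  <= N%:R / l%:R :> R.
Proof.
move=> l1 Nl; have l0 : (0 < l)%N by apply: ltnW.
pose Q p n := [/\ coprime (p ^ 4) n, (p ^ 4 %| aliquot_sum n)%N &
    exists d e, [/\ n = (d * e)%N, coprime d e, odd e, sqfree e & (p * l ^ 2 < e <= p ^ 2 %/ l)%N]].
pose ps := [seq p <- index_iota 1 N.+1 | prime p && (p ^ 4 <= N * l)%N].
have H : (cnt N (fun n => exists p, [/\ prime p, (p ^ 4 <= N * l)%N, coprime p n, (p ^ 4 %| aliquot_sum n)%N &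
     exists d e, [/\ n = (d * e)%N, coprime d e, odd e, sqfree e & (p * l ^ 2 < e)%N && (e * l <= p ^ 2)%N]])
   <= \sum_(p <- ps) cnt N (Q p))%N.
  apply: cnt_ex => n /andP[n0 nN] [p [pp pNl cpn pn [d [e [nE c oe se /andP[e1 e2]]]]]].
  exists p.
    rewrite mem_filter pp pNl mem_index_iota prime_gt0 //= ltnS.
    apply: (leq_trans _ nN); rewrite nE; have d0 : (0 < d)%N by move: n0; rewrite nE muln_gt0 => /andP[].
    apply: (@leq_trans e); last by rewrite leq_pmull.
    by apply: (leq_trans _ (ltnW e1)); rewrite leq_pmulr // expn_gt0 l0.
  split=> //; first by rewrite coprimeXl.
  by exists d, e; split=> //; rewrite e1 leq_divRL.
have Qp p : p \in ps -> (cnt N (Q p) <= N %/ (p * l ^ 2))%N.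
  rewrite mem_filter => /andP[/andP[pp pNl] _]; have p0 := prime_gt0 pp.
  apply: cnt_unitary_divisor; first by rewrite muln_gt0 p0 expn_gt0 l0.
  move=> e e' /andP[e0 eE] /andP[e0' eE'].
  have e'N : (e' < 2 ^ l)%N.
    apply: leq_ltn_trans Nl; apply: (leq_trans eE').
    rewrite -(@leq_pmul2r l) //; apply: (leq_trans (leq_trunc_div _ _)).
    have Nl0 : (0 < N * l)%N by apply: leq_trans pNl; rewrite expn_gt0 p0.
    rewrite -leq_sqr -expnM (leq_trans pNl) // -mulnn; exact: leq_pmulr.
  have tl : (trunc_log 2 e' < l)%N by rewrite -(@ltn_exp2l 2) // (leq_ltn_trans _ e'N) // trunc_logP.
  apply: (@leq_ltn_trans (e * (e' * l))).
    by rewrite leq_mul2l; apply/orP; right; apply: (leq_trans (sigma_le e0')); rewrite leq_mul2l tl orbT.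
  apply: (@leq_ltn_trans (p ^ 2 %/ l * p ^ 2)).
    apply: leq_mul => //; rewrite -leq_divRL //.
  by rewrite (expnD p 2 2) ltn_mul2r expn_gt0 p0 /= ltn_Pdiv // expn_gt0 p0.
apply: (le_trans (y := (\sum_(p <- ps) cnt N (Q p))%N%:R)); first by rewrite ler_nat.
rewrite natr_sum; apply: (@le_trans _ _ (\sum_(p <- ps) N%:R / l%:R ^+ 2 * p%:R^-1)).
  rewrite big_seq [leRHS]big_seq; apply: ler_sum => p pps.
  apply: (@le_trans _ _ (N %/ (p * l ^ 2))%:R); first by rewrite ler_nat Qp.
  have p0 : (0 < p)%N by move: pps; rewrite mem_filter => /andP[/andP[/prime_gt0]].
  have d0 : (0 < p * l ^ 2)%N by rewrite muln_gt0 p0 expn_gt0 l0.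
  by apply: (le_trans (divn_le_div R N d0)); rewrite natrM natrX invfM; rewrite mulrCA mulrC.
rewrite big_filter.
apply: (@le_trans _ _ (\sum_(1 <= p < N.+1) N%:R / l%:R ^+ 2 * p%:R^-1)).
  rewrite big_mkcond; apply: ler_sum => p _; case: ifP => // _.
  by rewrite !mulr_ge0 ?invr_ge0 ?exprn_ge0.
rewrite -mulr_sumr; apply: (@le_trans _ _ (N%:R / l%:R ^+ 2 * l%:R)).
  by rewrite ler_wpM2l ?divr_ge0 ?exprn_ge0 // sum_inv_le.
rewrite le_eqVlt; apply/orP; left; apply/eqP; field; by rewrite pnatr_eq0 -lt0n.
Qed.
End TopCounts.

(** * Large primes [p]: case analysis and choice of parameters *)

Section TopRange.

Lemma coprime_no_prime d e : 0 < e -> (forall r, prime r -> r %| d -> r %| e -> False) -> coprime d e.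
Proof.
move=> e0 H; rewrite /coprime eqn_leq gcdn_gt0 e0 orbT andbT leqNgt; apply/negP => g1.
have rp := pdiv_prime g1; have := pdiv_dvd (gcdn d e); rewrite dvdn_gcd => /andP[].
exact: H.
Qed.

Lemma rough_unitary m n e : 1 < m -> 0 < n -> (forall d, m < d -> ~~ (d ^ 2 %| n)) -> e %| n ->
  (forall r, prime r -> r %| e -> m < r) -> [/\ coprime (n %/ e) e, odd e & sqfree e].
Proof.
move=> m1 n0 H en He; have e0 := dvdn_gt0 n0 en; split.
- apply: coprime_no_prime => // r rp rd re; move/negP: (H r (He r rp re)); apply.
  by rewrite -(divnK en) -mulnn dvdn_mul.
- rewrite -[odd e]negbK -dvdn2; apply/negP => /(He 2 isT).
  by rewrite ltnNge m1.
move=> r rp; apply/negP => re; have re1 : r %| e by rewrite (dvdn_trans _ re) // dvdn_exp.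
by move/negP: (H r (He r rp re1)); apply; apply: dvdn_trans en.
Qed.

Lemma aliquot_sum_gt0 n : 1 < n -> 0 < aliquot_sum n.
Proof. by move=> n1; rewrite /aliquot_sum big_mkcond big_ltn // dvd1n. Qed.

(** If no prime factor of [n] exceeds [p * l ^ 2], then [q1] forces [p >= B * l ^ 3]. A prime factor
    [Q > p / l ^ 3] may itself be too small to serve as [e]; the auxiliary prime [q0], between
    [A >= l ^ 5] and [B], corrects this: [q0 * Q] lies above [p * l ^ 2] and at most at [p ^ 2 / l].
    If all prime factors are at most [p / l ^ 3], a minimal divisor of the part of [n] free of
    primes up to [m] is fine enough. *)
Lemma top_cases m N l A B n p q0 q1 :
  1 < m -> m <= l -> l <= N -> N < 2 ^ l -> l ^ 5 <= A -> 2 * m ^ 3 <= A ->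
  l ^ 13 * (m ^ (3 * m.+1)) ^ 4 <= N ^ 3 ->
  1 < n <= N -> (forall d, m < d -> ~~ (d ^ 2 %| n)) -> N < n * l ->
  prime q0 -> q0 %| n -> A < q0 <= B ->
  prime q1 -> q1 %| n -> B * l ^ 5 <= q1 ->
  (forall p q, prime p -> prime q -> B < p -> p %| q.+1 -> ~~ (p * q %| n)) ->
  prime p -> p ^ 4 %| aliquot_sum n ->
  p <= N /\ (has_prime_in (p * l ^ 2) N n \/
   [/\ p ^ 4 <= N * l, coprime p n &
     exists d e, [/\ n = d * e, coprime d e, odd e, sqfree e & (p * l ^ 2 < e) && (e * l <= p ^ 2)]]).
Proof.
move=> m1 ml lN Nl lA mA HK /andP[n1 nN] Hsq nl p0 q0n /andP[Aq0 q0B] pq1 q1n Bq1 H5 pp ps.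
have n0 : 0 < n by apply: ltnW.
have l0 : 0 < l by rewrite (leq_trans _ ml) // ltnW.
have P0 := prime_gt0 pp.
have mA' : m <= A.
  by apply: leq_trans mA; rewrite (leq_trans _ (leq_pmull _ _)) // -{1}(expn1 m) leq_pexp2l // ltnW.
have p4 : p ^ 4 <= N * l.
  apply: (leq_trans (dvdn_leq (aliquot_sum_gt0 n1) ps)).
  apply: (@leq_trans (sigma n)); first by rewrite sigmaE // leq_addr.
  apply: (leq_trans (sigma_le n0)); apply: leq_mul => //.
  by rewrite -(@ltn_exp2l 2) // (leq_ltn_trans _ Nl) // (leq_trans _ nN) // trunc_logP.
have pN : p <= N.
  rewrite leqNgt; apply/negP => Np.
  have : p ^ 2 <= p ^ 4 by rewrite leq_pexp2l.
  rewrite leqNgt => /negP; apply; apply: (leq_ltn_trans p4).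
  by rewrite -mulnn; apply: (leq_ltn_trans (leq_mul (leqnn N) lN)); rewrite ltn_mul.
split=> //.
have [[q [pq qn plq]]|nQ] := pselect (exists q, [/\ prime q, q %| n & p * l ^ 2 < q]).
  left; exists (n %/ q), q; split=> //; first by rewrite divnK.
    rewrite coprime_sym prime_coprime //; apply/negP => qq.
    have mq : m < q.
      apply: leq_ltn_trans plq; apply: (leq_trans ml).
      by rewrite -{1}(mul1n l) leq_mul // -{1}(expn1 l) leq_pexp2l.
    by move/negP: (Hsq _ mq); apply; rewrite -(divnK qn) -mulnn dvdn_mul.
  by rewrite plq (leq_trans (dvdn_leq n0 qn)).
right.
have Hall q : prime q -> q %| n -> q <= p * l ^ 2.
  by move=> pq qn; rewrite leqNgt; apply/negP => H; apply: nQ; exists q.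
have B0 : 0 < B by apply: leq_trans q0B; apply: leq_ltn_trans Aq0.
have Bp : B * l ^ 3 <= p.
  have := leq_trans Bq1 (Hall _ pq1 q1n).
  by rewrite (expnD l 3 2) mulnA leq_pmul2r // expn_gt0 l0.
have AB : A < B by apply: leq_trans q0B.
have Bp' : B < p.
  rewrite ltnNge; apply/negP => pB; have l2 : 2 <= l ^ 3.
    by apply: (@leq_trans (l ^ 1)); [rewrite expn1 (leq_trans m1)|rewrite leq_pexp2l].
  have := leq_trans (leq_trans (leq_mul (leqnn B) l2) Bp) pB.
  by rewrite -{2}(muln1 B) leq_pmul2l.
have cpn : coprime p n.
  rewrite prime_coprime //; apply/negP => pn.
  have psg : p %| sigma n.
    by rewrite sigmaE // dvdn_addl // (dvdn_trans _ ps) // dvdn_exp.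
  have mp : 2 * m ^ 3 < p by apply: (leq_ltn_trans mA); apply: ltn_trans AB Bp'.
  have [q [pq pq1' pqn]] := common_prime_sigma n0 pp Hsq mp pn psg.
  by move/negP: (H5 p q pp pq Bp' pq1').
split=> //.
have l20 : 0 < l ^ 2 by rewrite expn_gt0 l0.
have l30 : 0 < l ^ 3 by rewrite expn_gt0 l0.
have [[Q [pQ Qn pQl]]|nQl] := pselect (exists Q, [/\ prime Q, Q %| n & p < Q * l ^ 3]).
  have BQ : B < Q by rewrite -(@ltn_pmul2r (l ^ 3)) // (leq_ltn_trans Bp).
  have q0Q : q0 < Q by apply: leq_ltn_trans BQ.
  have en : q0 * Q %| n.
    by rewrite Gauss_dvd ?q0n // prime_coprime // dvdn_prime2 // neq_ltn q0Q.
  have He r : prime r -> r %| q0 * Q -> m < r.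
    move=> rp; rewrite Euclid_dvdM // !dvdn_prime2 // => /orP[/eqP ->|/eqP ->].
      exact: leq_ltn_trans Aq0.
    by apply: leq_ltn_trans (ltn_trans AB BQ).
  have [c o sq] := rough_unitary m1 n0 Hsq en He.
  exists (n %/ (q0 * Q)), (q0 * Q); split=> //; first by rewrite divnK.
  apply/andP; split.
    rewrite -(@ltn_pmul2r (l ^ 3)) // -[q0 * Q * _]mulnA -[p * _ * _]mulnA -expnD mulnC.
    by apply: ltn_mul => //; apply: leq_ltn_trans Aq0.
  apply: (@leq_trans (B * (p * l ^ 2) * l)).
    by rewrite leq_mul2r leq_mul ?orbT // Hall.
  by rewrite mulnCA -[p * _ * _]mulnA -mulnA -expnSr -mulnn leq_mul2l Bp orbT.
have Hall3 q : prime q -> q %| n -> q * l ^ 3 <= p.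
  by move=> pq qn; rewrite leqNgt; apply/negP => H; apply: nQl; exists q.
pose pi : nat_pred := [pred q | m < q].
have nE := partnC pi n0.
(* Otherwise [N < p * l ^ 3 * K], against [p ^ 4 <= N * l]: in fourth powers this contradicts
   [HK]. *)
have piB : p * l ^ 2 < n`_pi.
  have AK : n`_pi^' <= m ^ (3 * m.+1).
    rewrite (@eq_partn _ [pred q | q <= m]); first exact: smooth_part_le.
    by move=> q; rewrite !inE -leqNgt.
  rewrite ltnNge; apply/negP => Bpl.
  set K := m ^ (3 * m.+1) in AK HK.
  have N1 : N < p * l ^ 3 * K.
    apply: (leq_trans nl); rewrite -nE expnSr mulnA [_ * l * K]mulnAC leq_mul2r.
    by rewrite leq_mul ?orbT.
  have : N ^ 4 < (p * l ^ 3 * K) ^ 4 by rewrite ltn_exp2r.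
  have E1 : (p * l ^ 3 * K) ^ 4 = p ^ 4 * (l ^ 12 * K ^ 4).
    by rewrite expnMn (expnMn p) -(expnM l 3 4) -mulnA.
  have E2 : N * l * (l ^ 12 * K ^ 4) = N * (l ^ 13 * K ^ 4) by rewrite (expnS l 12) -!mulnA.
  rewrite ltnNge E1 => /negP; apply; apply: (leq_trans (leq_mul p4 (leqnn _))).
  by rewrite E2 (expnS N 3) leq_mul2l HK orbT.
have pB0 : 0 < n`_pi by rewrite part_gt0.
have pl0 : 0 < p * l ^ 2 by rewrite muln_gt0 P0.
have Hq q : prime q -> q %| n`_pi -> q * l ^ 3 <= p.
  by move=> pq qB; apply: Hall3 => //; rewrite -nE dvdn_mulr.
have [e [eB ple el]] := minimal_divisor pB0 pl0 piB Hq.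
have en : e %| n by rewrite -nE dvdn_mulr.
have He r : prime r -> r %| e -> m < r.
  move=> rp re; have := part_pnat pi n; rewrite /pnat pB0 /= => /allP/(_ r).
  by rewrite mem_primes rp pB0 (dvdn_trans re eB) => /(_ isT).
have [c o sq] := rough_unitary m1 n0 Hsq en He.
exists (n %/ e), e; split=> //; first by rewrite divnK.
rewrite ple -(@leq_pmul2r (l ^ 2)) //= -mulnA -expnS (leq_trans el) //.
by rewrite mulnAC mulnn.
Qed.

Lemma log_small C : exists L0, forall L, L0 <= L -> C * (trunc_log 2 L.+1).+1 <= L.
Proof.
exists (2 ^ (2 * C + 5)) => L HL; set k := (trunc_log 2 L.+1).+1.
have k5 : 2 * C + 5 < k.
  by rewrite ltnS; apply: trunc_log_max => //; apply: leqW.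
have kL : 2 ^ k <= 2 * L.+1 by rewrite expnS leq_mul2l /= trunc_logP.
have : k ^ 2 + 2 <= 2 ^ k.
  have : 5 <= k by apply: leq_trans (ltnW k5); rewrite leq_addl.
  move: k {kL k5}; elim=> // k IH; rewrite leq_eqVlt => /predU1P[<- //|k5].
  have := IH k5; have : 5 * k <= k * k by apply: leq_mul.
  have -> : k.+1 ^ 2 = k * k + 2 * k + 1 by rewrite -mulnn; ring.
  rewrite (expnS 2 k) -mulnn; move: (2 ^ k) (k * k) => x y; lia.
rewrite -mulnn => H.
have : 2 * C * k <= k * k by rewrite leq_mul2r (leq_trans _ (ltnW k5)) ?orbT // leq_addr.
lia.
Qed.

Variable R : realType.

Lemma top_range (eps : R) : (0 < eps)%R -> exists N0, forall N, N0 <= N -> forall P, N < 2 ^ (P ^ 2) ->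
  ((cnt N (fun n => (1 < n)%N /\ exists p, [/\ prime p, (P < p)%N & (p ^ 4 %| aliquot_sum n)%N]))%:R
   <= eps * N%:R)%R.
Proof.
move=> eps0.
(* The seven exceptional sets below cost 1, 1, 6, 6, 2, 45 and 1 times [N / m], in total 62. *)
have [m0 Hm0] : exists m0 : nat, (62 / eps < m0%:R)%R.
  by exists (Num.bound (62 / eps)%R); apply: archi_boundP; rewrite divr_ge0 // ltW.
pose m := m0 + 14; have m14 : 14 <= m by rewrite leq_addl.
have Hm : (62 / eps < m%:R :> R)%R by apply: (lt_le_trans Hm0); rewrite ler_nat leq_addr.
pose K := m ^ (3 * m.+1); pose D := 4 ^ m.
have D0 : 0 < D by rewrite expn_gt0.
(* A single constant that dominates every requirement of the form [x * k <= L] made below. *)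
pose C := D * (D * 5 + 5 + 15) + m ^ 2 + 13 + 4 * (trunc_log 2 K).+1 + 4 * m.
have [L0 HL0] := log_small C.
exists (2 ^ (L0 + 1)) => N HN P NP.
have N0 : 0 < N by apply: leq_trans HN; rewrite expn_gt0.
pose L := trunc_log 2 N; pose l := L.+1; pose k := (trunc_log 2 l).+1.
have L0L : L0 <= L.
  by apply: (@leq_trans (L0 + 1)); [rewrite leq_addr|apply: trunc_log_max].
have CL : C * k <= L by exact: HL0.
have k0 : 0 < k by [].
have NL : 2 ^ L <= N by exact: trunc_logP.
have Nl : N < 2 ^ l by exact: trunc_log_ltn.
have lk : l < 2 ^ k by exact: trunc_log_ltn.
have CL1 x : x <= C -> x * k <= L by move=> xC; apply: leq_trans CL; rewrite leq_mul2r xC orbT.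
have CL2 x : x <= C -> x <= L.
  by move=> xC; apply: leq_trans (CL1 x xC); rewrite leq_pmulr.
have mL : m ^ 2 <= L by apply: CL2; rewrite /C; clear -R; lia.
have ml : m <= l by apply: leqW; apply: leq_trans mL; rewrite -mulnn leq_pmulr // (leq_trans _ m14).
have lN : l <= N by apply: leq_trans NL; exact: ltn_expl.
have k4 : 4 <= k.
  by rewrite ltnS; apply: trunc_log_max => //; apply: leq_trans ml; apply: leq_trans m14.
(* As [l < 2 ^ k], the choice of [a] gives [2 ^ a >= l ^ 5]. The windows for [q0] and [q1] both
   multiply the exponent by [D = 4 ^ m], hence have reciprocal sum at least [m / 2]; the second ends
   below [N]. *)
pose a := 5 * k; pose b := D * a; pose v := L %/ D.
have a14 : 14 <= a by rewrite /a; clear -k4; lia.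
have v14 : 14 <= v.
  by rewrite leq_divRL //; apply: CL2; rewrite /C; clear -R; lia.
have vb : b + a <= v.
  rewrite leq_divRL // /b /a; have := CL1 (D * (D * 5 + 5)); rewrite /C => H.
  apply: leq_trans (H _); clear -R; lia.
have bL : b <= L.
  apply: (@leq_trans v); last exact: leq_div.
  by apply: leq_trans vb; rewrite leq_addr.
have lA : l ^ 5 <= 2 ^ a by rewrite /a mulnC expnM leq_exp2r // ltnW.
have mA : 2 * m ^ 3 <= 2 ^ a.
  apply: (leq_trans _ lA); apply: (@leq_trans (m ^ 4)).
    by rewrite expnS leq_mul2r (leq_trans _ m14) ?orbT.
  by apply: (@leq_trans (l ^ 4)); [rewrite leq_exp2r|rewrite leq_pexp2l].
have HK : l ^ 13 * K ^ 4 <= N ^ 3.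
  have KK : K <= 2 ^ (trunc_log 2 K).+1 by apply: ltnW; apply: trunc_log_ltn.
  apply: (@leq_trans ((2 ^ k) ^ 13 * (2 ^ (trunc_log 2 K).+1) ^ 4)).
    by apply: leq_mul; rewrite leq_exp2r // ltnW.
  rewrite -!expnM -expnD; apply: (@leq_trans (2 ^ (L * 3))).
    rewrite leq_exp2l //; have := CL1 (13 + 4 * (trunc_log 2 K).+1); rewrite /C => H.
    have {}H : (13 + 4 * (trunc_log 2 K).+1) * k <= L by apply: H; clear -R; lia.
    move: (trunc_log 2 K) H => t H; clear -H; nia.
  by rewrite expnM leq_exp2r.
have lP : l <= P ^ 2 by rewrite -(@ltn_exp2l 2) // (leq_ltn_trans NL).
have mP : m <= P.
  rewrite leqNgt; apply/negP => Pm; have : P ^ 2 < m ^ 2 by rewrite ltn_exp2r.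
  by rewrite ltnNge (leq_trans _ lP) // leqW.
have P0 : 0 < P by apply: leq_trans mP; apply: leq_trans m14.
pose X1 n := n * l <= N.
pose X2 n := exists2 d, m < d & d ^ 2 %| n.
pose X3 n := forall q, prime q -> 2 ^ v < q <= 2 ^ (4 ^ m * v) -> ~~ (q %| n).
pose X4 n := forall q, prime q -> 2 ^ a < q <= 2 ^ (4 ^ m * a) -> ~~ (q %| n).
pose X5 n := exists p q, [/\ 2 ^ b < p, prime p, prime q, p %| q.+1 & p * q %| n].
pose Y1 n := exists p, [/\ P < p <= N, prime p, p ^ 4 %| aliquot_sum n & has_prime_in (p * l ^ 2) N n].
pose Y2 n := exists p, [/\ prime p, p ^ 4 <= N * l, coprime p n, p ^ 4 %| aliquot_sum n &
     exists d e, [/\ n = d * e, coprime d e, odd e, sqfree e & (p * l ^ 2 < e) && (e * l <= p ^ 2)]].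
have cover : cnt N (fun n => 1 < n /\ exists p, [/\ prime p, P < p & p ^ 4 %| aliquot_sum n]) <=
    cnt N X1 + (cnt N X2 + (cnt N X3 + (cnt N X4 + (cnt N X5 + (cnt N Y1 + cnt N Y2))))).
  have U A B x : cnt N B <= x -> cnt N (fun n => A n \/ B n) <= cnt N A + x.
    by move=> H; apply: (leq_trans (cnt_or _ _ _)); rewrite leq_add2l.
  apply: (leq_trans _ (U X1 _ _ (U X2 _ _ (U X3 _ _ (U X4 _ _ (U X5 _ _ (cnt_or N Y1 Y2))))))).
  apply: cnt_sub => n /andP[n0 nN] [n1 [p [pp Pp ps]]].
  have [|h1] := pselect (X1 n); [by left|right].
  have [|h2] := pselect (X2 n); [by left|right].
  have [|h3] := pselect (X3 n); [by left|right].
  have [|h4] := pselect (X4 n); [by left|right].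
  have [|h5] := pselect (X5 n); [by left|right].
  have [q1 [pq1 q1v q1n]] : exists q, [/\ prime q, 2 ^ v < q & q %| n].
    apply: contrapT => H; apply: h3 => q pq /andP[qv _]; apply/negP => qn.
    by apply: H; exists q.
  have [q0 [pq0 q0a q0n]] : exists q, [/\ prime q, 2 ^ a < q <= 2 ^ b & q %| n].
    by apply: contrapT => H; apply: h4 => q pq qab; apply/negP => qn; apply: H; exists q.
  have [pN [HY|[p4 cpn HY]]] : p <= N /\ (has_prime_in (p * l ^ 2) N n \/
   [/\ p ^ 4 <= N * l, coprime p n &
     exists d e, [/\ n = d * e, coprime d e, odd e, sqfree e & (p * l ^ 2 < e) && (e * l <= p ^ 2)]]).
    apply: (@top_cases m N l (2 ^ a) (2 ^ b) n p q0 q1) => //.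
    - exact: leq_trans m14.
    - by rewrite n1.
    - by move=> d md; apply/negP => dn; apply: h2; exists d.
    - by rewrite ltnNge; apply/negP.
    - apply: ltnW; apply: leq_ltn_trans q1v; apply: (@leq_trans (2 ^ (b + a))).
        by rewrite expnD leq_mul2l lA orbT.
      by rewrite leq_exp2l.
    - by move=> p' q' pp' pq' bp' pq1'; apply/negP => H; apply: h5; exists p', q'.
  - by left; exists p; split=> //; rewrite Pp.
  - by right; exists p; split.
have K1 : (cnt N X1 <= N %/ l).
  rewrite -[leqRHS](size_iota 1); apply: (@cnt_le_size _ _ _ id) => // n /andP[n0 _].
  by rewrite /X1 -leq_divRL // mem_iota add1n ltnS n0 => ->.
Local Open Scope ring_scope.
have l0' : 0 < l%:R :> R by rewrite ltr0n.
have m0' : 0 < m%:R :> R by rewrite ltr0n (leq_trans _ m14).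
have N0' : 0 <= N%:R :> R by [].
have inv_le (x : nat) : (m <= x)%N -> N%:R / x%:R <= N%:R / m%:R :> R.
  move=> mx; rewrite ler_wpM2l // lef_pV2 ?posrE // ?ler_nat // ltr0n.
  by apply: leq_trans mx; apply: leq_trans m14.
set z := N%:R / m%:R :> R; have z0 : 0 <= z by rewrite divr_ge0 // ltW.
have Z1 : (cnt N X1)%:R <= z :> R.
  apply: le_trans (inv_le _ ml); apply: (@le_trans _ _ (N %/ l)%:R); first by rewrite ler_nat.
  exact: divn_le_div.
have Z2 : (cnt N X2)%:R <= z :> R.
  by apply: cnt_square_factor; apply: leq_trans m14.
have npf w : (14 <= w)%N -> (4 ^ m * w <= L)%N ->
    (cnt N (fun n => forall q, prime q -> (2 ^ w < q <= 2 ^ (4 ^ m * w))%N -> ~~ (q %| n)%N))%:R <= 6 * z :> R.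
  move=> w14 wL; have PR := prime_recip_ge R m w14.
  have PR0 : 0 < prime_recip R (2 ^ w) (2 ^ (4 ^ m * w)) by apply: lt_le_trans PR; rewrite divr_gt0.
  have bN : (2 ^ (4 ^ m * w) <= N)%N by apply: leq_trans NL; rewrite leq_exp2l.
  apply: (le_trans (no_prime_factor bN PR0)).
  have -> : 6 * z = 3 * N%:R / (m%:R / 2) by rewrite /z; field; rewrite gt_eqF.
  by rewrite ler_wpM2l ?mulr_ge0 // lef_pV2 ?posrE ?divr_gt0.
have Z3 : (cnt N X3)%:R <= 6 * z :> R by apply: npf => //; rewrite mulnC leq_trunc_div.
have Z4 : (cnt N X4)%:R <= 6 * z :> R by apply: npf.
have Z5 : (cnt N X5)%:R <= 2 * z :> R.
  apply: (le_trans (cnt_common_prime R (expn_gt0 2 b) Nl)).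
  apply: (@le_trans _ _ (2 * (N%:R / l%:R))); last by rewrite ler_wpM2l // inv_le.
  rewrite -!mulrA !ler_wpM2l // ler_pdivrMr ?ltr0n ?expn_gt0 // ler_pdivlMl // -natrM ler_nat mulnn.
  apply: (@leq_trans (l ^ 5)); first by rewrite leq_pexp2l.
  by apply: (leq_trans lA); rewrite leq_exp2l // /b leq_pmull.
have Z6 : (cnt N Y1)%:R <= 45 * z :> R.
  apply: (le_trans (cnt_large_prime_factor R P0 (ltn0Sn _) Nl lP)).
  have := inv_le _ mP; have := inv_le _ ml.
  have -> : 5 * N%:R / P%:R = 5 * (N%:R / P%:R) :> R by ring.
  have -> : 40 * N%:R / l%:R = 40 * (N%:R / l%:R) :> R by ring.
  rewrite -/z; move: (N%:R / P%:R) (N%:R / l%:R) => x y; lra.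
have l1 : (1 < l)%N by apply: leq_trans ml; apply: leq_trans m14.
have Z7 : (cnt N Y2)%:R <= z :> R.
  by apply: (le_trans (cnt_medium_divisor R l1 Nl)); exact: inv_le.
apply: (le_trans (y := (cnt N X1 + (cnt N X2 + (cnt N X3 + (cnt N X4 + (cnt N X5 + (cnt N Y1 + cnt N Y2))))))%N%:R)).
  by rewrite ler_nat.
have zE : 62 * z <= eps * N%:R.
  rewrite /z mulrCA (mulrC eps) ler_wpM2l // ler_pdivrMr // mulrC -ler_pdivrMr // ltW //.
rewrite !natrD; move: Z1 Z2 Z3 Z4 Z5 Z6 Z7 zE.
move: (cnt N X1)%:R (cnt N X2)%:R (cnt N X3)%:R (cnt N X4)%:R (cnt N X5)%:R (cnt N Y1)%:R (cnt N Y2)%:R (eps * N%:R).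
move=> x1 x2 x3 x4 x5 x6 x7 y; lra.
Qed.
End TopRange.

(** * From prime powers to [k]-freeness and density *)

Lemma not_kfree_prime k n : ~ kfree k n -> exists2 p, prime p & p ^ k %| n.
Proof.
move=> nk; apply: contrapT => H; apply: nk => d d1; apply/negP => dn; apply: H.
exists (pdiv d); first exact: pdiv_prime.
by apply: dvdn_trans dn; rewrite dvdn_exp2r // pdiv_dvd.
Qed.

Lemma not_kfree k n p : prime p -> p ^ k %| n -> ~ kfree k n.
Proof. by move=> pp pn /(_ p (prime_gt1 pp)); rewrite pn. Qed.

Section Main.
Variable R : realType.
Local Open Scope ring_scope.

Lemma dvd_sigma_uniform k (s : seq nat) (e : R) : all prime s -> 0 < e ->
  exists N0, forall N, (N0 <= N)%N -> forall p, p \in s ->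
  (cnt N (fun n => ~~ (p ^ k %| sigma n)%N))%:R <= e * N%:R.
Proof.
move=> + e0; elim: s => [|q s IH] /=; first by exists 0%N.
case/andP=> pq /IH[N1 H1]; have [N2 H2] := @dvd_sigma_almost_all R q k e pq e0.
exists (N1 + N2)%N => N HN p; rewrite inE => /predU1P[->|ps].
  by apply: H2; apply: leq_trans HN; rewrite leq_addl.
by apply: H1 ps; apply: leq_trans HN; rewrite leq_addr.
Qed.

Definition agree k n := kfree k n <-> kfree k (aliquot_sum n).

(** For [p <= y] with [p ^ k %| sigma n], [p ^ k] divides both [n] and [s(n)] or neither. A larger
    [p] yields a large square factor of [n] or a fourth power dividing [s(n)]. *)
Lemma disagree_cover k y n : (3 < k)%N -> (1 < n)%N -> ~ agree k n ->
  [\/ exists2 d, (y < d)%N & (d ^ 2 %| n)%N,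
      exists2 p, p \in [seq p <- iota 0 y.+1 | prime p] & ~~ (p ^ k %| sigma n)%N |
      exists p, [/\ prime p, (y < p)%N & (p ^ 4 %| aliquot_sum n)%N]].
Proof.
move=> k3 n1 nagree; have n0 : (0 < n)%N by apply: ltnW.
have small p : prime p -> (p <= y)%N -> ~ (exists2 p, p \in [seq p <- iota 0 y.+1 | prime p] & ~~ (p ^ k %| sigma n)%N) ->
    (p ^ k %| aliquot_sum n)%N = (p ^ k %| n)%N.
  move=> pp py H; have : (p ^ k %| sigma n)%N.
    apply/negPn/negP => pn; apply: H; exists p => //.
    by rewrite mem_filter pp mem_iota add0n ltnS.
  rewrite sigmaE // => H1; apply/idP/idP => H2.
    by rewrite -(dvdn_addr _ H2).
  by rewrite -(dvdn_addl _ H2).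
have [|h1] := pselect (exists2 d, (y < d)%N & (d ^ 2 %| n)%N); first by constructor 1.
have [|h2] := pselect (exists2 p, p \in [seq p <- iota 0 y.+1 | prime p] & ~~ (p ^ k %| sigma n)%N).
  by constructor 2.
constructor 3; apply: contrapT => h3; apply: nagree.
have large p : prime p -> (p ^ k %| n)%N || (p ^ k %| aliquot_sum n)%N -> (p <= y)%N.
  move=> pp; rewrite leqNgt => pn; apply/negP => yp; case/orP: pn => pn.
    by apply: h1; exists p => //; apply: dvdn_trans pn; rewrite dvdn_exp2l // ltnW // ltnW.
  by apply: h3; exists p; split=> //; apply: dvdn_trans pn; rewrite dvdn_exp2l.
split=> Hk; apply: contrapT => /not_kfree_prime[p pp pn]; apply: (not_kfree pp _ Hk).
  by rewrite -(small p) // (large p) // pn orbT.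
by rewrite (small p) // (large p) // pn.
Qed.

Lemma scale_unbounded N r : (0 < r)%N -> exists J, (N < 2 ^ (scale (2 ^ J * r) ^ 2))%N.
Proof.
move=> r0; exists N; apply: (@leq_trans (2 ^ N)); first exact: ltn_expl.
rewrite leq_exp2l //; apply: (@leq_trans (scale (2 ^ N * r))); last first.
  by rewrite -mulnn leq_pmulr // scale_gt0.
apply: leq_trans (scale_ge _); apply: (@leq_trans (2 ^ N)); first by rewrite ltnW // ltn_expl.
by rewrite mulnCA leq_pmulr // muln_gt0.
Qed.

Lemma cnt_disagree k (eps : R) : (3 < k)%N -> 0 < eps ->
  exists N0, forall N, (N0 <= N)%N -> (cnt N (fun n => ~ agree k n))%:R <= eps * N%:R.
Proof.
move=> k3 eps0; pose e := eps / 6.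
have e0 : 0 < e by rewrite divr_gt0.
pose r := (Num.bound (40 / e) + 4)%N.
have r3 : (3 < r)%N by rewrite /r addn4.
have rE : 40 / e < r%:R :> R.
  apply: (@lt_le_trans _ _ (Num.bound (40 / e))%:R); last by rewrite ler_nat leq_addr.
  by apply: archi_boundP; rewrite divr_ge0 // ltW.
have r0 : 0 < r%:R :> R by rewrite ltr0n (leq_trans _ r3).
pose y := scale r; pose ps := [seq p <- iota 0 y.+1 | prime p].
have y0 : (0 < y)%N by exact: scale_gt0.
(* There are at most [y + 1] primes in [ps], and each may fail for a proportion [d]. The threshold
   [y] is fixed before [N]. *)
pose d := e / y.+1%:R.
have d0 : 0 < d by rewrite divr_gt0.
have pps : all prime ps by apply/allP => p; rewrite mem_filter => /andP[].
have [N1 H1] := @dvd_sigma_uniform k ps d pps d0.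
have [N2 H2] := @top_range R e e0.
exists (N1 + N2 + (Num.bound (e^-1)))%N => N HN.
have HN1 : (N1 <= N)%N by apply: leq_trans HN; rewrite -addnA leq_addr.
have HN2 : (N2 <= N)%N by apply: leq_trans HN; rewrite addnAC leq_addl.
have eN : 1 <= e * N%:R.
  rewrite -ler_pdivrMl // mulr1; apply: ltW; apply: (@lt_le_trans _ _ (Num.bound e^-1)%:R).
    by apply: archi_boundP; rewrite invr_ge0 ltW.
  by rewrite ler_nat; apply: leq_trans HN; rewrite leq_addl.
(* Minimality puts all batches before [J] below [N], while [N < 2 ^ (P ^ 2)] is what [top_range]
   asks of [P = scale (2 ^ J * r)]; no prime is left between the two ranges. *)
have [J NJ Jmin] := ex_minnP (scale_unbounded N (leq_trans (isT : (0 < 4)%N) r3)).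
have HJ j : (j < J)%N -> (2 ^ (scale (2 ^ j * r) ^ 2) <= N)%N.
  by move=> jJ; rewrite leqNgt; apply/negP => /Jmin; rewrite leqNgt jJ.
pose P := scale (2 ^ J * r).
pose X1 n := exists2 d, (y < d)%N & (d ^ 2 %| n)%N.
pose X2 n := exists2 p, p \in ps & ~~ (p ^ k %| sigma n)%N.
pose X3 n := exists p, [/\ prime p, (y < p <= P)%N & (p ^ 4 %| aliquot_sum n)%N].
pose X4 n := (1 < n)%N /\ exists p, [/\ prime p, (P < p)%N & (p ^ 4 %| aliquot_sum n)%N].
have cover : (cnt N (fun n => ~ agree k n) <=
    cnt N (fun n => n <= 1)%N + (cnt N X1 + (\sum_(p <- ps) cnt N (fun n => ~~ (p ^ k %| sigma n)%N)
    + (cnt N X3 + cnt N X4))))%N.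
  (* The integer 1 is set apart because [aliquot_sum 1 = 0] is divisible by every fourth power. *)
  apply: (@leq_trans (cnt N (fun n => (n <= 1)%N \/ (X1 n \/ (X2 n \/ (X3 n \/ X4 n)))))).
    apply: cnt_sub => n /andP[n0 _] nag; have [|n1] := leqP n 1; [by left|right].
    case: (disagree_cover y k3 n1 nag) => [||[p [pp yp pn]]]; [by left|by right; left|].
    by have [pP|Pp] := leqP p P; right; right; [left; exists p; rewrite yp|right; split=> //; exists p].
  apply: (leq_trans (cnt_or _ _ _)); rewrite leq_add2l.
  apply: (leq_trans (cnt_or _ _ _)); rewrite leq_add2l.
  apply: (leq_trans (cnt_or _ _ _)); apply: leq_add; last exact: cnt_or.
  exact: cnt_ex.
have Z0 : (cnt N (fun n => n <= 1)%N)%:R <= e * N%:R.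
  apply: le_trans eN; rewrite -[leRHS]/(1%:R) ler_nat.
  rewrite -[leqRHS]/(size [:: 1%N]); apply: (@cnt_le_size _ _ _ id) => // n /andP[n0 _] n1.
  by rewrite inE eqn_leq n1.
have N0 : 0 <= N%:R :> R by [].
have Z1 : (cnt N X1)%:R <= e * N%:R.
  apply: (le_trans (cnt_square_factor R N y0)); rewrite mulrC ler_wpM2r //.
  have ry : r%:R <= y%:R :> R.
    by rewrite ler_nat (leq_trans _ (scale_ge r)) // leq_pmull.
  have e40 : 40 < e * r%:R by rewrite -ltr_pdivrMl // mulrC.
  have er : e * r%:R <= e * y%:R by rewrite ler_pM2l.
  rewrite -[y%:R^-1]mul1r ler_pdivrMr ?ltr0n //; lra.
have Z2 : (\sum_(p <- ps) cnt N (fun n => ~~ (p ^ k %| sigma n)%N))%N%:R <= e * N%:R.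
  rewrite natr_sum; apply: (@le_trans _ _ (\sum_(p <- ps) d * N%:R)).
    by rewrite big_seq [leRHS]big_seq; apply: ler_sum => p; exact: H1.
  rewrite big_const_seq count_predT iter_addr_0 -[leLHS]mulr_natr mulrAC ler_wpM2r //.
  rewrite /d mulrAC ler_pdivrMr // ler_wpM2l ?(ltW e0) // ler_nat.
  by rewrite -[leqRHS](size_iota 0) size_filter count_size.
have Z3 : (cnt N X3)%:R <= e * N%:R.
  apply: (le_trans (cnt_small_range R r3 HJ)).
  rewrite -mulrA mulrCA mulrC ler_wpM2r // ler_pdivrMr // mulrC -ler_pdivrMr // ltW //.
have Z4 : (cnt N X4)%:R <= e * N%:R by exact: H2.
apply: (le_trans (y := (cnt N (fun n => n <= 1)%N + (cnt N X1 + (\sum_(p <- ps) cnt N (fun n => ~~ (p ^ k %| sigma n)%N)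
    + (cnt N X3 + cnt N X4))))%N%:R)); first by rewrite ler_nat.
rewrite !natrD; have -> : eps * N%:R = 6 * (e * N%:R) by rewrite /e; field.
move: Z0 Z1 Z2 Z3 Z4 eN; move: (e * N%:R) => z.
move: (cnt N _)%:R (cnt N X1)%:R (\sum_(p <- ps) _)%N%:R (cnt N X3)%:R (cnt N X4)%:R => a b c f g.
lra.
Qed.

Lemma has_density_one (S : set nat) :
  (forall eps : R, 0 < eps -> exists N0, forall N, (N0 <= N)%N ->
     (cnt N (fun n => ~ S n))%:R <= eps * N%:R) ->
  has_asymptotic_density S (1 : R).
Proof.
move=> H; apply/cvgrPdist_le => e e0; have [N0 HN] := H e e0.
exists N0.+1 => // N /= N0N; have NN : (N0 <= N)%N by apply: ltnW.
have N1 : 0 < N%:R :> R by rewrite ltr0n (leq_ltn_trans _ N0N).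
have E : N%:R - (counting_fun S N)%:R = (cnt N (fun n => ~ S n))%:R :> R.
  rewrite cntE /counting_fun natr_sum big_mkcond.
  have -> : N%:R = \sum_(1 <= n < N.+1) 1 :> R by rewrite big_const_nat subn1 iter_addr_0.
  rewrite -sumrB; apply: eq_bigr => n _.
  case: (boolP (n \in S)) => [|]; rewrite ?inE ?notin_setE => Sn.
    by rewrite subrr; case: asboolP.
  by rewrite subr0; case: asboolP.
have D : 1 - (counting_fun S N)%:R / N%:R = (N%:R - (counting_fun S N)%:R) / N%:R :> R.
  by rewrite mulrBl divff // gt_eqF.
rewrite D E.
by rewrite ger0_norm ?divr_ge0 // ler_pdivrMr // HN.
Qed.
End Main.

Theorem theorem1p2 (R : realType) (k : nat) (hk : 4 <= k) :
  exists S : set nat,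
    [/\ forall n : nat, S n -> 0 < n,
        has_asymptotic_density S (1%R : R)
      & forall n : nat, S n -> (kfree k n <-> kfree k (aliquot_sum n))].
Proof.
exists [set n : nat | 0 < n /\ agree k n]%classic; split=> [n []//||n []//].
apply: has_density_one => eps eps0; have [N0 HN] := cnt_disagree hk eps0.
exists N0 => N /HN; apply: le_trans; rewrite ler_nat; apply: cnt_sub => n /andP[n0 _] H ag.
by apply: H; split.
Qed.
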